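(* Let $X=T^*\mathbb{CP}^2$ with its Calabi hyperkähler structure $(g,(I,J,K))$, let $L\in\{I,J,K\}$, and let $A$ be an $\mathrm{SU}(3)$-invariant $L$-$\mathrm{SU}(4)$-instanton in temporal gauge on the $\mathrm{SO}(3)$-bundle $E_0\to X^*$, $X^*=X\setminus\mathbb{CP}^2$. Then $A$ extends across the zero section up to gauge if and only if $A$ is the (flat) canonical connection.
   Context: **Calabi structure.** $\mathrm{SU}(3)$ acts on $\mathbb{CP}^2$ in the standard way and hence on $X=T^*\mathbb{CP}^2$; $X^*$ is the complement of the zero section. Let $K_0=\{\mathrm{diag}(e^{i\theta},e^{i\theta},e^{-2i\theta})\}\cong\mathrm{U}(1)$ and $N_{1,1}=\mathrm{SU}(3)/K_0$. Write the left-invariant Maurer–Cartan form of $\mathrm{SU}(3)$ as $$\eta=\begin{bmatrix} i(\zeta+\kappa)&\nu&\sigma\\-\overline\nu&i(\zeta-\kappa)&\mu\\-\overline\sigma&-\overline\mu&-2i\zeta\end{bmatrix},\quad \nu=\nu_1+i\nu_2,\ \sigma=\sigma_1+i\sigma_2,\ \mu=\mu_1+i\mu_2,$$ which defines real left-invariant $1$-forms $\zeta,\kappa,\nu_j,\sigma_j,\mu_j$. There is an $\mathrm{SU}(3)$-equivariant diffeomorphism $X^*\cong(1,\infty)\times N_{1,1}$, with coordinate $r\in(1,\infty)$ and $r\to1$ at the zero section; forms on $X^*$ are identified with their pullbacks to $(1,\infty)\times\mathrm{SU}(3)$. Put $a=\sqrt{(r^2-1)/2}$, $b=\sqrt{(r^2+1)/2}$,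 $c=r$, $f=\frac1r\sqrt{r^4-1}$, $dt=\sqrt{r^4/(r^4-1)}\,dr$, and $e^0=dt$, $e^1=a\sigma_1$, $e^2=a\sigma_2$, $e^3=b\mu_1$, $e^4=b\mu_2$, $e^5=c\nu_1$, $e^6=c\nu_2$, $e^7=f\kappa$. On $X^*$ the Calabi metric is $g=\sum_{j=0}^7(e^j)^2$, with orientation $e^{0}\wedge e^1\wedge\cdots\wedge e^7$ and Kähler forms ($e^{ij}=e^i\wedge e^j$) $$\omega_I=-e^{07}+e^{56}+e^{12}-e^{34},\quad \omega_J=-e^{06}-e^{57}-e^{23}+e^{14},\quad \omega_K=e^{05}-e^{67}+e^{24}+e^{13}.$$ These extend smoothly to a complete $\mathrm{SU}(3)$-invariant hyperkähler structure on $X$. A connection $A$ with curvature $F_A$ is an $L$-$\mathrm{SU}(4)$-instanton, also called primitive Hermitian Yang-Mills with respect to $L$, if $\ast F_A=-\frac12\omega_L^2\wedge F_A$. **Bundle and connections.** $E_0=X^*\times\mathrm{SO}(3)=(1,\infty)\times N_{1,1}\times\mathrm{SO}(3)$ is the trivial principal $\mathrm{SO}(3)$-bundle with $\mathrm{SU}(3)$ acting on $X^*$ only. A connection on $E_0$ is in temporal gauge if its connection form has no $dr$ component. The canonical connection on $E_0$ is the product connection, which is flat. ''$A$ extends across the zero section up to gauge'' means that there is a principal $\mathrm{SO}(3)$-bundle over $X$ with a smooth connection whose restriction to $X^*$ is isomorphic, as a bundle with connection, to $(E_0,A)$. *)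

(* Defs.v *)
From HB Require Import structures.
From mathcomp Require Import all_boot all_order all_algebra.
From mathcomp Require Import sesquilinear spectral complex.
From mathcomp Require Import all_classical all_reals all_analysis.

Set Implicit Arguments.
Unset Strict Implicit.
Unset Printing Implicit Defensive.

Import Order.TTheory GRing.Theory Num.Theory.
Import numFieldNormedType.Exports.

Local Open Scope classical_set_scope.
Local Open Scope ring_scope.
Local Open Scope complex_scope.
Local Open Scope sesquilinear_scope.

(* Manifolds are subsets of finite-dimensional normed spaces, with the smooth
   structure induced by the ambient space: a map is smooth on S when it is
   locally the restriction of a smooth map defined on an open set.  By the
   Whitney embedding theorem this covers all (second countable, Hausdorff)
   manifolds. *)
Section Smooth.
Variable R : realType.

(* For V of finite dimension this is the class C^k on the open set U. *)
Fixpoint Ck (V W : normedModType R) (k : nat) (U : set V) (f : V -> W) : Prop :=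
  (forall x, U x -> {for x, continuous f}) /\
  (if k is k'.+1 then
     forall v, (forall x, U x -> derivable f x v) /\
               Ck k' U (fun x => 'D_v f x)
   else True).

Definition Cinfty (V W : normedModType R) (U : set V) (f : V -> W) : Prop :=
  forall k, Ck k U f.

Definition smooth_on (V W : normedModType R) (S : set V) (f : V -> W) : Prop :=
  forall x, S x -> exists (U : set V) (f' : V -> W),
    [/\ open U, U x, Cinfty U f' & forall y, S y -> U y -> f y = f' y].

Definition smooth_curve (V : normedModType R) (S : set V) (c : R -> V) : Prop :=
  exists I : set R,
    [/\ open I, I 0, Cinfty I c & forall t, I t -> S (c t)].

Definition velocity (V : normedModType R) (c : R -> V) : V := derive1 c 0.

Definition tangent (V : normedModType R) (S : set V) (x v : V) : Prop :=
  exists c : R -> V, [/\ smooth_curve S c, c 0 = x & velocity c = v].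

(* A W-valued 1-form on S is a function alpha : V -> V -> W; only the values
   alpha x v with x in S and v tangent to S at x are meaningful. *)
Definition local_extension (V W : normedModType R) (S : set V)
    (alpha : V -> V -> W) (x : V) (beta : V -> V -> W) : Prop :=
  exists U : set V,
    [/\ open U, U x,
        forall v, Cinfty U (beta^~ v),
        forall y, linear (beta y)
      & forall y v, S y -> U y -> tangent S y v -> alpha y v = beta y v].

Definition smooth_form (V W : normedModType R) (S : set V)
    (alpha : V -> V -> W) : Prop :=
  forall x, S x -> exists beta, local_extension S alpha x beta.

(* As d commutes with pull-back to S, the value on vectors tangent to S does
   not depend on the local extension. *)
Definition ext_deriv (V W : normedModType R) (S : set V)
    (alpha : V -> V -> W) (x u v : V) : W :=
  let beta := xget alpha [set b | local_extension S alpha x b] in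
  'D_u (beta^~ v) x - 'D_v (beta^~ u) x.

End Smooth.

Section Bundles.
Variable R : realType.
Local Notation M3 := 'M[R]_3.

Definition SO3 : set M3 := [set h | h^T *m h = 1%:M /\ \det h = 1].
Definition so3 : set M3 := [set xi | xi^T = - xi].

(* A principal SO(3)-bundle with base B, total space P, projection p and right
   action act. *)
Definition principal_bundle (V W : normedModType R) (B : set V) (P : set W)
    (p : W -> V) (act : W -> M3 -> W) : Prop :=
  [/\ smooth_on P p /\ (forall z, P z -> B (p z)),
      smooth_on (P `*` SO3) (fun zh : W * M3 => act zh.1 zh.2),
      forall z, P z -> act z 1%:M = z,
      forall z h k, P z -> SO3 h -> SO3 k ->
        [/\ P (act z h), p (act z h) = p z
          & act (act z h) k = act z (h *m k)]
    & forall x, B x ->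
        exists (U : set V) (triv : V * M3 -> W) (triv' : W -> V * M3),
          let D := (B `&` U) `*` SO3 in
          let Q := P `&` p @^-1` U in
          [/\ open U /\ U x,
              smooth_on D triv /\ smooth_on Q triv',
              (forall d, D d -> Q (triv d) /\ triv' (triv d) = d),
              (forall z, Q z -> D (triv' z) /\ triv (triv' z) = z)
            & forall y h k, D (y, h) -> SO3 k ->
                p (triv (y, h)) = y /\
                triv (y, h *m k) = act (triv (y, h)) k]].

Definition principal_connection (W : normedModType R) (P : set W)
    (act : W -> M3 -> W) (theta : W -> W -> M3) : Prop :=
  [/\ smooth_form P theta,
      forall z v, P z -> tangent P z v -> so3 (theta z v),
      (* theta (d/dt z.k(t)) = k'(0) for curves k through 1 in SO(3) *)
      (forall z (k : R -> M3), P z -> smooth_curve SO3 k -> k 0 = 1%:M ->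
         theta z (velocity (fun t => act z (k t))) = velocity k)
    & (* R_h^* theta = Ad(h^-1) theta *)
      forall (c : R -> W) h, smooth_curve P c -> SO3 h ->
        theta (act (c 0) h) (velocity (fun t => act (c t) h)) =
        h^T *m theta (c 0) (velocity c) *m h].

Definition bundle_connection_iso (V W W' : normedModType R)
    (P : set W) (p : W -> V) (act : W -> M3 -> W) (theta : W -> W -> M3)
    (P' : set W') (p' : W' -> V) (act' : W' -> M3 -> W')
    (theta' : W' -> W' -> M3) : Prop :=
  exists (Phi : W -> W') (Psi : W' -> W),
    [/\ smooth_on P Phi /\ smooth_on P' Psi,
        (forall z, P z -> [/\ P' (Phi z), Psi (Phi z) = z & p' (Phi z) = p z]),
        (forall z, P' z -> P (Psi z) /\ Phi (Psi z) = z),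
        (forall z h, P z -> SO3 h -> Phi (act z h) = act' (Phi z) h)
      & forall c : R -> W, smooth_curve P c ->
          theta' (Phi (c 0)) (velocity (Phi \o c)) =
          theta (c 0) (velocity c)].

(* d theta + 1/2 [theta, theta] *)
Definition curvature (W : normedModType R) (P : set W)
    (theta : W -> W -> M3) (z u v : W) : M3 :=
  ext_deriv P theta z u v +
  (theta z u *m theta z v - theta z v *m theta z u).

End Bundles.

(* Exterior algebra on e^0, ..., e^7 with coefficients in a real vector space:
   a form is given by its coefficients on the basis
   e^S = e^{i_1} /\ ... /\ e^{i_k}, S = {i_1 < ... < i_k}. *)
Section Exterior.
Variable R : realType.

Definition extalg (W : lmodType R) := {ffun {set 'I_8} -> W}.

(* e^S /\ e^T = shuffle_sign S T e^{S u T} for S and T disjoint *)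
Definition shuffle_sign (S T : {set 'I_8}) : R :=
  (-1) ^+ #|[set p : 'I_8 * 'I_8 | [&& p.1 \in S, p.2 \in T & (p.2 < p.1)%N]]%SET|.

Definition wedge (W : lmodType R) (alpha : extalg R^o) (beta : extalg W) :
    extalg W :=
  [ffun S : {set 'I_8} => \sum_(T : {set 'I_8} | T \subset S)
     (shuffle_sign T (S :\: T) * alpha T) *: beta (S :\: T)].

(* Hodge star for which e^0, ..., e^7 is an oriented orthonormal coframe:
   *e^T = shuffle_sign T (~: T) e^{~: T}. *)
Definition hodge (W : lmodType R) (beta : extalg W) : extalg W :=
  [ffun S : {set 'I_8} => shuffle_sign (~: S) S *: beta (~: S)].

Definition e1 (i : 'I_8) : extalg R^o :=
  [ffun S : {set 'I_8} => (S == [set i]%SET)%:R].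

Definition e2 (i j : 'I_8) : extalg R^o := wedge (e1 i) (e1 j).

Definition two_form (W : lmodType R) (F : 'I_8 -> 'I_8 -> W) : extalg W :=
  [ffun S : {set 'I_8} =>
     \sum_(i < 8) \sum_(j < 8 | (i < j)%N) (e2 i j S : R) *: F i j].

Inductive complex_structure : Type := cI | cJ | cK.

Definition omega (L : complex_structure) : extalg R^o :=
  match L with
  | cI => - e2 0 7 + e2 5 6 + e2 1 2 - e2 3 4
  | cJ => - e2 0 6 - e2 5 7 - e2 2 3 + e2 1 4
  | cK => e2 0 5 - e2 6 7 + e2 2 4 + e2 1 3
  end.

End Exterior.

Section Calabi.
Variable R : realType.
Local Notation M3 := 'M[R]_3.
Local Notation C3 := 'M[R[i]]_3.

(* Complex matrices as a real normed space, by real and imaginary parts. *)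
Definition CM : normedModType R := (M3 * M3)%type.
Definition cplx (z : CM) : C3 := \matrix_(i, j) (z.1 i j +i* z.2 i j).
Definition uncplx (m : C3) : CM :=
  (map_mx (@complex.Re R) m, map_mx (@complex.Im R) m).

Definition SU3 : set CM :=
  [set g | cplx g \is unitarymx /\ \det (cplx g) = 1].

Definition conj_by (g : CM) (m : C3) : CM :=
  uncplx (cplx g *m m *m (cplx g)^t*).

(* A line in C^3 is identified with the orthogonal projector p onto it, and a
   covector at p, in Hom(C^3/im p, im p), with a matrix q such that
   p q = q and q p = 0. *)
Definition TCP2 : set (CM * CM) :=
  [set x | let p := cplx x.1 in let q := cplx x.2 in
    [/\ p *m p = p, p^t* = p, \tr p = 1, p *m q = q & q *m p = 0]].

Definition TCP2_star : set (CM * CM) := TCP2 `&` [set x | x.2 != 0].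

Definition su3_act (g : CM) (x : CM * CM) : CM * CM :=
  (conj_by g (cplx x.1), conj_by g (cplx x.2)).

(* The diffeomorphism (1, oo) x N_{1,1} ~= X^*, lifted to (1, oo) x SU(3): the
   orbit of the covector s E_21 over the line spanned by the second basis
   vector, whose stabiliser is K_0.  The coframe gives I dt = f kappa up to
   sign, and kappa rotates the covector at speed 2, so s is a holomorphic
   radius for I when ds / s = 2 dt / f, that is s = sqrt (r^4 - 1) up to a
   constant factor.  Being, up to this factor, a smooth odd function of the
   distance t to the zero section, this s makes the Calabi structure extend
   smoothly to X. *)
Definition calabi_map (y : R * CM) : CM * CM :=
  (conj_by y.2 (delta_mx 1 1),
   Num.sqrt (y.1 ^+ 4 - 1) *: conj_by y.2 (delta_mx 1 0)).

Definition cone : set (R * CM) := [set r | 1 < r] `*` SU3.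

(* eta = g^-1 dg at y = (r, g), on the tangent vector v = (dr, dg) *)
Definition maurer_cartan (y v : R * CM) : C3 := (cplx y.2)^t* *m cplx v.2.

Definition coframe (i : 'I_8) (y v : R * CM) : R :=
  let r := y.1 in
  let a := Num.sqrt ((r ^+ 2 - 1) / 2) in
  let b := Num.sqrt ((r ^+ 2 + 1) / 2) in
  let c := r in
  let f := r^-1 * Num.sqrt (r ^+ 4 - 1) in
  let eta := maurer_cartan y v in
  let nu := eta 0 1 in
  let sigma := eta 0 2 in
  let mu := eta 1 2 in
  let kappa := (complex.Im (eta 0 0) - complex.Im (eta 1 1)) / 2 in
  [:: Num.sqrt (r ^+ 4 / (r ^+ 4 - 1)) * v.1;
      a * complex.Re sigma; a * complex.Im sigma;
      b * complex.Re mu; b * complex.Im mu;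
      c * complex.Re nu; c * complex.Im nu;
      f * kappa]`_i.

Definition E0_space : normedModType R := ((CM * CM) * M3)%type.
Definition E0 : set E0_space := TCP2_star `*` @SO3 R.
Definition E0_proj (z : E0_space) : CM * CM := z.1.
Definition E0_act (z : E0_space) (h : M3) : E0_space := (z.1, z.2 *m h).

Definition su3_invariant (A : E0_space -> E0_space -> M3) : Prop :=
  forall g z v, SU3 g -> E0 z -> tangent E0 z v ->
    A (su3_act g z.1, z.2) (su3_act g v.1, v.2) = A z v.

Definition temporal_gauge (A : E0_space -> E0_space -> M3) : Prop :=
  forall y h, cone y -> SO3 h ->
    A (calabi_map y, h) ('D_(1, 0) calabi_map y, 0) = 0.

Definition is_canonical (A : E0_space -> E0_space -> M3) : Prop :=
  forall z v, E0 z -> tangent E0 z v -> A z v = z.2^T *m v.2.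

(* The curvature as an so(3)-valued 2-form on X^*, through the section
   x |-> (x, 1) of E_0, pulled back to (1, oo) x SU(3). *)
Definition pulled_curvature (A : E0_space -> E0_space -> M3)
    (y u v : R * CM) : M3 :=
  curvature E0 A (calabi_map y, 1%:M)
    ('D_u calabi_map y, 0) ('D_v calabi_map y, 0).

Definition SU4_instanton (L : complex_structure)
    (A : E0_space -> E0_space -> M3) : Prop :=
  forall y, cone y -> exists F : 'I_8 -> 'I_8 -> M3,
    (forall u v, tangent cone y u -> tangent cone y v ->
       pulled_curvature A y u v =
       \sum_(i < 8) \sum_(j < 8 | (i < j)%N)
         (coframe i y u * coframe j y v - coframe i y v * coframe j y u)
           *: F i j) /\
    hodge (two_form F) =
    - (2^-1 *: wedge (wedge (omega R L) (omega R L)) (two_form F)).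

Definition extends_across_zero_section (A : E0_space -> E0_space -> M3)
    : Prop :=
  exists (n : nat) (P : set 'rV[R]_n.+1) (p : 'rV[R]_n.+1 -> CM * CM)
         (act : 'rV[R]_n.+1 -> M3 -> 'rV[R]_n.+1)
         (theta : 'rV[R]_n.+1 -> 'rV[R]_n.+1 -> M3),
    [/\ principal_bundle TCP2 P p act,
        principal_connection P act theta
      & bundle_connection_iso E0 E0_proj E0_act A
          (P `&` p @^-1` TCP2_star) p act theta].

End Calabi.

(* Main.v *)
(** The SU(3)-orbits in the complement of the zero section are those of covectors of norm s =
    sqrt (r^4 - 1) > 0, with representatives [xs s]. An invariant connection in temporal gauge
    is therefore determined by the linear maps alpha_s : su(3) -> so(3) giving its values on the
    generators of the action at [xs s]. Invariance under the stabiliser K_0 makes alpha_s vanish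
    on the sigma and mu directions, leaving the kappa and nu directions. The instanton equation
    kills all but one of these: for I, alpha vanishes on nu_1 and nu_2 and its value k on kappa
    satisfies k' = - (2/s + s/(s^2+1)) k; for J and K, only the value n on nu_2, resp. nu_1,
    survives and n' = - (3/s) n. Hence k^2 s^4 (s^2+1), resp. n^2 s^6, is constant. If A extends
    across the zero section, its curvature along the orbit of [xs s] is bounded as s -> 0; by
    the bracket relations of su(3) one component of this curvature is a nonzero multiple of k,
    resp. n, so the constant is zero and A is the product connection. *)

Require Import Defs.
From HB Require Import structures.
From mathcomp Require Import all_boot all_order all_algebra.
From mathcomp Require Import sesquilinear spectral complex.
From mathcomp Require Import all_classical all_reals all_analysis.
From mathcomp Require Import ring lra zify.
Set Implicit Arguments.
Unset Strict Implicit.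
Unset Printing Implicit Defensive.
Import Order.TTheory GRing.Theory Num.Theory.
Import numFieldNormedType.Exports.
Local Open Scope classical_set_scope.
Local Open Scope ring_scope.
Local Open Scope complex_scope.
Local Open Scope sesquilinear_scope.

(** * Calculus of C^k maps between finite-dimensional spaces *)

(** The definitions provide directional derivatives only, and [ext_deriv] differentiates an
    arbitrary local extension of a form. Both d A and d theta are therefore read off by pull-back
    along smooth two-parameter families inside the bundle, where only values on tangent vectors
    enter. The families are products of rotations in SU(3) given by Rodrigues' formula, which takes
    the place of the exponential map.

    The comparison with the extended bundle has to avoid the isomorphism at the zero section, where
    it is not defined. Generators X and Y with alpha_s(X) = alpha_s(Y) = 0 make such a family
    horizontal at its base point, so the velocities of its image are horizontal lifts for theta.
    These lifts, and d theta on them, are defined and continuous up to s = 0 in one local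
    trivialisation, since the velocities of the action at [xs s] converge. The isomorphism enters
    only through an element of SO(3) that conjugates the curvature, which the Frobenius norm does
    not see. Boundedness suffices because the factors s^4 (s^2+1) and s^6 tend to zero. *)

Section FiniteDimension.
Variable R : realType.

Definition coordinates (V : normedModType R) (n : nat)
    (e : 'I_n -> V) (c : 'I_n -> V -> R) : Prop :=
  [/\ forall i a x y, c i (a *: x + y) = a * c i x + c i y,
      forall i, continuous (c i),
      forall x, x = \sum_i c i x *: e i
    & forall i j, c i (e j) = (i == j)%:R].

Definition findim (V : normedModType R) : Prop :=
  exists n (e : 'I_n -> V) (c : 'I_n -> V -> R), coordinates e c.

Section Coordinates.
Variables (V : normedModType R) (n : nat) (e : 'I_n -> V) (c : 'I_n -> V -> R).
Hypothesis ec : coordinates e c.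

Lemma coordD i x y : c i (x + y) = c i x + c i y.
Proof. by have [H _ _ _] := ec; rewrite -[x]scale1r H mul1r scale1r. Qed.

Lemma coord0 i : c i 0 = 0.
Proof. by apply: (addrI (c i 0)); rewrite -coordD !addr0. Qed.

Lemma coordZ i a x : c i (a *: x) = a * c i x.
Proof. by have [H _ _ _] := ec; rewrite -[a *: x]addr0 H coord0 addr0. Qed.

Lemma coord_sum i (I : finType) (f : I -> V) :
  c i (\sum_j f j) = \sum_j c i (f j).
Proof. by apply: (big_morph (c i)); [exact: coordD|exact: coord0]. Qed.

Lemma coord_inj x y : (forall i, c i x = c i y) -> x = y.
Proof.
have [_ _ H _] := ec => E.
by rewrite (H x) (H y); apply: eq_bigr => i _; rewrite E.
Qed.

Lemma linear_coord (W : lmodType R) (f : V -> W) : linear f ->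
  forall x, f x = \sum_i c i x *: f (e i).
Proof.
move=> lf x; have [_ _ H _] := ec.
have f0 : f 0 = 0.
  by have := lf (-1) 0 0; rewrite scaler0 addr0 scaleN1r addNr.
have fD : {morph f : x y / x + y} by move=> a b; rewrite -[a]scale1r lf !scale1r.
have fZ a y : f (a *: y) = a *: f y by rewrite -[a *: y]addr0 lf f0 addr0.
rewrite [in LHS](H x) (big_morph f fD f0).
by apply: eq_bigr => i _; rewrite fZ.
Qed.

End Coordinates.

Lemma findim_R : findim R.
Proof.
exists 1%N, (fun _ => 1), (fun _ => id); split => //.
- by move=> _ x; apply: cvg_id.
- by move=> x; rewrite big_ord1 /GRing.scale /= mulr1.
- by move=> i j; rewrite !ord1.
Qed.

Lemma findim_mx (m n : nat) : findim 'M[R]_(m.+1, n.+1).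
Proof.
pose ix (k : 'I_#|{: 'I_m.+1 * 'I_n.+1}|) := enum_val k.
exists _, (fun k => delta_mx (ix k).1 (ix k).2 : 'M[R]_(m.+1, n.+1)),
  (fun k (M : 'M[R]_(m.+1, n.+1)) => M (ix k).1 (ix k).2).
split.
- by move=> k a x y; rewrite !mxE.
- by move=> k; apply: coord_continuous.
- move=> x; rewrite [LHS]matrix_sum_delta pair_bigA /=.
  rewrite (reindex (fun k => ix k)) //=.
  by exists enum_rank => k _; rewrite /ix ?enum_valK ?enum_rankK.
- move=> k l; rewrite mxE -(inj_eq enum_val_inj k l) -/(ix k) -/(ix l).
  by case: (ix k) (ix l) => [a b] [a' b'].
Qed.

Lemma findim_prod (V W : normedModType R) :
  findim V -> findim W -> findim (V * W)%type.
Proof.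
move=> [n [e [c ec]]] [m [f [d fd]]].
have [cl cc cs cd] := ec; have [dl dc ds dd] := fd.
pose sp (k : 'I_(n + m)) := fintype.split k.
exists (n + m)%N,
  (fun k => match sp k with inl i => (e i, 0) | inr j => (0, f j) end),
  (fun k (x : V * W) => match sp k with inl i => c i x.1 | inr j => d j x.2 end).
split.
- by move=> k a x y; case: (sp k) => i /=; rewrite ?cl ?dl.
- move=> k; case: (sp k) => i x.
    by apply: continuous_comp; [exact: cvg_fst|exact: cc].
  by apply: continuous_comp; [exact: cvg_snd|exact: dc].
- move=> [x y]; rewrite big_split_ord /=.
  under eq_bigr => i _ do rewrite /sp (unsplitK (inl i)) /=.
  under [X in _ = _ + X]eq_bigr => i _ do rewrite /sp (unsplitK (inr i)) /=.
  rewrite (_ : \sum_i _ = (x, 0)); last first.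
    rewrite [in RHS](cs x) (big_morph (fun z => (z, 0 : W)) (id1 := 0) (op1 := +%R)) //.
      by apply: eq_bigr => i _; rewrite /GRing.scale /= /scale_pair scaler0.
    by move=> a b; rewrite /GRing.add /= /add_pair /= addr0.
  rewrite (_ : \sum_i _ = (0, y)); last first.
    rewrite [in RHS](ds y) (big_morph (fun z => (0 : V, z)) (id1 := 0) (op1 := +%R)) //.
      by apply: eq_bigr => i _; rewrite /GRing.scale /= /scale_pair scaler0.
    by move=> a b; rewrite /GRing.add /= /add_pair /= addr0.
  by rewrite /GRing.add /= /add_pair /= addr0 add0r.
- move=> i j; rewrite /sp; case: (fintype.splitP i) (fintype.splitP j) => a ia [] b jb.
  + by rewrite cd -val_eqE /= -(inj_eq val_inj i) /= ia jb.
  + rewrite (coord0 ec) -(inj_eq val_inj) /= ia jb; case: eqP => // E.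
    by have := ltn_ord a; rewrite E ltnNge leq_addr.
  + rewrite (coord0 fd) -(inj_eq val_inj) /= ia jb; case: eqP => // E.
    by have := ltn_ord b; rewrite -E ltnNge leq_addr.
  + by rewrite dd -val_eqE /= -(inj_eq val_inj i) /= ia jb eqn_add2l.
Qed.

Lemma is_derive_cvg (V W : normedModType R) (f : V -> W) x v df :
  (fun h : R => h^-1 *: (f (h *: v + x) - f x)) h @[h --> 0^'] --> df ->
  is_derive x v f df.
Proof. by move=> H; split; [apply/cvg_ex; exists df|apply: cvg_lim]. Qed.

Lemma cvg_is_derive (V W : normedModType R) (f : V -> W) x v df :
  is_derive x v f df ->
  (fun h : R => h^-1 *: (f (h *: v + x) - f x)) h @[h --> 0^'] --> df.
Proof. by case=> d <-; exact: d. Qed.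

Lemma is_derive_near (V W : normedModType R) (f g : V -> W) x v df :
  (\forall y \near x, f y = g y) -> is_derive x v f df -> is_derive x v g df.
Proof.
move=> fg [d <-]; split; first exact: near_eq_derivable fg d.
by apply/esym/near_eq_derive.
Qed.

Lemma is_derive_linear (V W W' : normedModType R) (l : W -> W') (f : V -> W)
    x v df : linear l -> continuous l ->
  is_derive x v f df -> is_derive x v (l \o f) (l df).
Proof.
move=> ll lc /cvg_is_derive fd; apply: is_derive_cvg.
have l0 : l 0 = 0.
  by have := ll (-1) 0 0; rewrite scaler0 addr0 scaleN1r addNr.
have lZ a y : l (a *: y) = a *: l y by rewrite -[a *: y]addr0 ll l0 addr0.
have lB a y : l (a - y) = l a - l y.
  by rewrite addrC -scaleN1r ll scaleN1r addrC.
rewrite (_ : (fun h => _) =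
  l \o (fun h : R => h^-1 *: (f (h *: v + x) - f x))); last first.
  by apply/funext => h /=; rewrite lZ lB.
by apply: cvg_comp; [exact: fd|exact: lc].
Qed.

(* [f] along the line through [x]: reduces directional derivatives to
   functions of one variable. *)
Lemma is_derive_line (V W : normedModType R) (f : V -> W) x v t df :
  is_derive (t *: v + x) v f df <->
  is_derive t 1 (fun s : R => f (s *: v + x)) df.
Proof.
have E : (fun h : R => h^-1 *: (f (h *: v + (t *: v + x)) - f (t *: v + x))) =
  (fun h : R => h^-1 *: (f ((h *: 1 + t) *: v + x) - f (t *: v + x))).
  by apply/funext => h; rewrite scalerDl -addrA /GRing.scale /= mulr1.
by split=> /cvg_is_derive H; apply: is_derive_cvg; rewrite ?E // -E.
Qed.

Lemma is_derive_line0 (V W : normedModType R) (f : V -> W) x v df :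
  is_derive x v f df <-> is_derive (0 : R) 1 (fun s : R => f (s *: v + x)) df.
Proof. by rewrite -is_derive_line scale0r add0r. Qed.

(** The inner map is derivable in one direction only. Its restriction to the line through [x] in
    that direction is a function of one variable, where derivable and differentiable agree, so the
    chain rule for differentials applies. *)
Lemma is_derive_diff (V W W' : normedModType R) (f : W -> W') (g : V -> W) x v dg :
  differentiable f (g x) -> is_derive x v g dg ->
  is_derive x v (f \o g) ('d f (g x) dg).
Proof.
move=> df /is_derive_line0 [Dg <-]; apply/is_derive_line0.
set k := (fun s : R => g (s *: v + x)) in Dg *.
have k0 : k 0 = g x by rewrite /k scale0r add0r.
have dk : differentiable k 0 by apply/derivable1_diffP.
have dfk : differentiable f (k 0) by rewrite k0.
rewrite (_ : (fun s : R => _) = f \o k)//.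
have dc : differentiable (f \o k) 0 by exact: differentiable_comp.
split; first exact: diff_derivable.
rewrite deriveE // diff_comp //= -k0; congr ('d f _ _).
by rewrite deriveE.
Qed.

Lemma is_derive_comp1 (V W : normedModType R) (f : R -> W) (g : V -> R) x v a df :
  is_derive x v g a -> is_derive (g x) 1 f df -> is_derive x v (f \o g) (a *: df).
Proof.
move=> dg [Df <-].
have dff : differentiable f (g x) by apply/derivable1_diffP.
rewrite deriveE // -linearZ (_ : a *: _ = a); last by rewrite /GRing.scale /= mulr1.
exact: is_derive_diff.
Qed.

Lemma is_derive_scale_dir (V W : normedModType R) (f : V -> W) x v a df :
  is_derive x v f df -> is_derive x (a *: v) f (a *: df).
Proof.
move=> /is_derive_line0 H; apply/is_derive_line0.
rewrite (_ : (fun s : R => _) = (fun s : R => f (s *: v + x)) \o (fun s : R => a *: s)); last first.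
  by apply/funext => s /=; rewrite scalerA [s * a]mulrC.
apply: is_derive_comp1; last by rewrite scaler0.
have lz : linear (fun s : R => a *: s : R).
  by move=> b y z; rewrite scalerDr !scalerA [a * b]mulrC.
have := is_derive_linear lz _ (is_derive_id (0 : R) 1).
rewrite /= [a *: _]mulr1; apply; exact: scaler_continuous.
Qed.

Lemma coord_is_derive (V W : normedModType R) n (e : 'I_n -> W) c (f : V -> W)
    x v (df : W) : coordinates e c ->
  is_derive x v f df <-> forall i, is_derive x v (c i \o f) (c i df).
Proof.
move=> ec; have [cl cc cs cd] := ec; split=> [H i|H].
  by apply: is_derive_linear => // a y z; rewrite cl.
rewrite (_ : f = \sum_i (fun y => (c i \o f) y *: e i)); last first.
  by apply/funext => y; rewrite fct_sumE; exact: cs.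
rewrite [df]cs; apply: is_derive_sum => i.
apply: (@is_derive_linear _ _ _ (fun a : R => a *: e i)).
- by move=> a y z; rewrite scalerDl scalerA.
- by move=> y; apply: cvgZr_tmp; exact: cvg_id.
Qed.

Lemma coord_continuous_at (T : topologicalType) (W : normedModType R) n
    (e : 'I_n -> W) c (f : T -> W) x : coordinates e c ->
  {for x, continuous f} <-> forall i, {for x, continuous (c i \o f)}.
Proof.
move=> ec; have [cl cc cs cd] := ec; split=> [H i|H].
  by apply: continuous_comp; [exact: H|exact: cc].
rewrite (_ : f = \sum_i (fun y => (c i \o f) y *: e i)); last first.
  by apply/funext => y; rewrite fct_sumE; exact: cs.
rewrite /prop_for /continuous_at fct_sumE.
apply: (@cvg_big _ _ _ _ _ _ _ _ _ (fun i y => (c i \o f) y *: e i)) => [|i _].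
  exact: add_continuous.
by apply: cvgZr_tmp; exact: H.
Qed.

Lemma MVT_line (V : normedModType R) (f : V -> R) (x v : V) (df : V -> R) :
  (forall s : R, 0 <= s <= 1 -> is_derive (s *: v + x) v f (df (s *: v + x))) ->
  exists2 s : R, 0 <= s <= 1 & f (v + x) - f x = df (s *: v + x).
Proof.
move=> H; pose g (s : R) := f (s *: v + x).
have dg (s : R) : 0 <= s <= 1 -> is_derive s 1 g (df (s *: v + x)).
  by move=> /H /is_derive_line.
have [| |s sI] := @MVT_segment _ g (fun s => df (s *: v + x)) 0 1 ler01.
- by move=> s; rewrite in_itv /= => /andP[a b]; apply: dg; rewrite !ltW.
- apply: derivable_within_continuous => s; rewrite in_itv /= => sI.
  by have [] := dg s sI.
rewrite /g scale1r scale0r add0r subr0 mulr1 => E.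
by exists s => //; move: sI; rewrite in_itv.
Qed.

(** * Continuous directional derivatives imply differentiability *)

Section ContinuousPartials.
Variables (V : normedModType R) (f : V -> R) (df : V -> V -> R) (U : set V).
Hypothesis oU : open U.
Hypothesis fd : forall y v, U y -> is_derive y v f (df y v).
Hypothesis dfc : forall y v, U y -> {for y, continuous (df^~ v)}.

Lemma partial_near x v (eps : R) : U x -> 0 < eps -> exists2 d : R, 0 < d &
  forall y, `|y - x| < d -> U y /\ `|df y v - df x v| < eps.
Proof.
move=> Ux e0; have : \forall y \near x, U y /\ `|df y v - df x v| < eps.
  near=> y; split; near: y; first exact: open_nbhs_nbhs.
  by have /cvgrPdist_lt /(_ _ e0) := @dfc x v Ux; under eq_near do rewrite distrC.
move=> /nbhs_normP [d d0 H]; exists d => // y yd.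
by apply: H; rewrite /ball_ /= distrC.
Unshelve. all: by end_near. Qed.

Lemma partial_dirZ y a v : U y -> df y (a *: v) = a * df y v.
Proof.
move=> Uy; have [_ <-] := fd (a *: v) Uy.
by have [_ ->] := is_derive_scale_dir a (fd v Uy).
Qed.

(** The quotient for [u + v] splits into a step along [u] from [x] and a step along [v] from the
    moved point. The mean value theorem turns the second into a directional derivative at a point
    close to [x], where continuity applies. *)
Lemma partial_dirD x u v : U x -> df x (u + v) = df x u + df x v.
Proof.
move=> Ux.
have /cvg_is_derive Huv := fd (u + v) Ux.
have /cvg_is_derive Hu := fd u Ux.
have Hv : (fun h : R => h^-1 *: (f (h *: v + (h *: u + x)) - f (h *: u + x))) h
    @[h --> 0^'] --> df x v.
  apply/cvgrPdist_le => e e0.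
  have [d d0 Hd] := partial_near v Ux e0.
  (* The summand 1 keeps [M] positive; |h| < d / M then keeps both steps within distance d of
     [x]. *)
  pose M := `|u| + `|v| + 1.
  have M0 : 0 < M by rewrite ltr_wpDl // addr_ge0.
  near=> h.
  have h0 : h != 0 by near: h; exact: nbhs_dnbhs_neq.
  have hd : `|h| < d / M.
    near: h; apply: nbhs_dnbhs; apply/nbhs_normP; exists (d / M) => /=; first exact: divr_gt0.
    by move=> h; rewrite /ball_ /= sub0r normrN.
  have inb s : 0 <= s <= 1 -> `|s *: (h *: v) + (h *: u + x) - x| < d.
    move=> /andP[s0 s1]; rewrite addrA addrK.
    rewrite (le_lt_trans (ler_normD _ _)) // !normrZ.
    rewrite (@le_lt_trans _ _ (`|h| * M)) //; last by rewrite -ltr_pdivlMr.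
    rewrite /M !mulrDr mulr1 (ger0_norm s0).
    have : s * (`|h| * `|v|) <= `|h| * `|v| by rewrite ler_piMl // mulr_ge0.
    by have := normr_ge0 h; lra.
  have [s sI] := @MVT_line _ f (h *: u + x) (h *: v) (fun y => df y (h *: v))
    (fun s sI => fd _ (Hd _ (inb s sI)).1).
  move=> ->; have [Uy Dy] := Hd _ (inb s sI).
  rewrite partial_dirZ // /GRing.scale /= mulKf //.
  by rewrite distrC ltW.
have := cvgD Hv Hu.
rewrite (_ : _ + _ = (fun h : R => h^-1 *: (f (h *: (u + v) + x) - f x))); last first.
  apply/funext => h; rewrite -[LHS]/(_ *: _ + _ *: _) -scalerDr addrA subrK.
  by rewrite addrA -scalerDr [v + u]addrC.
move=> /(_ (dnbhs_filter _)) K; rewrite [RHS]addrC.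
by have := cvg_unique _ Huv K; apply.
Unshelve. all: by end_near. Qed.

Lemma partial_linear x : U x -> linear (df x : V -> R).
Proof. by move=> Ux a u v; rewrite partial_dirD // partial_dirZ. Qed.

(** The candidate differential is [df x]. The mean value theorem on the segment from x to x + h
    turns the error into the difference of [df] at two points, applied to h; in coordinates it is
    bounded by the oscillation of finitely many partial derivatives. *)
Lemma C1_differentiable_real x : findim V -> U x -> differentiable f x.
Proof.
move=> [n [e [c ec]]] Ux; have [cl cc cs cd] := ec.
have ldf := partial_linear Ux.
pose L : {linear V -> R} := HB.pack (df x) (GRing.isLinear.Build R V R *:%R (df x) ldf).
have Lc : continuous L.
  move=> y; rewrite /continuous_at.
  rewrite (_ : (L : V -> R) = fun z => \sum_i c i z *: df x (e i)); last first.
    by apply/funext => z; exact: (linear_coord ec).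
  apply: (@cvg_big _ _ _ _ _ _ _ _ _ (fun i z => c i z *: df x (e i))) => [|i _].
    exact: add_continuous.
  by apply: cvgZr_tmp; exact: cc.
suff E : f \o shift x = cst (f x) + L +o_ (0 : V) id.
  apply/diff_locallyP; rewrite (diff_unique Lc E); split => //.
apply/eqaddoP => eps eps0.
have [K [K0 HK]] : exists K : R, 0 < K /\ forall i y, `|c i y| <= K * `|y|.
  have Hi i : exists k : R, 0 < k /\ forall y, `|c i y| <= k * `|y|.
    have lci : linear (c i : V -> R) by move=> a u v; rewrite cl.
    pose Li : {linear V -> R} := HB.pack (c i) (GRing.isLinear.Build R V R *:%R (c i) lci).
    by have [k k0 Hk] := @linear_lipschitz _ _ _ Li (cc i); exists k.
  have [k Hk] := choice Hi.
  exists (1 + \sum_i k i); split.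
    by rewrite ltr_pwDl // sumr_ge0 // => i _; rewrite ltW //; case: (Hk i).
  move=> i y; apply: le_trans (_ : k i * `|y| <= _); first by case: (Hk i).
  rewrite ler_wpM2r // (bigD1 i) //= addrCA lerDl addr_ge0 // sumr_ge0 // => j _.
  by rewrite ltW //; case: (Hk j).
(* Using n + 1 rather than n keeps the divisor nonzero in dimension zero. *)
pose eps' := eps / (K * n.+1%:R).
have e'0 : 0 < eps' by rewrite divr_gt0 // mulr_gt0.
have : \forall y \near x, U y /\ forall i, `|df y (e i) - df x (e i)| < eps'.
  apply: filterI; first exact: open_nbhs_nbhs.
  apply: filter_forall => i; have [d d0 Hd] := partial_near (e i) Ux e'0.
  by apply/nbhs_normP; exists d => // y; rewrite /ball_ /= distrC => /Hd[].
move=> /nbhs_normP [d d0 Hd].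
apply/nbhs_normP; exists d => // h; rewrite /ball_ /= sub0r normrN => hd.
have inb s : 0 <= s <= 1 -> ball_ Num.Def.normr x d (s *: h + x).
  move=> /andP[s0 s1]; rewrite /ball_ /= opprD addrCA subrr addr0 normrN normrZ.
  by rewrite (ger0_norm s0) (le_lt_trans _ hd) // ler_piMl.
have [s sI E] := @MVT_line _ f x h (fun y => df y h) (fun s sI => fd _ (Hd _ (inb s sI)).1).
rewrite -[X in `|X|]/(f (h + x) - (f x + df x h)) opprD addrA E.
have [Uy Dy] := Hd _ (inb s sI).
rewrite (linear_coord ec ldf) (linear_coord ec (partial_linear Uy)).
rewrite -sumrB (le_trans (ler_norm_sum _ _ _)) //.
apply: le_trans (_ : \sum_(i < n) K * `|h| * eps' <= _).
  apply: ler_sum => i _; rewrite -scalerBr normrZ ler_pM //.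
  by rewrite ltW.
rewrite sumr_const card_ord -[leLHS]mulr_natl /eps'.
rewrite (_ : n%:R * _ = (n%:R / n.+1%:R) * (eps * `|h|)).
  by rewrite ler_piMl ?mulr_ge0 ?(ltW eps0) // ler_pdivrMr // mul1r ler_nat.
have N0 : n.+1%:R != 0 :> R by rewrite pnatr_eq0.
by move: n.+1%:R N0 (lt0r_neq0 K0) => N N0 K0'; field; rewrite N0 K0'.
Qed.

End ContinuousPartials.

(** * C^k maps in coordinates and pull-back of the exterior derivative *)

Section Ck.
Implicit Types (V W : normedModType R).

Lemma Ck_continuous V W k (U : set V) (f : V -> W) x :
  Ck k U f -> U x -> {for x, continuous f}.
Proof. by case: k => [|k] [H _] Ux; exact: H. Qed.

Lemma Ck_is_derive V W k (U : set V) (f : V -> W) x v :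
  Ck k.+1 U f -> U x -> is_derive x v f ('D_v f x).
Proof. by case=> _ H Ux; split => //; have [+ _] := H v; exact. Qed.

Lemma Ck_derive V W k (U : set V) (f : V -> W) v :
  Ck k.+1 U f -> Ck k U ('D_v f).
Proof. by case=> _ H; have [] := H v. Qed.

Lemma CkW V W k (U : set V) (f : V -> W) : Ck k.+1 U f -> Ck k U f.
Proof.
elim: k f => [|k IH] f /= [fc H]; split => // v.
by have [fd fD] := H v; split => //; exact: IH.
Qed.

Lemma Ck_le V W k l (U : set V) (f : V -> W) : (k <= l)%N -> Ck l U f -> Ck k U f.
Proof.
move=> /subnKC <-; elim: (l - k)%N => [|m IH]; first by rewrite addn0.
by rewrite addnS => /CkW.
Qed.

Lemma Ck_subset V W k (U U' : set V) (f : V -> W) :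
  U' `<=` U -> Ck k U f -> Ck k U' f.
Proof.
move=> UU; elim: k f => [|k IH] f /= [fc H]; split => //.
- by move=> x /UU; exact: fc.
- by move=> x /UU; exact: fc.
- by move=> v; have [fd fD] := H v; split=> [x /UU|]; [exact: fd|exact: IH].
Qed.

Lemma Ck_eq V W k (U : set V) (f g : V -> W) : open U ->
  (forall x, U x -> f x = g x) -> Ck k U f -> Ck k U g.
Proof.
move=> oU; have near_eq (f' g' : V -> W) x : (forall x, U x -> f' x = g' x) ->
    U x -> \forall y \near x, f' y = g' y.
  by move=> fg Ux; near=> y; apply: fg; near: y; exact: open_nbhs_nbhs.
have cont (f' g' : V -> W) x : (forall x, U x -> f' x = g' x) -> U x ->
    {for x, continuous f'} -> {for x, continuous g'}.
  move=> fg Ux fc; rewrite /prop_for /continuous_at -fg //.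
  by apply: cvg_trans fc; apply: near_eq_cvg; exact: near_eq.
elim: k f g => [|k IH] f g fg /= [fc H]; split => //.
- by move=> x Ux; apply: cont fg Ux (fc x Ux).
- by move=> x Ux; apply: cont fg Ux (fc x Ux).
- move=> v; have [fd fD] := H v; split.
    by move=> x Ux; apply: near_eq_derivable (fd x Ux); exact: near_eq.
  by apply: IH fD => x Ux; apply: near_eq_derive; exact: near_eq.
Unshelve. all: by end_near. Qed.

(** The induction step of most C^k proofs: a formula for all directional derivatives that is itself
    C^k. *)
Lemma Ck_intro V W k (U : set V) (f : V -> W) (df : V -> V -> W) : open U ->
  (forall x, U x -> {for x, continuous f}) ->
  (forall x v, U x -> is_derive x v f (df x v)) ->
  (forall v, Ck k U (df^~ v)) -> Ck k.+1 U f.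
Proof.
move=> oU fc fd Hd; split=> // v; split=> [x /(fd x v)[]//|].
by apply: Ck_eq (Hd v) => // x /(fd x v)[].
Qed.

Lemma coord_derive V W k (U : set V) (f : V -> W) n (e : 'I_n -> W) c i v x :
  coordinates e c -> Ck k.+1 U f -> U x ->
  is_derive x v (c i \o f) (c i ('D_v f x)).
Proof. by move=> ec fC Ux; have /(coord_is_derive _ _ _ _ ec) := Ck_is_derive v fC Ux. Qed.

Lemma Ck_coord V W k (U : set V) (f : V -> W) n (e : 'I_n -> W) c : open U ->
  coordinates e c -> Ck k U f <-> forall i, Ck k U (c i \o f).
Proof.
move=> oU ec; split.
  move=> fC i; elim: k f fC => [|k IH] f fC.
    split=> // x Ux; have /(coord_continuous_at _ _ ec) := Ck_continuous fC Ux.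
    exact.
  apply: (Ck_intro (df := fun x v => c i ('D_v f x))) => //.
  - by move=> x Ux; have /(coord_continuous_at _ _ ec) := Ck_continuous fC Ux.
  - by move=> x v Ux; exact: (coord_derive i v ec fC Ux).
  - by move=> v; apply: (IH ('D_v f)); exact: Ck_derive.
elim: k f => [|k IH] f fC.
  by split=> // x Ux; apply/(coord_continuous_at _ _ ec) => i; exact: Ck_continuous (fC i) Ux.
have [_ _ _ cd] := ec.
have D x v : U x -> is_derive x v f (\sum_i 'D_v (c i \o f) x *: e i).
  move=> Ux; apply/(coord_is_derive _ _ _ _ ec) => i.
  rewrite (coord_sum ec) (bigD1 i) //= big1 => [|j ji].
    rewrite addr0 (coordZ ec) cd eqxx mulr1; exact: Ck_is_derive (fC i) Ux.
  by rewrite (coordZ ec) cd eq_sym (negPf ji) mulr0.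
apply: (Ck_intro oU _ D).
  by move=> x Ux; apply/(coord_continuous_at _ _ ec) => i; exact: Ck_continuous (fC i) Ux.
move=> v; apply: IH => i.
apply: (Ck_eq oU _ (Ck_derive v (fC i))) => x Ux /=.
rewrite (coord_sum ec) (bigD1 i) //= big1 => [|j ji].
  by rewrite addr0 (coordZ ec) cd eqxx mulr1.
by rewrite (coordZ ec) cd eq_sym (negPf ji) mulr0.
Qed.

Lemma Ck_cst V W k (U : set V) (w : W) : Ck k U (fun _ : V => w).
Proof.
elim: k w => [|k IH] w; split=> //.
- by move=> x _; exact: cvg_cst.
- by move=> x _; exact: cvg_cst.
- move=> v; split=> [x _|]; first exact: derivable_cst.
  by rewrite (_ : 'D_v _ = fun _ => 0) //; apply/funext => x; rewrite derive_cst.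
Qed.

Lemma Ck_addr V k (U : set V) (f g : V -> R) : open U ->
  Ck k U f -> Ck k U g -> Ck k U (fun x => f x + g x).
Proof.
move=> oU; elim: k f g => [|k IH] f g fC gC.
  by split=> // x Ux; apply: cvgD; [exact: Ck_continuous fC Ux|exact: Ck_continuous gC Ux].
apply: (Ck_intro (df := fun x v => 'D_v f x + 'D_v g x)) => //.
- by move=> x Ux; apply: cvgD; [exact: Ck_continuous fC Ux|exact: Ck_continuous gC Ux].
- by move=> x v Ux; have df := Ck_is_derive v fC Ux; have dg := Ck_is_derive v gC Ux; exact: is_deriveD.
- by move=> v; apply: IH; exact: Ck_derive.
Qed.

Lemma Ck_mulr V k (U : set V) (f g : V -> R) : open U ->
  Ck k U f -> Ck k U g -> Ck k U (fun x => f x * g x).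
Proof.
move=> oU; elim: k f g => [|k IH] f g fC gC.
  by split=> // x Ux; apply: cvgM; [exact: Ck_continuous fC Ux|exact: Ck_continuous gC Ux].
apply: (Ck_intro (df := fun x v => f x * 'D_v g x + g x * 'D_v f x)) => //.
- by move=> x Ux; apply: cvgM; [exact: Ck_continuous fC Ux|exact: Ck_continuous gC Ux].
- by move=> x v Ux; have df := Ck_is_derive v fC Ux; have dg := Ck_is_derive v gC Ux; exact: is_deriveM.
- by move=> v; apply: Ck_addr => //; apply: IH; by [exact: Ck_derive|exact: CkW].
Qed.

Lemma Ck_sumr V k (U : set V) (I : finType) (f : I -> V -> R) : open U ->
  (forall i, Ck k U (f i)) -> Ck k U (fun x => \sum_i f i x).
Proof.
move=> oU fC; elim: (index_enum I) => [|i r IH].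
  by under eq_fun do rewrite big_nil; exact: Ck_cst.
by under eq_fun do rewrite big_cons; apply: Ck_addr.
Qed.

Lemma Ck_linear_comp V W W' k (U : set V) (l : W -> W') (f : V -> W) :
  open U -> findim W -> findim W' -> linear l -> Ck k U f -> Ck k U (l \o f).
Proof.
move=> oU [n [e [c ec]]] [m [e' [c' ec']]] ll fC.
apply/(Ck_coord _ _ oU ec') => j.
rewrite (_ : _ \o _ = fun x => \sum_i c i (f x) * c' j (l (e i))); last first.
  apply/funext => x /=; rewrite (linear_coord ec ll (f x)) (coord_sum ec').
  by apply: eq_bigr => i _; rewrite (coordZ ec').
apply: Ck_sumr => // i; apply: Ck_mulr => //; last exact: Ck_cst.
by have /(Ck_coord _ _ oU ec) := fC; exact.
Qed.

Lemma Ck_bilinear V W1 W2 W' k (U : set V) (b : W1 -> W2 -> W') f g :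
  open U -> findim W1 -> findim W2 -> findim W' ->
  (forall y, linear (b^~ y)) -> (forall x, linear (b x)) ->
  Ck k U f -> Ck k U g -> Ck k U (fun x => b (f x) (g x)).
Proof.
move=> oU [n1 [e1 [c1 ec1]]] [n2 [e2 [c2 ec2]]] [m [e' [c' ec']]] bl br fC gC.
apply/(Ck_coord _ _ oU ec') => j.
rewrite (_ : _ \o _ = fun x => \sum_i \sum_i' c1 i (f x) * (c2 i' (g x) * c' j (b (e1 i) (e2 i')))); last first.
  apply/funext => x /=; rewrite (linear_coord ec1 (bl _) (f x)) (coord_sum ec').
  apply: eq_bigr => i _; rewrite (linear_coord ec2 (br _) (g x)) (coordZ ec') (coord_sum ec') big_distrr /=.
  by apply: eq_bigr => i' _; rewrite (coordZ ec').
apply: Ck_sumr => // i; apply: Ck_sumr => // i'.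
apply: Ck_mulr => //; first by have /(Ck_coord _ _ oU ec1) := fC; exact.
apply: Ck_mulr => //; last exact: Ck_cst.
by have /(Ck_coord _ _ oU ec2) := gC; exact.
Qed.

Lemma Ck_id V k (U : set V) : Ck k U (id : V -> V).
Proof.
case: k => [|k]; split=> //.
- by move=> x _; exact: cvg_id.
- by move=> x _; exact: cvg_id.
- move=> v; split=> [x _|]; first exact: derivable_id.
  by rewrite (_ : 'D_v _ = fun _ => v); [exact: Ck_cst|apply/funext => x; rewrite derive_id].
Qed.

Lemma C1_differentiable V W k (U : set V) (f : V -> W) x : open U ->
  findim V -> findim W -> Ck k.+1 U f -> U x -> differentiable f x.
Proof.
move=> oU fV [m [e [c ec]]] fC Ux; have [_ _ cs _] := ec.
rewrite (_ : f = \sum_i (fun y => (c i \o f) y *: e i)); last first.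
  by apply/funext => y; rewrite fct_sumE; exact: cs.
apply: differentiable_sum => i; apply: differentiableZl.
have /(Ck_coord _ _ oU ec) /(_ i) fiC := Ck_le (ltn0Sn k) fC.
apply: (@C1_differentiable_real V (c i \o f) (fun y v => 'D_v (c i \o f) y) U) => //.
- by move=> y v Uy; exact: Ck_is_derive fiC Uy.
- by move=> y v Uy; exact: Ck_continuous (Ck_derive v fiC) Uy.
Qed.

Lemma derive_linear V W k (U : set V) (f : V -> W) x : open U ->
  findim V -> findim W -> Ck k.+1 U f -> U x -> linear (fun v => 'D_v f x).
Proof.
move=> oU fV fW fC Ux a u v.
have df := C1_differentiable oU fV fW fC Ux.
by rewrite !deriveE // linearP.
Qed.

Lemma derive_coord V W k (U : set V) (f : V -> W) x n (e : 'I_n -> V) c v :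
  open U -> coordinates e c -> findim W -> Ck k.+1 U f -> U x ->
  'D_v f x = \sum_i c i v *: 'D_(e i) f x.
Proof.
move=> oU ec fW fC Ux.
have fV : findim V by exists n, e, c.
exact: (linear_coord ec (derive_linear oU fV fW fC Ux)).
Qed.

Lemma is_derive_comp V W W' k (U : set W) (f : W -> W') (g : V -> W) x v dg :
  open U -> findim W -> findim W' -> Ck k.+1 U f -> U (g x) ->
  is_derive x v g dg -> is_derive x v (f \o g) ('D_dg f (g x)).
Proof.
move=> oU fW fW' fC Ux dgx.
have df := C1_differentiable oU fW fW' fC Ux.
by rewrite deriveE //; exact: is_derive_diff.
Qed.

(** In a basis of the middle space, D_v of the composite is the sum of the products of c_i (D_v g)
    with D_(e_i) f composed with g, so the induction hypothesis applies to D_(e_i) f and g. *)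
Lemma Ck_comp V W W' k (U : set V) (U' : set W) (f : W -> W') (g : V -> W) :
  open U -> open U' -> findim W -> findim W' -> (forall x, U x -> U' (g x)) ->
  Ck k U' f -> Ck k U g -> Ck k U (f \o g).
Proof.
move=> oU oU' fW fW' UU'; elim: k f g UU' => [|k IH] f g UU' fC gC.
  split=> // x Ux; apply: continuous_comp; first exact: Ck_continuous gC Ux.
  exact: Ck_continuous fC (UU' x Ux).
have [n [e [c ec]]] := fW.
apply: (Ck_intro (df := fun x v => \sum_i c i ('D_v g x) *: 'D_(e i) f (g x))) => //.
- move=> x Ux; apply: continuous_comp; first exact: Ck_continuous gC Ux.
  exact: Ck_continuous fC (UU' x Ux).
- move=> x v Ux; rewrite -(derive_coord _ oU' ec fW' fC (UU' x Ux)).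
  by apply: (is_derive_comp oU' fW fW' fC); [exact: UU'|exact: Ck_is_derive gC Ux].
- move=> v; have [m [e' [c' ec']]] := fW'.
  apply/(Ck_coord _ _ oU ec') => j.
  rewrite (_ : _ \o _ = fun x => \sum_i c i ('D_v g x) * c' j ('D_(e i) f (g x))); last first.
    by apply/funext => x /=; rewrite (coord_sum ec'); apply: eq_bigr => i _; rewrite (coordZ ec').
  apply: Ck_sumr => // i; apply: Ck_mulr => //.
    by have /(Ck_coord _ _ oU ec) := Ck_derive v gC; exact.
  have /(Ck_coord _ _ oU ec') : Ck k U ('D_(e i) f \o g).
    by apply: IH => //; [exact: Ck_derive|exact: CkW].
  exact.
Qed.

Lemma Ck_add V W k (U : set V) (f g : V -> W) : open U -> findim W ->
  Ck k U f -> Ck k U g -> Ck k U (fun x => f x + g x).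
Proof.
move=> oU [n [e [c ec]]] fC gC; apply/(Ck_coord _ _ oU ec) => i.
rewrite (_ : _ \o _ = fun x => c i (f x) + c i (g x)); last first.
  by apply/funext => x /=; rewrite (coordD ec).
apply: Ck_addr => //; first by have /(Ck_coord _ _ oU ec) := fC; exact.
by have /(Ck_coord _ _ oU ec) := gC; exact.
Qed.

Lemma Ck_scale V W k (U : set V) (f : V -> R) (g : V -> W) : open U -> findim W ->
  Ck k U f -> Ck k U g -> Ck k U (fun x => f x *: g x).
Proof.
move=> oU fW fC gC; apply: (@Ck_bilinear V R W W k U (fun a w => a *: w)) => //.
- exact: findim_R.
- by move=> y a b c; rewrite scalerDl scalerA.
- by move=> y a b c; rewrite scalerDr !scalerA mulrC.
Qed.

Lemma Ck_pair V W W' k (U : set V) (f : V -> W) (g : V -> W') :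
  open U -> findim W -> findim W' -> Ck k U f -> Ck k U g ->
  Ck k U (fun x => (f x, g x)).
Proof.
move=> oU fW fW' fC gC.
rewrite (_ : (fun x => _) = fun x => (f x, 0 : W') + (0 : W, g x)); last first.
  by apply/funext => x; rewrite /GRing.add /= /add_pair /= addr0 add0r.
apply: Ck_add => //; first exact: findim_prod.
  apply: (@Ck_linear_comp V W (W * W')%type k U (fun x => (x, 0))) => //; first exact: findim_prod.
  by move=> a x y; rewrite /GRing.scale /= /scale_pair /= /GRing.add /= /add_pair /= scaler0 addr0.
apply: (@Ck_linear_comp V W' (W * W')%type k U (fun x => (0, x))) => //; first exact: findim_prod.
by move=> a x y; rewrite /GRing.scale /= /scale_pair /= /GRing.add /= /add_pair /= scaler0 addr0.
Qed.

Lemma Ck_linear V W k (U : set V) (l : V -> W) :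
  open U -> findim V -> findim W -> linear l -> Ck k U l.
Proof. by move=> oU fV fW ll; apply: (Ck_linear_comp oU fV fW ll); exact: Ck_id. Qed.

Lemma linear_continuous_findim V W (l : V -> W) :
  findim V -> findim W -> linear l -> continuous l.
Proof.
move=> fV fW ll x; apply: (@Ck_continuous V W 0 setT) => //.
by apply: Ck_linear => //; exact: openT.
Qed.

Lemma is_derive_lin V W W' (l : W -> W') (f : V -> W) x v df :
  findim W -> findim W' -> linear l -> is_derive x v f df ->
  is_derive x v (l \o f) (l df).
Proof. by move=> fW fW' ll; apply: is_derive_linear => //; exact: linear_continuous_findim. Qed.

Lemma is_derive_bilinear V W1 W2 W' (b : W1 -> W2 -> W')
    (f : V -> W1) (g : V -> W2) x v df dg :
  findim W1 -> findim W2 -> findim W' ->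
  (forall y, linear (b^~ y)) -> (forall x, linear (b x)) ->
  is_derive x v f df -> is_derive x v g dg ->
  is_derive x v (fun y => b (f y) (g y)) (b df (g x) + b (f x) dg).
Proof.
move=> [n1 [e1 [c1 ec1]]] [n2 [e2 [c2 ec2]]] [m [e' [c' ec']]] bl br Df Dg.
have E y z : b y z = \sum_i \sum_i' (c1 i y * c2 i' z) *: b (e1 i) (e2 i').
  rewrite (linear_coord ec1 (bl z) y); apply: eq_bigr => i _.
  rewrite (linear_coord ec2 (br _) z) scaler_sumr.
  by apply: eq_bigr => i' _; rewrite scalerA.
rewrite (_ : (fun y => _) = \sum_i \sum_i' (fun y => (c1 i (f y) * c2 i' (g y)) *: b (e1 i) (e2 i'))); last first.
  by apply/funext => y; rewrite E !fct_sumE; apply: eq_bigr => i _; rewrite fct_sumE.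
rewrite !E -big_split /=; apply: is_derive_sum => i.
rewrite -big_split /=; apply: is_derive_sum => i'.
rewrite -scalerDl addrC [c1 i df * _]mulrC.
have /(coord_is_derive _ _ _ _ ec1) /(_ i) d1 := Df.
have /(coord_is_derive _ _ _ _ ec2) /(_ i') d2 := Dg.
have d12 := is_deriveM d1 d2.
apply: (@is_derive_linear V R W' (fun a : R => a *: b (e1 i) (e2 i')) _ x v _ _ _ d12).
- by move=> a y z; rewrite scalerDl scalerA.
- by move=> y; apply: cvgZr_tmp; exact: cvg_id.
Qed.

(** Linearity in the direction separates the two limits: the coordinates of the direction converge,
    and the derivatives along basis vectors are continuous in the point. *)
Lemma cvg_derive V W k (U : set V) (f : V -> W) (T : Type) (F : set_system T)
    (x v : T -> V) (x0 v0 : V) : Filter F -> open U -> findim V -> findim W ->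
  Ck k.+1 U f -> U x0 -> x @ F --> x0 -> v @ F --> v0 ->
  'D_(v t) f (x t) @[t --> F] --> 'D_v0 f x0.
Proof.
move=> FF oU fV fW fC Ux0 xx0 vv0; have [n [e [c ec]]] := fV.
have [_ cc _ _] := ec.
rewrite (derive_coord v0 oU ec fW fC Ux0).
have : \sum_i c i (v t) *: 'D_(e i) f (x t) @[t --> F] --> \sum_i c i v0 *: 'D_(e i) f x0.
  apply: (@cvg_big _ _ _ _ _ _ _ _ _ (fun i t => c i (v t) *: 'D_(e i) f (x t))) => [|i _].
    exact: add_continuous.
  apply: cvgZ.
    exact: (cvg_comp _ _ vv0 (cc i v0)).
  exact: (cvg_comp _ _ xx0 (Ck_continuous (Ck_derive (e i) fC) Ux0)).
apply: cvg_trans; apply: near_eq_cvg; near=> t.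
apply/esym/(derive_coord _ oU ec fW fC); near: t.
by apply: xx0; exact: open_nbhs_nbhs.
Unshelve. all: by end_near. Qed.

Lemma is_derive_translate V W (f : V -> W) w x v df :
  is_derive (w + x) v f df <-> is_derive x v (fun y => f (w + y)) df.
Proof.
by split=> /cvg_is_derive H; apply: is_derive_cvg; move: H;
  under eq_fun do rewrite addrCA.
Qed.

(** The mean value theorem twice: along [u] for the function f(v + y) - f(y) of y, then along [v]
    for D_u f. *)
Lemma second_increment V (U : set V) (f : V -> R) x u v : Ck 2 U f ->
  (forall s t : R, 0 <= s <= 1 -> 0 <= t <= 1 -> U (s *: u + (t *: v + x))) ->
  exists s t : R, [/\ 0 <= s <= 1, 0 <= t <= 1 &
    f (u + (v + x)) - f (v + x) - (f (u + x) - f x) =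
    'D_v ('D_u f) (s *: u + (t *: v + x))].
Proof.
move=> fC inU.
have I0 : 0 <= (0 : R) <= 1 by rewrite lexx ler01.
have I1 : 0 <= (1 : R) <= 1 by rewrite lexx ler01.
have D1 (s : R) : 0 <= s <= 1 -> is_derive (s *: u + x) u (fun y => f (v + y) - f y)
    ((fun y => 'D_u f (v + y) - 'D_u f y) (s *: u + x)).
  move=> sI; apply: is_deriveB.
    apply/(is_derive_translate f); apply: (Ck_is_derive u fC).
    by have := inU s 1 sI I1; rewrite scale1r addrCA.
  apply: (Ck_is_derive u fC).
  by have := inU s 0 sI I0; rewrite scale0r add0r.
have [s sI Es] := @MVT_line _ (fun y => f (v + y) - f y) x u
  (fun y => 'D_u f (v + y) - 'D_u f y) D1.
have D2 (t : R) : 0 <= t <= 1 -> is_derive (t *: v + (s *: u + x)) v ('D_u f)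
    ('D_v ('D_u f) (t *: v + (s *: u + x))).
  move=> tI; apply: (Ck_is_derive v (Ck_derive u fC)).
  by rewrite addrCA; exact: inU.
have [t tI Et] := @MVT_line _ ('D_u f) (s *: u + x) v ('D_v ('D_u f)) D2.
exists s, t; split; [exact: sI|exact: tI|].
have swap (a b c d : R) : a - b - (c - d) = a - c - (b - d) by ring.
by rewrite [s *: u + (_ + _)]addrCA -Et -Es [v + (u + x)]addrCA swap.
Qed.

(** Schwarz's theorem. If the mixed derivatives differed, a number m would separate them on a whole
    ball; but the second increment is symmetric in the two directions and is, up to scaling, a value
    of each of them on that ball. *)
Lemma derive_symmetric_real V (U : set V) (f : V -> R) x u v : open U ->
  Ck 2 U f -> U x -> 'D_u ('D_v f) x = 'D_v ('D_u f) x.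
Proof.
move=> oU fC Ux.
wlog: u v / 'D_u ('D_v f) x < 'D_v ('D_u f) x.
  move=> H; have [//|] := eqVneq ('D_u ('D_v f) x) ('D_v ('D_u f) x).
  rewrite neq_lt => /orP[lt|lt]; first exact: H.
  by apply/esym; exact: H.
move=> lt; exfalso.
have cuv : {for x, continuous ('D_u ('D_v f))}.
  by apply: Ck_continuous (Ck_derive u (Ck_derive v fC)) Ux.
have cvu : {for x, continuous ('D_v ('D_u f))}.
  by apply: Ck_continuous (Ck_derive v (Ck_derive u fC)) Ux.
have [m mlt] : exists m, 'D_u ('D_v f) x < m /\ m < 'D_v ('D_u f) x.
  move: lt; move: ('D_u _ x) ('D_v _ x) => a b ab.
  by exists ((a + b) / 2); split; lra.
have : \forall y \near x, [/\ U y, 'D_u ('D_v f) y < m & m < 'D_v ('D_u f) y].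
  near=> y; split; near: y; first exact: open_nbhs_nbhs.
  - by apply: (cvgr_lt _ cuv); exact: mlt.1.
  - by apply: (cvgr_gt _ cvu); exact: mlt.2.
move=> /nbhs_normP [d d0 Hd].
(* The increments are taken along h u and h v, with h so small that every intermediate point stays
   in the ball of radius d. *)
have [h [h0 hd]] : exists h : R, 0 < h /\ h * (`|u| + `|v| + 1) = d.
  have M0 : 0 < `|u| + `|v| + 1 by rewrite ltr_wpDl // addr_ge0.
  by exists (d / (`|u| + `|v| + 1)); split; [exact: divr_gt0|rewrite divfK // gt_eqF].
have inb (a b : V) s t : `|a| + `|b| < `|u| + `|v| + 1 -> 0 <= s <= 1 -> 0 <= t <= 1 ->
    ball_ Num.Def.normr x d (s *: (h *: a) + (t *: (h *: b) + x)).
  move=> ab /andP[s0 s1] /andP[t0 t1]; rewrite /ball_ /= distrC addrA addrK.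
  rewrite (le_lt_trans (ler_normD _ _)) // !normrZ !ger0_norm ?(ltW h0) //.
  rewrite -hd.
  have : s * (h * `|a|) <= h * `|a| by rewrite ler_piMl // mulr_ge0 // ltW.
  have : t * (h * `|b|) <= h * `|b| by rewrite ler_piMl // mulr_ge0 // ltW.
  have : h * (`|a| + `|b|) < h * (`|u| + `|v| + 1) by rewrite ltr_pM2l.
  by clear; lra.
have lt1 (a b : V) : `|a| + `|b| < `|a| + `|b| + 1 by rewrite ltrDl.
have D2 (a b y : V) : U y -> 'D_(h *: b) ('D_(h *: a) f) y = h * (h * 'D_b ('D_a f) y).
  move=> Uy; have -> : 'D_(h *: b) ('D_(h *: a) f) y = 'D_(h *: b) (h \*: 'D_a f) y.
    apply: near_eq_derive; near=> z.
    have Uz : U z by near: z; exact: open_nbhs_nbhs.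
    by have [_ ->] := is_derive_scale_dir h (Ck_is_derive a fC Uz).
  have D1 := is_derive_scale_dir h (is_deriveZ h (Ck_is_derive b (Ck_derive a fC) Uy)).
  by have [_ ->] := D1.
have Ust (a b : V) : `|a| + `|b| < `|u| + `|v| + 1 -> forall s t : R, 0 <= s <= 1 -> 0 <= t <= 1 ->
    U (s *: (h *: a) + (t *: (h *: b) + x)).
  by move=> ab s t sI tI; have /Hd[] := inb _ _ s t ab sI tI.
have [s [t [sI tI E]]] := second_increment fC (Ust _ _ (lt1 u v)).
have vu : `|v| + `|u| < `|u| + `|v| + 1 by rewrite addrC.
have [s' [t' [sI' tI' E']]] := second_increment fC (Ust _ _ vu).
have [U1 _ H1] := Hd _ (inb _ _ s t (lt1 u v) sI tI).
have [U2 H2 _] := Hd _ (inb _ _ s' t' vu sI' tI').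
rewrite (D2 _ _ _ U1) in E; rewrite (D2 _ _ _ U2) [h *: v + (h *: u + x)]addrCA in E'.
have swap (p q r z : R) : p - q - (r - z) = p - r - (q - z) by clear; ring.
have : h * (h * 'D_v ('D_u f) (s *: (h *: u) + (t *: (h *: v) + x))) =
  h * (h * 'D_u ('D_v f) (s' *: (h *: v) + (t' *: (h *: u) + x))).
  exact: etrans (esym E) (etrans (swap _ _ _ _) E').
move=> /(mulfI (lt0r_neq0 h0)) /(mulfI (lt0r_neq0 h0)) EE.
by move: H1; rewrite EE => H1; have := lt_trans H1 H2; rewrite ltxx.
Unshelve. all: by end_near. Qed.

Lemma derive_symmetric V W (U : set V) (f : V -> W) x u v : open U -> findim W ->
  Ck 2 U f -> U x -> 'D_u ('D_v f) x = 'D_v ('D_u f) x.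
Proof.
move=> oU [n [e [c ec]]] fC Ux; apply: (coord_inj ec) => i.
have D (w w' : V) : c i ('D_w ('D_w' f) x) = 'D_w ('D_w' (c i \o f)) x.
  have [_ <-] := coord_derive i w ec (Ck_derive w' fC) Ux.
  apply: near_eq_derive; near=> y.
  have Uy : U y by near: y; exact: open_nbhs_nbhs.
  by have [_ /= <-] := coord_derive i w' ec fC Uy.
rewrite !D; apply: (derive_symmetric_real _ _ oU) Ux.
by have /(Ck_coord _ _ oU ec) := fC; exact.
Unshelve. all: by end_near. Qed.

(** Product rule: the argument of the form contributes the second derivative of [G], its base point
    the derivative of [beta]. *)
Lemma is_derive_form V0 V W (O : set V0) (U : set V) (G : V0 -> V)
    (beta : V -> V -> W) x w w' :
  open O -> open U -> findim V -> findim W ->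
  Ck 2 O G -> O x -> U (G x) ->
  (forall w, Ck 1 U (beta^~ w)) -> (forall y, U y -> linear (beta y)) ->
  is_derive x w (fun y => beta (G y) ('D_w' G y))
   (beta (G x) ('D_w ('D_w' G) x) + 'D_('D_w G x) (beta^~ ('D_w' G x)) (G x)).
Proof.
move=> oO oU fV fW GC Ox UGx bC bl; have [n [e [c ec]]] := fV.
have near_U : \forall y \near x, U (G y).
  have Gc := Ck_continuous GC Ox; exact: Gc (open_nbhs_nbhs (conj oU UGx)).
apply: (is_derive_near (f := fun y => \sum_i c i ('D_w' G y) *: beta (G y) (e i))).
  near=> y; have Uy : U (G y) by near: y.
  by rewrite [RHS](linear_coord ec (bl _ Uy)).
rewrite (linear_coord ec (bl _ UGx) ('D_w ('D_w' G) x)).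
have -> : 'D_('D_w G x) (beta^~ ('D_w' G x)) (G x) =
    \sum_i c i ('D_w' G x) *: 'D_('D_w G x) (beta^~ (e i)) (G x).
  have D1 : is_derive (G x) ('D_w G x) (\sum_i (fun y => c i ('D_w' G x) *: beta y (e i)))
    (\sum_i c i ('D_w' G x) *: 'D_('D_w G x) (beta^~ (e i)) (G x)).
    apply: is_derive_sum => i; apply: is_deriveZ.
    exact: Ck_is_derive (bC (e i)) UGx.
  have [_ <-] := D1; apply: near_eq_derive; near=> y.
  rewrite fct_sumE; apply: (linear_coord ec); apply: bl.
  by near: y; exact: open_nbhs_nbhs.
rewrite -big_split /= (_ : (fun y => _) = \sum_i (fun y => c i ('D_w' G y) *: beta (G y) (e i))); last first.
  by apply/funext => y; rewrite fct_sumE.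
apply: is_derive_sum => i.
apply: (@is_derive_bilinear V0 R W W (fun a w => a *: w)
  (c i \o 'D_w' G) (beta^~ (e i) \o G)) => //.
- exact: findim_R.
- by move=> y a b d; rewrite scalerDl scalerA.
- by move=> y a b d; rewrite scalerDr !scalerA mulrC.
- exact: coord_derive ec (Ck_derive w' GC) Ox.
- apply: (is_derive_comp oU fV fW (bC (e i)) UGx).
  exact: Ck_is_derive GC Ox.
Unshelve. all: by end_near. Qed.

(** The exterior derivative commutes with pull-back, because the second derivatives of [G] cancel by
    symmetry. The right-hand side involves [beta] only on velocities of [G], so for a form known on
    tangent vectors it does not depend on the extension. Points, velocities and derivatives are
    separate variables so that each can be supplied by its own computation. *)
Lemma pullback_ext_deriv V0 V W (O : set V0) (U : set V) (G : V0 -> V)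
    (beta : V -> V -> W) x u v z du dv a b :
  open O -> open U -> findim V -> findim W ->
  Ck 2 O G -> O x -> U z ->
  (forall w, Ck 1 U (beta^~ w)) -> (forall y, U y -> linear (beta y)) ->
  G x = z -> 'D_u G x = du -> 'D_v G x = dv ->
  'D_u (fun y => beta (G y) ('D_v G y)) x = a ->
  'D_v (fun y => beta (G y) ('D_u G y)) x = b ->
  'D_du (beta^~ dv) z - 'D_dv (beta^~ du) z = a - b.
Proof.
move=> oO oU fV fW GC Ox Uz bC bl Gx Gu Gv <- <-; rewrite -Gu -Gv -Gx.
have UGx : U (G x) by rewrite Gx.
have D w w' := is_derive_form w w' oO oU fV fW GC Ox UGx bC bl.
have [_ ->] := D u v; have [_ ->] := D v u.
by rewrite (derive_symmetric u v oO fV GC Ox) opprD addrACA subrr add0r.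
Qed.

End Ck.
End FiniteDimension.

(** * The action of SU(3) on T*CP^2 *)

Section SpecialUnitary.
Variable R : realType.
Local Notation M3 := 'M[R]_3.
Local Notation C3 := 'M[R[i]]_3.
Local Notation CM := (CM R).

Lemma cplxK : cancel (@cplx R) (@uncplx R).
Proof. by case=> a b; congr (_, _); apply/matrixP => i j; rewrite !mxE. Qed.

Lemma uncplxK : cancel (@uncplx R) (@cplx R).
Proof. by move=> m; apply/matrixP => i j; rewrite !mxE; case: (m i j). Qed.

Lemma uncplxD m n : uncplx (m + n) = uncplx m + uncplx n :> CM.
Proof.
by congr (_, _); apply/matrixP => i j; rewrite !mxE; case: (m i j) (n i j) => ? ? [].
Qed.

Lemma uncplxZ (a : R) m : uncplx (a%:C *: m) = a *: uncplx m :> CM.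
Proof.
congr (_, _); apply/matrixP => i j; rewrite !mxE; case: (m i j) => ? ? /=.
  by rewrite mul0r subr0.
by rewrite mul0r addr0.
Qed.

Lemma uncplx0 : uncplx 0 = 0 :> CM.
Proof. by rewrite -(scale0r 0) -[0]/(0%:C) uncplxZ scale0r. Qed.

Lemma uncplxN m : uncplx (- m) = - uncplx m :> CM.
Proof. by apply: (addrI (uncplx m)); rewrite -uncplxD !subrr uncplx0. Qed.

Lemma cplxD (x y : CM) : cplx (x + y) = cplx x + cplx y.
Proof. by apply: (can_inj uncplxK); rewrite cplxK uncplxD !cplxK. Qed.

Lemma cplxZ (a : R) (x : CM) : cplx (a *: x) = a%:C *: cplx x.
Proof. by apply: (can_inj uncplxK); rewrite cplxK uncplxZ cplxK. Qed.

Lemma cplx0 : cplx (0 : CM) = 0.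
Proof. by rewrite -uncplx0 uncplxK. Qed.

(** Product and adjoint are carried over to real pairs, where they are bilinear and linear over the
    reals and the calculus above applies. *)
Definition cmul (x y : CM) : CM := uncplx (cplx x *m cplx y).
Definition cadj (x : CM) : CM := uncplx ((cplx x)^t*).

Lemma cplx_cmul x y : cplx (cmul x y) = cplx x *m cplx y.
Proof. exact: uncplxK. Qed.

Lemma cplx_cadj x : cplx (cadj x) = (cplx x)^t*.
Proof. exact: uncplxK. Qed.

Lemma trC_D (m n : C3) : (m + n)^t* = m^t* + n^t*.
Proof. by rewrite linearD /= map_mxD. Qed.

Lemma trC_M m n l (x : 'M[R[i]]_(m, n)) (y : 'M[R[i]]_(n, l)) : (x *m y)^t* = y^t* *m x^t*.
Proof. by rewrite trmx_mul map_mxM. Qed.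

Lemma trC_Z (a : R) (m : C3) : (a%:C *: m)^t* = a%:C *: m^t*.
Proof.
apply/matrixP => i j; rewrite !mxE rmorphM /=; congr (_ * _).
by apply/eqP; rewrite eq_complex /= oppr0 !eqxx.
Qed.

Lemma trC_N (m : C3) : (- m)^t* = - m^t*.
Proof. by rewrite linearN /= map_mxN. Qed.

Lemma trC_1 : (1%:M : C3)^t* = 1%:M.
Proof. by rewrite trmx1 map_mx1. Qed.

Lemma cmul_linear_l y : linear (cmul^~ y).
Proof.
by move=> a x z; rewrite /cmul cplxD cplxZ mulmxDl uncplxD -scalemxAl uncplxZ.
Qed.

Lemma cmul_linear_r x : linear (cmul x).
Proof.
by move=> a y z; rewrite /cmul cplxD cplxZ mulmxDr uncplxD -scalemxAr uncplxZ.
Qed.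

Lemma cadj_linear : linear cadj.
Proof. by move=> a y z; rewrite /cadj cplxD cplxZ trC_D trC_Z uncplxD uncplxZ. Qed.

Lemma findim_CM : findim CM.
Proof. by apply: findim_prod; exact: findim_mx. Qed.

Lemma findim_TCP : findim (CM * CM)%type.
Proof. by apply: findim_prod; exact: findim_CM. Qed.

Lemma findim_E0 : findim (E0_space R).
Proof. by apply: findim_prod; [exact: findim_TCP|exact: findim_mx]. Qed.

(* [ad Z x] is the velocity at [x] of the action of exp(t Z). *)
Definition comm (Z m : C3) : C3 := Z *m m - m *m Z.
Definition ad1 (Z : C3) (x : CM) : CM := uncplx (comm Z (cplx x)).
Definition ad (Z : C3) (x : CM * CM) : CM * CM := (ad1 Z x.1, ad1 Z x.2).

Lemma comm_linear_r (Z : C3) (a : R) (m n : C3) :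
  comm Z (a%:C *: m + n) = a%:C *: comm Z m + comm Z n.
Proof.
by rewrite /comm mulmxDl mulmxDr -scalemxAr -scalemxAl scalerBr opprD addrACA.
Qed.

Lemma comm_linear_l (Z Z' : C3) (a : R) (m : C3) :
  comm (a%:C *: Z + Z') m = a%:C *: comm Z m + comm Z' m.
Proof.
by rewrite /comm mulmxDl mulmxDr -scalemxAr -scalemxAl scalerBr opprD addrACA.
Qed.

Lemma ad1_linear_r Z : linear (ad1 Z).
Proof. by move=> a x y; rewrite /ad1 cplxD cplxZ comm_linear_r uncplxD uncplxZ. Qed.

Lemma ad_linear_r Z : linear (ad Z).
Proof.
by move=> a x y; rewrite /ad [in LHS]ad1_linear_r [in LHS]ad1_linear_r.
Qed.

Lemma ad_linear_l (a : R) Z Z' x : ad (a%:C *: Z + Z') x = a *: ad Z x + ad Z' x.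
Proof.
have E (y : CM) : ad1 (a%:C *: Z + Z') y = a *: ad1 Z y + ad1 Z' y.
  by rewrite /ad1 comm_linear_l uncplxD uncplxZ.
by rewrite /ad [in LHS]E [in LHS]E.
Qed.

Lemma adZ (a : R) Z x : ad (a%:C *: Z) x = a *: ad Z x.
Proof. by rewrite -[_ *: Z]addr0 ad_linear_l /ad /ad1 /comm !mul0mx !mulmx0 subrr uncplx0 addr0. Qed.

Lemma conj_by_cmul g (x : CM) : conj_by g (cplx x) = cmul (cmul g x) (cadj g).
Proof. by rewrite /conj_by /cmul /cadj !uncplxK. Qed.

Lemma conj_by_linear g : linear (fun x : CM => conj_by g (cplx x)).
Proof. by move=> a x y; rewrite !conj_by_cmul cmul_linear_r cmul_linear_l. Qed.

Lemma su3_act_linear g : linear (su3_act g : CM * CM -> CM * CM).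
Proof.
by move=> a x y; rewrite /su3_act /= [in LHS]conj_by_linear [in LHS]conj_by_linear.
Qed.

Lemma conj_by_mul g h m : conj_by (cmul g h) m = conj_by g (cplx (conj_by h m)).
Proof. by rewrite /conj_by cplx_cmul uncplxK trC_M !mulmxA. Qed.

Lemma su3_act_cmul (g h : CM) x : su3_act (cmul g h) x = su3_act g (su3_act h x).
Proof. by rewrite /su3_act [in LHS]conj_by_mul [in LHS]conj_by_mul. Qed.

Lemma su3_act1 (x : CM * CM) : su3_act (uncplx 1%:M) x = x.
Proof.
have E (y : CM) : conj_by (uncplx 1%:M) (cplx y) = y.
  by rewrite /conj_by uncplxK trC_1 mul1mx mulmx1 cplxK.
by rewrite /su3_act !E; case: x.
Qed.

Lemma SU3_inv (g : CM) : SU3 g -> (cplx g)^t* *m cplx g = 1%:M.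
Proof. by case=> /unitarymxP/mulmx1C. Qed.

Lemma SU3_cmul (g h : CM) : SU3 g -> SU3 h -> SU3 (cmul g h).
Proof.
move=> [/unitarymxP gu gd] [/unitarymxP hu hd]; split; rewrite cplx_cmul.
  by apply/unitarymxP; rewrite trC_M mulmxA -[_ *m _ *m (cplx h)^t*]mulmxA hu mulmx1.
by rewrite det_mulmx gd hd mulr1.
Qed.

Lemma SU3_cadj (g : CM) : SU3 g -> SU3 (cadj g).
Proof.
move=> [gu gd]; split; rewrite cplx_cadj; first by rewrite trmxC_unitary.
by rewrite det_map_mx det_tr gd rmorph1.
Qed.

Lemma SU3_1 : SU3 (uncplx 1%:M : CM).
Proof.
by split; rewrite uncplxK ?det1 //; apply/unitarymxP; rewrite trC_1 mul1mx.
Qed.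

Lemma cadj_cmul (g : CM) : SU3 g -> cmul (cadj g) g = uncplx 1%:M.
Proof. by move=> /SU3_inv gu; rewrite /cmul cplx_cadj gu. Qed.

Lemma TCP2_star_su3_act (g : CM) (x : CM * CM) : SU3 g -> TCP2_star x -> TCP2_star (su3_act g x).
Proof.
move=> gS [[pp ph pt pq qp] q0]; have gV := SU3_inv gS.
have [/unitarymxP gu _] := gS.
have cj m n : cplx (conj_by g m) *m cplx (conj_by g n) = cplx (conj_by g (m *m n)).
  rewrite /conj_by !uncplxK !mulmxA; congr (_ *m _ *m _).
  by rewrite -[LHS]mulmxA gV mulmx1.
split.
  rewrite /TCP2 /su3_act /=; split; rewrite ?cj ?pp ?pq ?qp //.
  - by rewrite /conj_by uncplxK !trC_M ph trmxCK mulmxA.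
  - by rewrite /conj_by uncplxK mxtrace_mulC mulmxA gV mul1mx.
  - by rewrite /conj_by uncplxK mulmx0 mul0mx.
rewrite /su3_act /=; apply: contraNneq q0 => /(congr1 (@cplx R)).
rewrite uncplxK cplx0 => E; apply/eqP; rewrite -[x.2]cplxK -uncplx0; congr uncplx.
have := congr1 (fun m => (cplx g)^t* *m m *m cplx g) E.
rewrite mulmx0 mul0mx !mulmxA gV mul1mx -mulmxA gV mulmx1; exact.
Qed.

Lemma Ck_cmul (V : normedModType R) k (U : set V) (f g : V -> CM) : open U ->
  Ck k U f -> Ck k U g -> Ck k U (fun x => cmul (f x) (g x)).
Proof.
move=> oU; apply: Ck_bilinear => //; try exact: findim_CM.
  exact: cmul_linear_l.
exact: cmul_linear_r.
Qed.

Lemma Ck_su3_act (V : normedModType R) k (U : set V) (g : V -> CM) (x : V -> CM * CM) :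
  open U -> Ck k U g -> Ck k U x -> Ck k U (fun y => su3_act (g y) (x y)).
Proof.
move=> oU gC xC; have adjC : Ck k U (fun y => cadj (g y)).
  by apply: (Ck_linear_comp oU findim_CM findim_CM cadj_linear).
have C1 : Ck k U (fun y => (x y).1).
  by apply: (Ck_linear_comp (l := fst) oU findim_TCP findim_CM).
have C2 : Ck k U (fun y => (x y).2).
  by apply: (Ck_linear_comp (l := snd) oU findim_TCP findim_CM).
rewrite /su3_act; under eq_fun do rewrite !conj_by_cmul.
by apply: Ck_pair => //; try exact: findim_CM; do 2!apply: Ck_cmul => //.
Qed.

Lemma is_derive_pair (V W W' : normedModType R) (f : V -> W) (g : V -> W') x v df dg :
  findim W -> findim W' -> is_derive x v f df -> is_derive x v g dg ->
  is_derive x v (fun y => (f y, g y)) (df, dg).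
Proof.
move=> fW fW' Df Dg.
have l1 : linear (fun w : W => (w, 0 : W')).
  by move=> a y z; rewrite /GRing.scale /= /scale_pair /= /GRing.add /= /add_pair /= scaler0 addr0.
have l2 : linear (fun w : W' => (0 : W, w)).
  by move=> a y z; rewrite /GRing.scale /= /scale_pair /= /GRing.add /= /add_pair /= scaler0 addr0.
have fP := findim_prod fW fW'.
have := is_deriveD (is_derive_lin fW fP l1 Df) (is_derive_lin fW' fP l2 Dg).
rewrite {2}/GRing.add /= /add_pair /= addr0 add0r.
rewrite (_ : _ + _ = fun y => (f y, g y)) //; apply/funext => y.
by rewrite {1}/GRing.add /= {1}/GRing.add /= /add_pair /= addr0 add0r.
Qed.

(** For g' = g Z the derivative of g x g^* is the conjugate by g of Z x + x Z^* + x', and skewness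
    of [Z] turns the first two terms into a commutator. *)
Lemma is_derive_su3_act (V : normedModType R) (g : V -> CM) (x : V -> CM * CM)
    p v (Z : C3) dx : Z^t* = - Z -> is_derive p v g (uncplx (cplx (g p) *m Z)) ->
  is_derive p v x dx ->
  is_derive p v (fun y => su3_act (g y) (x y)) (su3_act (g p) (ad Z (x p) + dx)).
Proof.
move=> ZS Dg Dx.
have D (l : CM * CM -> CM) : linear l ->
    is_derive p v (fun y => conj_by (g y) (cplx (l (x y))))
    (conj_by (g p) (cplx (ad1 Z (l (x p)) + l dx))).
  move=> ll; under eq_fun do rewrite conj_by_cmul.
  have Dl := is_derive_lin findim_TCP findim_CM ll Dx.
  have Da := is_derive_lin findim_CM findim_CM cadj_linear Dg.
  have D1 := is_derive_bilinear findim_CM findim_CM findim_CM cmul_linear_l cmul_linear_r Dg Dl.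
  have D2 := is_derive_bilinear findim_CM findim_CM findim_CM cmul_linear_l cmul_linear_r D1 Da.
  apply: is_derive_eq D2 _; rewrite /ad1 /cmul /cadj /conj_by /= !cplxD !uncplxK.
  rewrite -uncplxD trC_M ZS; congr uncplx.
  rewrite /comm !(mulmxDr, mulmxDl) !(mulmxN, mulNmx, mulmxA).
  by rewrite -!addrA; congr (_ + _); rewrite addrC.
have D1 := D fst (fun _ _ _ => erefl); have D2 := D snd (fun _ _ _ => erefl).
exact: (is_derive_pair findim_CM findim_CM D1 D2).
Qed.

(** * Explicit 3x3 matrices and one-parameter subgroups of SU(3) *)

Lemma mx3P (T : Type) (A B : 'M[T]_3) :
  A 0 0 = B 0 0 -> A 0 1 = B 0 1 -> A 0 2 = B 0 2 ->
  A 1 0 = B 1 0 -> A 1 1 = B 1 1 -> A 1 2 = B 1 2 ->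
  A 2 0 = B 2 0 -> A 2 1 = B 2 1 -> A 2 2 = B 2 2 -> A = B.
Proof.
have H (i : 'I_3) : [\/ i = 0, i = 1 | i = 2].
  by case: i => [[|[|[|//]]] i]; [constructor 1|constructor 2|constructor 3]; exact: val_inj.
by move=> *; apply/matrixP => i j; case: (H i) (H j) => -> [] ->.
Qed.

Lemma sum3 (V : nmodType) (F : 'I_3 -> V) : \sum_i F i = F 0 + F 1 + F 2.
Proof.
rewrite !big_ord_recl big_ord0 addr0 addrA.
by congr (_ + F _ + F _); apply: val_inj.
Qed.

Lemma det3 (F : comNzRingType) (A : 'M[F]_3) :
  \det A = A 0 0 * (A 1 1 * A 2 2 - A 1 2 * A 2 1)
         - A 0 1 * (A 1 0 * A 2 2 - A 1 2 * A 2 0)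
         + A 0 2 * (A 1 0 * A 2 1 - A 1 1 * A 2 0).
Proof.
have d2 (M : 'M[F]_2) : \det M = M 0 0 * M 1 1 - M 0 1 * M 1 0.
  rewrite (expand_det_row _ 0) !big_ord_recl big_ord0 addr0 /cofactor !det_mx11 !mxE /=.
  rewrite expr0 expr1 mul1r mulN1r mulrN.
  by congr (M _ _ * M _ _ - M _ _ * M _ _); apply: val_inj.
rewrite (expand_det_row _ 0) sum3 /cofactor !d2 !mxE /=.
rewrite expr0 expr1 -signr_odd /= expr0 !mul1r mulN1r mulrN.
by congr (A _ _ * (A _ _ * A _ _ - A _ _ * A _ _) - A _ _ * (A _ _ * A _ _ - A _ _ * A _ _)
  + A _ _ * (A _ _ * A _ _ - A _ _ * A _ _)); apply: val_inj.
Qed.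

Definition ord3E := ((erefl : (0 == 1 :> 'I_3) = false), (erefl : (0 == 2 :> 'I_3) = false),
  (erefl : (1 == 0 :> 'I_3) = false), (erefl : (1 == 2 :> 'I_3) = false),
  (erefl : (2 == 0 :> 'I_3) = false), (erefl : (2 == 1 :> 'I_3) = false)).

(** Rodrigues' closed form of exp(t X), valid when X^3 = - X. *)
Definition rotation (X : C3) (t : R) : CM :=
  uncplx 1%:M + sin t *: uncplx X + (1 - cos t) *: uncplx (X *m X).

(* Infinitesimal generators satisfying Rodrigues' formula. *)
Definition rotgen (X : C3) : Prop :=
  [/\ X^t* = - X, X *m X *m X = - X & forall t, \det (cplx (rotation X t)) = 1].

Lemma cplx_rotation X t : cplx (rotation X t) =
  1%:M + (sin t)%:C *: X + (1 - cos t)%:C *: (X *m X).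
Proof. by rewrite /rotation !cplxD !cplxZ !uncplxK. Qed.

Lemma rotation0 X : rotation X 0 = uncplx 1%:M.
Proof. by rewrite /rotation sin0 cos0 subrr !scale0r !addr0. Qed.

(** For Y = X^2, s = sin t and c = 1 - cos t, the left-hand side is the expanded product of a
    rotation with its adjoint; the hypothesis on s and c is cos^2 + sin^2 = 1. *)
Lemma rodrigues_sum (F : comNzRingType) (X Y : 'M[F]_3) (s c : F) :
  c + c - c * c - s * s = 0 ->
  1%:M - s *: X + c *: Y + (s *: X - (s * s) *: Y - (s * c) *: X) +
  (c *: Y + (c * s) *: X - (c * c) *: Y) = 1%:M.
Proof.
move=> E; apply/matrixP => i j; rewrite !mxE.
by rewrite -[RHS]addr0 -[X in _ = _ + X](mul0r (Y i j)) -E; ring.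
Qed.

Lemma SU3_rotation X t : rotgen X -> SU3 (rotation X t).
Proof.
move=> [XS X3 dX]; split; last exact: dX.
apply/unitarymxP; rewrite cplx_rotation !trC_D !trC_Z trC_1 trC_M XS mulmxN mulNmx opprK.
set s := (sin t)%:C; set c := (1 - cos t)%:C.
have X4 : X *m X *m (X *m X) = - (X *m X) by rewrite mulmxA X3 mulNmx.
have X3' : X *m (X *m X) = - X by rewrite mulmxA.
rewrite !(mulmxDl, mulmxDr) mul1mx !mulmx1 !mul1mx.
rewrite !(scalemxAl, scalemxAr, scalerN, mulmxN, mulNmx) -!(scalemxAl, scalemxAr) X3 X3' X4.
rewrite !(scalerN, opprK, scalerA).
have E : c + c - c * c - s * s = 0.
  have ct := cos2Dsin2 t; rewrite /s /c.
  apply/eqP; rewrite eq_complex /=; apply/andP; split; apply/eqP; last by ring.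
  have -> : sin t * sin t = 1 - cos t * cos t by rewrite -ct !expr2; ring.
  by ring.
exact: rodrigues_sum.
Qed.

Lemma is_derive_scalel (V W : normedModType R) (f : V -> R) (w : W) x v df :
  is_derive x v f df -> is_derive x v (fun y => f y *: w) (df *: w).
Proof.
move=> D; apply: (@is_derive_linear _ V R W (fun a : R => a *: w)) D.
- by move=> a y z; rewrite scalerDl scalerA.
- by move=> y; apply: cvgZr_tmp; exact: cvg_id.
Qed.

Lemma is_derive_rotation X (t : R) : rotgen X ->
  is_derive t 1 (rotation X) (uncplx (cplx (rotation X t) *m X)).
Proof.
move=> [XS X3 dX].
have D1 := is_derive_scalel (uncplx X : CM) (is_derive_sin t).
have := is_deriveB (is_derive_cst (1 : R) t 1) (is_derive_cos t).
rewrite sub0r opprK => /(is_derive_scalel (uncplx (X *m X) : CM)) D2.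
have := is_deriveD (is_deriveD (is_derive_cst (uncplx 1%:M : CM) t 1) D1) D2.
rewrite add0r cplx_rotation !mulmxDl mul1mx -!scalemxAl X3 uncplxD uncplxD !uncplxZ uncplxN.
rewrite (_ : uncplx X + _ + _ = cos t *: uncplx X + sin t *: uncplx (X *m X)) //.
rewrite scalerN scalerBl scale1r opprB.
by rewrite addrC addrA [_ - uncplx X + uncplx X]subrK.
Qed.

Lemma Ck_sin_cos k (U : set R) : open U -> Ck k U (@sin R) /\ Ck k U (@cos R).
Proof.
move=> oU; elim: k => [|k [IHs IHc]].
  by split; split=> // x _; [exact: continuous_sin|exact: continuous_cos].
split.
  apply: (@Ck_intro _ R R k U _ (fun x v => v * cos x) oU).
  - by move=> x _; exact: continuous_sin.
  - by move=> x v _; have := is_derive_scale_dir v (is_derive_sin x); rewrite /GRing.scale /= mulr1.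
  - by move=> v; apply: Ck_mulr => //; exact: Ck_cst.
apply: (@Ck_intro _ R R k U _ (fun x v => (- v) * sin x) oU).
- by move=> x _; exact: continuous_cos.
- move=> x v _; have := is_derive_scale_dir v (is_derive_cos x).
  by rewrite /GRing.scale /= mulr1 mulrN mulNr.
- by move=> v; apply: Ck_mulr => //; exact: Ck_cst.
Qed.

Lemma Ck_rotation X k (U : set R) : open U -> Ck k U (rotation X).
Proof.
move=> oU; have [sC cC] := Ck_sin_cos k oU; rewrite /rotation.
apply: Ck_add => //; first exact: findim_CM.
  apply: Ck_add => //; first exact: findim_CM.
    exact: Ck_cst.
  by apply: Ck_scale => //; [exact: findim_CM|exact: Ck_cst].
apply: Ck_scale => //; first exact: findim_CM; last exact: Ck_cst.
have -> : (fun x : R => 1 - cos x) = (fun x => 1 + (-1) * cos x).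
  by apply/funext => x; rewrite mulN1r.
by apply: Ck_addr => //; [exact: Ck_cst|apply: Ck_mulr => //; exact: Ck_cst].
Qed.

(** Here [c] is 1 - cos t, so the matrix is a 2x2 block with cos t on the diagonal and s u, s w off
    it. An abstract ring keeps [ring] from looking into complex numbers. *)
Lemma det_rotation_pair (F : comNzRingType) (i j : 'I_3) (u w s c : F) : i != j ->
  u * w = - 1 -> c + c - c * c - s * s = 0 ->
  \det (1%:M + s *: (u *: delta_mx i j + w *: delta_mx j i)
         - c *: (delta_mx i i + delta_mx j j)) = 1.
Proof.
move=> ij uw E; have E' : (1 - c) * (1 - c) - s * s * (u * w) = 1.
  by rewrite uw -[RHS]subr0 -E; ring.
case: i j ij => [[|[|[|//]]] i] [[|[|[|//]]] j] // _; rewrite det3 !mxE -!val_eqE /=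
  -[RHS]E'; ring.
Qed.

Lemma det_rotation_diag (F : comNzRingType) (u s c : F) :
  u * u = - 1 -> c + c - c * c - s * s = 0 ->
  \det (1%:M + s *: (u *: (delta_mx 0 0 - delta_mx 1 1))
         - c *: (delta_mx 0 0 + delta_mx 1 1) : 'M[F]_3) = 1.
Proof.
move=> uu E; have E' : (1 - c) * (1 - c) - s * s * (u * u) = 1.
  by rewrite uu -[RHS]subr0 -E; ring.
rewrite det3 !mxE -!val_eqE /= -[RHS]E'; ring.
Qed.

Lemma trC_Zc (a : R[i]) (m : C3) : (a *: m)^t* = Num.conj a *: m^t*.
Proof. by rewrite linearZ /= map_mxZ. Qed.

Lemma trC_delta (i j : 'I_3) : (delta_mx i j : C3)^t* = delta_mx j i.
Proof. by rewrite trmx_delta map_delta_mx. Qed.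

Lemma rotgen_pair (i j : 'I_3) (u w : R[i]) : i != j -> u * w = -1 -> Num.conj u = - w ->
  rotgen (u *: delta_mx i j + w *: delta_mx j i).
Proof.
move=> ij uw uc; have ji : j != i by rewrite eq_sym.
have wc : Num.conj w = - u by rewrite -[u]conjCK uc rmorphN opprK.
have X2 : (u *: delta_mx i j + w *: delta_mx j i) *m (u *: delta_mx i j + w *: delta_mx j i)
   = - (delta_mx i i + delta_mx j j) :> C3.
  rewrite !(mulmxDl, mulmxDr) -!(scalemxAl, scalemxAr) !mul_delta_mx_cond !eqxx
    (negPf ij) (negPf ji) !mulr0n !mulr1n !scaler0 !scalerA [w * u]mulrC uw !scaleN1r.
  by rewrite add0r addr0 opprD addrC.
split.
- by rewrite trC_D !trC_Zc !trC_delta uc wc !scaleNr opprD addrC.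
- rewrite X2 mulNmx !(mulmxDl, mulmxDr) -!(scalemxAl, scalemxAr) !mul_delta_mx_cond !eqxx
    (negPf ij) (negPf ji) !mulr0n !mulr1n !scaler0.
  by rewrite addr0 add0r.
- move=> t; rewrite cplx_rotation X2 scalerN det_rotation_pair //.
  have ct := cos2Dsin2 t.
  apply/eqP; rewrite eq_complex /=; apply/andP; split; apply/eqP; last by ring.
  have -> : sin t * sin t = 1 - cos t * cos t by rewrite -ct !expr2; ring.
  by ring.
Qed.

Definition Ci : R[i] := Complex 0 1.
(** [gR] and [gI] are dual to the real and imaginary parts of the entry (i, j) of the Maurer-Cartan
    form, [gK] to kappa. The explicit coefficients 1 and -1 give all pairs the shape required by
    [rotgen_pair]. *)
Definition gR (i j : 'I_3) : C3 := 1 *: delta_mx i j + (-1) *: delta_mx j i.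
Definition gI (i j : 'I_3) : C3 := Ci *: delta_mx i j + Ci *: delta_mx j i.
Definition gK : C3 := Ci *: (delta_mx 0 0 - delta_mx 1 1).

Lemma conjC_i : Num.conj Ci = - Ci.
Proof. by apply/eqP; rewrite eq_complex /= oppr0 !eqxx. Qed.

Lemma mulC_i : Ci * Ci = -1.
Proof. by apply/eqP; rewrite eq_complex; apply/andP; split; apply/eqP => /=; ring. Qed.

Lemma rotgen_gR i j : i != j -> rotgen (gR i j).
Proof. by move=> ij; apply: rotgen_pair; rewrite ?mul1r ?rmorph1 ?opprK. Qed.

Lemma rotgen_gI i j : i != j -> rotgen (gI i j).
Proof. by move=> ij; apply: rotgen_pair => //; [exact: mulC_i|exact: conjC_i]. Qed.

Lemma rotgen_gK : rotgen gK.
Proof.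
have X2 : gK *m gK = - (delta_mx 0 0 + delta_mx 1 1).
  rewrite /gK -!(scalemxAl, scalemxAr) scalerA mulC_i scaleN1r; congr (- _).
  rewrite !(mulmxDl, mulmxDr, mulmxN, mulNmx) !mul_delta_mx_cond !eqxx !ord3E !mulr0n !mulr1n.
  by rewrite oppr0 addr0 opprK add0r.
split.
- by rewrite trC_Zc conjC_i trC_D trC_N !trC_delta scaleNr.
- rewrite X2 /gK -!(scalemxAl, scalemxAr) -scalerN; congr (_ *: _); rewrite mulNmx; congr (- _).
  rewrite !(mulmxDl, mulmxDr, mulmxN, mulNmx) !mul_delta_mx_cond !eqxx !ord3E !mulr0n !mulr1n.
  by rewrite oppr0 addr0 add0r.
- move=> t; rewrite cplx_rotation X2 /gK scalerN; apply: det_rotation_diag; first exact: mulC_i.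
  have ct := cos2Dsin2 t.
  apply/eqP; rewrite eq_complex /=; apply/andP; split; apply/eqP; last by ring.
  have -> : sin t * sin t = 1 - cos t * cos t by rewrite -ct !expr2; ring.
  by ring.
Qed.
End SpecialUnitary.

(** * Linear relations implied by the instanton equation *)

Section HodgeAlgebra.
Variable R : realType.
Local Notation form W := (extalg W).

Definition bas (A : {set 'I_8}) : extalg (R^o : lmodType R) := [ffun S : {set 'I_8} => (S == A)%:R].

Lemma wedge_bas (W : lmodType R) (A S : {set 'I_8}) (b : extalg W) :
  wedge (bas A) b S = if A \subset S then shuffle_sign R A (S :\: A) *: b (S :\: A) else 0.
Proof.
rewrite ffunE; case: ifP => [AS|/negbT AS].
  rewrite (bigD1 A) //= ffunE eqxx mulr1 big1 ?addr0 // => T /andP[_ TA].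
  by rewrite ffunE (negPf TA) mulr0 scale0r.
rewrite big1 // => T TS; rewrite ffunE; case: eqP => [E|_]; last by rewrite mulr0 scale0r.
by rewrite E (negPf AS) in TS.
Qed.

Lemma wedge_bas_bas (A B : {set 'I_8}) :
  wedge (bas A) (bas B) = if [disjoint A & B] then shuffle_sign R A B *: bas (A :|: B) else 0.
Proof.
apply/ffunP => S; rewrite wedge_bas.
have [dAB|dAB] := boolP [disjoint A & B]%B; last first.
  have [AS|AS] := boolP (A \subset S); rewrite [in RHS]ffunE //.
  rewrite ffunE; case: eqP => [E|_]; last by rewrite scaler0.
  by rewrite -E -finset.setI_eq0 finset.setIDA finset.setDIl finset.setDv finset.set0I eqxx in dAB.
rewrite [in RHS]ffunE /= [in RHS]ffunE; have [AS|AS] := boolP (A \subset S).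
  rewrite ffunE; have -> : (S :\: A == B) = (S == A :|: B).
    apply/eqP/eqP => [<-|->].
      apply/finset.setP => x; rewrite !inE.
      by case xA: (x \in A) => //=; rewrite (fintype.subsetP AS).
    by rewrite finset.setDUl finset.setDv finset.set0U; apply/finset.setDidPl; rewrite disjoint_sym.
  case: eqP => [->|]; rewrite ?scaler0 // finset.setDUl finset.setDv finset.set0U.
  by rewrite (finset.setDidPl _) // disjoint_sym.
by case: eqP => [E|_]; [rewrite E finset.subsetUl in AS|rewrite scaler0].
Qed.

Lemma wedge_linear_l (W : lmodType R) (b : extalg W) : linear (fun a => wedge a b).
Proof.
move=> c a a'; apply/ffunP => S; rewrite !ffunE scaler_sumr -big_split /=.
apply: eq_bigr => T _; rewrite !ffunE mulrDr scalerDl; congr (_ + _).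
by rewrite [c *: a T]/(c * a T) scalerA mulrCA.
Qed.

Lemma wedge_linear_r (W : lmodType R) (a : extalg (R^o : lmodType R)) : linear (fun b : extalg W => wedge a b).
Proof.
move=> c b b'; apply/ffunP => S; rewrite !ffunE scaler_sumr -big_split /=.
by apply: eq_bigr => T _; rewrite !ffunE scalerDr !scalerA mulrC.
Qed.

(** Index sets are encoded by lists of numbers so that inclusions, differences and shuffle signs are
    obtained by computation. *)
Definition ixs (s : seq nat) : {set 'I_8} := [set i : 'I_8 | (i : nat) \in s]%SET.

(** The number of inversions between the two index lists, that is, the exponent of the shuffle
    sign. *)
Definition inv (s t : seq nat) : nat :=
  sumn [seq sumn [seq nat_of_bool [&& i \in s, j \in t & (j < i)%N] | j <- iota 0 8] | i <- iota 0 8].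

Lemma shuffle_sign_ixs s t : shuffle_sign R (ixs s) (ixs t) = (-1) ^+ inv s t.
Proof.
rewrite /shuffle_sign /inv; congr (_ ^+ _).
rewrite cardsE -sum1_card big_mkcond sumnE big_map (_ : iota 0 8 = index_iota 0 8) // big_mkord.
rewrite -(pair_bigA _ (fun i j => if (i, j) \in [pred p : 'I_8 * 'I_8 | [&& p.1 \in ixs s, p.2 \in ixs t & (p.2 < p.1)%N]] then 1 else 0)).
apply: eq_bigr => i _; rewrite sumnE big_map big_mkord.
by apply: eq_bigr => j _; rewrite inE /= !inE; case: ifP.
Qed.

Definition subl (s u : seq nat) : bool := all (fun i => (i \in s) ==> (i \in u)) (iota 0 8).
Definition disjl (s u : seq nat) : bool := all (fun i => ~~ ((i \in s) && (i \in u))) (iota 0 8).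
Definition difl (u s : seq nat) : seq nat := [seq i <- u | i \notin s].

Lemma ixs_subset s u : (ixs s \subset ixs u) = subl s u.
Proof.
apply/fintype.subsetP/allP => [H i|H i]; last first.
  by rewrite !inE => si; have := H i; rewrite mem_iota ltn_ord => /(_ isT); rewrite si.
rewrite mem_iota => i8; apply/implyP => si.
by have := H (Ordinal i8); rewrite !inE /=; apply.
Qed.

Lemma ixs_disjoint s u : [disjoint ixs s & ixs u]%B = disjl s u.
Proof.
rewrite -setI_eq0; apply/eqP/allP => [H i|H].
  rewrite mem_iota => i8; apply/negP => /andP[si ui].
  have : Ordinal i8 \in ixs s :&: ixs u by rewrite !inE si ui.
  by rewrite H inE.
apply/finset.setP => i; rewrite !inE; apply/negbTE; apply: H.
by rewrite mem_iota ltn_ord.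
Qed.

Lemma ixs_difl u s : ixs u :\: ixs s = ixs (difl u s).
Proof. by apply/finset.setP => i; rewrite !inE mem_filter. Qed.

Lemma ixs_cat u s : ixs u :|: ixs s = ixs (u ++ s).
Proof. by apply/finset.setP => i; rewrite !inE mem_cat. Qed.

(* The signed index pairs of the monomials of the Kaehler forms. *)
Definition kpairs (L : complex_structure) : seq (nat * seq nat) :=
  match L with
  | cI => [:: (1, [:: 0; 7]); (0, [:: 5; 6]); (0, [:: 1; 2]); (1, [:: 3; 4])]
  | cJ => [:: (1, [:: 0; 6]); (1, [:: 5; 7]); (1, [:: 2; 3]); (0, [:: 1; 4])]
  | cK => [:: (0, [:: 0; 5]); (1, [:: 6; 7]); (0, [:: 2; 4]); (0, [:: 1; 3])]
  end%N.

Lemma e2E (i j : nat) (hi : (i < 8)%N) (hj : (j < 8)%N) : (i < j)%N ->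
  e2 R (Ordinal hi) (Ordinal hj) = bas (ixs [:: i; j]).
Proof.
move=> ij; have E k (hk : (k < 8)%N) : e1 R (Ordinal hk) = bas (ixs [:: k]).
  apply/ffunP => S; rewrite !ffunE; congr (_ == _)%:R.
  by apply/finset.setP => l; rewrite !inE.
rewrite /e2 !E wedge_bas_bas ixs_disjoint ixs_cat shuffle_sign_ixs.
have -> : inv [:: i] [:: j] = 0%N.
  rewrite /inv sumnE big_map big1_seq // => k _; rewrite sumnE big_map big1_seq // => l _.
  by rewrite !inE; case: eqP => //= ->; case: eqP => //= ->; rewrite ltnNge ltnW.
have -> : disjl [:: i] [:: j].
  by apply/allP => k _; rewrite !inE; case: eqP => //= ->; rewrite neq_ltn ij.
by rewrite expr0 scale1r.
Qed.

Lemma omegaE L : omega R L = \sum_(t <- kpairs L) (-1) ^+ t.1 *: bas (ixs t.2).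
Proof.
have e2E' (i j : 'I_8) : (i < j)%N -> e2 R i j = bas (ixs [:: i : nat; j : nat]).
  by case: i j => i hi [j hj] ij; exact: e2E.
by case: L; rewrite /omega /kpairs !big_cons big_nil /= !e2E' // expr0 expr1 !scale1r !scaleN1r addr0 !addrA.
Qed.

(** The surviving contributions to the coefficient of omega^2 /\ b on [u]: pairs of disjoint
    monomials of omega inside [u], recorded as the exponent of the total sign and the indices left
    for b. *)
Definition terms (L : complex_structure) (u : seq nat) : seq (nat * seq nat) :=
  [seq ((p.1.1 + p.2.1 + inv p.1.2 p.2.2 + inv (p.1.2 ++ p.2.2) (difl u (p.1.2 ++ p.2.2)))%N,
        difl u (p.1.2 ++ p.2.2))
    | p <- [seq p <- [seq (k, l) | k <- kpairs L, l <- kpairs L]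
             | disjl p.1.2 p.2.2 && subl (p.1.2 ++ p.2.2) u]].

Lemma wedge2E (W : lmodType R) L (b : extalg W) u :
  wedge (wedge (omega R L) (omega R L)) b (ixs u) =
  \sum_(t <- terms L u) (-1) ^+ t.1 *: b (ixs t.2).
Proof.
rewrite /terms big_map big_filter big_mkcond big_allpairs_dep /= omegaE.
have lsum (V V' : lmodType R) (f : V -> V') (lf : linear f) (r : seq (nat * seq nat)) (F : nat * seq nat -> V) :
    f (\sum_(t <- r) F t) = \sum_(t <- r) f (F t).
  pose g : {linear V -> V'} := HB.pack f (GRing.isLinear.Build R V V' *:%R f lf).
  exact: (raddf_sum g).
have lsc (V V' : lmodType R) (f : V -> V') (lf : linear f) a x : f (a *: x) = a *: f x.
  have f0 : f 0 = 0 by have := lf (-1) 0 0; rewrite scaler0 addr0 scaleN1r addNr.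
  by rewrite -[a *: x]addr0 lf f0 addr0.
rewrite (lsum _ _ _ (wedge_linear_l _)) (lsum _ _ _ (wedge_linear_l b)) sum_ffunE.
apply: eq_bigr => k _.
rewrite (lsum _ _ _ (wedge_linear_r (_ *: bas _))) (lsum _ _ _ (wedge_linear_l b)) sum_ffunE.
apply: eq_bigr => l _ /=.
rewrite (lsc _ _ _ (wedge_linear_l _)) (lsc _ _ _ (wedge_linear_r (bas _))) !(lsc _ _ _ (wedge_linear_l b)).
rewrite wedge_bas_bas ixs_disjoint ixs_cat shuffle_sign_ixs.
have scE (c : R) (f : extalg W) S : (c *: f) S = c *: f S by rewrite ffunE.
case: ifP => /= _; last first.
  have -> : wedge 0 b = 0.
    by have := lsc _ _ _ (wedge_linear_l b) 0 0; rewrite /= !scale0r.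
  by rewrite !scaler0 ffunE.
rewrite (lsc _ _ _ (wedge_linear_l b)) !scE wedge_bas ixs_subset.
case: ifP => _; last by rewrite !scaler0.
by rewrite ixs_difl shuffle_sign_ixs !scalerA -!exprD !addnA.
Qed.

Lemma two_formE (W : lmodType R) (F : 'I_8 -> 'I_8 -> W) (i j : 'I_8) : (i < j)%N ->
  two_form F (ixs [:: i : nat; j : nat]) = F i j.
Proof.
move=> ij; rewrite ffunE.
have e2E' (k l : 'I_8) : (k < l)%N -> e2 R k l (ixs [:: i : nat; j : nat]) = ((k == i) && (l == j))%:R.
  case: k l => k hk [l hl] /= kl; rewrite e2E // ffunE; congr (nat_of_bool _)%:R.
  rewrite -[Ordinal hk == i]val_eqE -[Ordinal hl == j]val_eqE /=; apply/eqP/andP => [E0|[/eqP -> /eqP ->]//].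
  have E (x : 'I_8) : (x \in ixs [:: i : nat; j : nat]) = (x \in ixs [:: k; l]) by rewrite E0.
  have := E i; have := E j; have := E (Ordinal hk); have := E (Ordinal hl).
  rewrite !inE /= !eqxx /= !orbT.
  move: ij kl; case: i j {E E0} => i hi [j hj] /=; do !case: eqP => //; lia.
rewrite (bigD1 i) //= (bigD1 j) //= e2E' // !eqxx scale1r.
rewrite big1 ?addr0 => [|l /andP[il lj]]; last by rewrite e2E' // (negPf lj) andbF scale0r.
rewrite big1 ?addr0 // => k ki; rewrite big1 // => l kl.
by rewrite e2E' // (negPf ki) scale0r.
Qed.

Definition compl (i j : nat) := [seq k <- iota 0 8 | (k != i) && (k != j)].

(** The equation is evaluated on the complement of {i, j}, where the Hodge star leaves F i j up to
    sign. *)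
Lemma hodge_component (W : lmodType R) L (F : 'I_8 -> 'I_8 -> W) (i j : 'I_8) : (i < j)%N ->
  hodge (two_form F) = - (2^-1 *: wedge (wedge (omega R L) (omega R L)) (two_form F)) ->
  (-1) ^+ inv [:: i : nat; j : nat] (compl i j) *: F i j =
  - (2^-1 *: \sum_(t <- terms L (compl i j)) (-1) ^+ t.1 *: two_form F (ixs t.2)).
Proof.
move=> ij /ffunP /(_ (ixs (compl i j))).
rewrite [in RHS]ffunE [in RHS]ffunE wedge2E => <-; rewrite ffunE.
have -> : ~: ixs (compl i j) = ixs [:: i : nat; j : nat].
  apply/finset.setP => k; rewrite !inE mem_filter mem_iota ltn_ord andbT.
  by case: (_ == _ :> nat); case: (_ == _ :> nat).
by rewrite shuffle_sign_ixs two_formE.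
Qed.

Local Notation o k := (@Ordinal 8 k isT).

Lemma half_double (W : lmodType R) (w : W) : 2^-1 *: (w + w) = w.
Proof.
rewrite scalerDr -scalerDl (_ : 2^-1 + 2^-1 = 1) ?scale1r //.
by field.
Qed.

(** Each unordered pair of monomials of omega occurs twice in omega^2; the order of the summands is
    the one produced by [terms]. *)
Lemma half_triple (W : lmodType R) (x y z : W) :
  2^-1 *: (x + (y + (x + (z + (y + z))))) = x + y + z.
Proof.
rewrite -[RHS]half_double; congr (_ *: _).
rewrite -[x + y + z]addrA addrACA [y + z + _]addrACA -!addrA.
by rewrite [y + (x + _)]addrCA [z + (y + z)]addrCA.
Qed.

Section Relations.
Variables (W : lmodType R) (F : 'I_8 -> 'I_8 -> W).

Definition hodge_equation (L : complex_structure) : Prop :=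
  hodge (two_form F) = - (2^-1 *: wedge (wedge (omega R L) (omega R L)) (two_form F)).

Lemma sign_odd (n : nat) (w : W) : (-1) ^+ n *: w = if odd n then - w else w :> W.
Proof. by rewrite -signr_odd; case: odd; rewrite ?expr0 ?expr1 ?scale1r ?scaleN1r. Qed.

(** The list [r] is the announced expansion of the right-hand side. Its agreement with [terms], up
    to parity of the signs, holds by conversion, so uses of the lemma prove it by [erefl]. *)
Lemma hodge_equation_ind L (i j : 'I_8) (r : seq (bool * ('I_8 * 'I_8))) : (i < j)%N ->
  hodge_equation L ->
  all (fun t : bool * ('I_8 * 'I_8) => (t.2.1 < t.2.2)%N) r ->
  [seq (odd t.1, t.2) | t <- terms L (compl i j)] =
    map (fun t : bool * ('I_8 * 'I_8) => (t.1, [:: nat_of_ord t.2.1; nat_of_ord t.2.2])) r ->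
  (if odd (inv [:: i : nat; j : nat] (compl i j)) then - F i j else F i j) =
  - (2^-1 *: \sum_(t <- r) if t.1 then - F t.2.1 t.2.2 else F t.2.1 t.2.2).
Proof.
move=> ij H /allP r_lt E; rewrite -sign_odd (hodge_component ij H); congr (- (_ *: _)).
under eq_bigr do rewrite sign_odd.
pose f (t : bool * seq nat) : W := if t.1 then - two_form F (ixs t.2) else two_form F (ixs t.2).
rewrite -(big_map (fun t : nat * seq nat => (odd t.1, t.2)) xpredT f).
rewrite E big_map big_seq [RHS]big_seq; apply: eq_bigr => t /r_lt tr.
by rewrite /f two_formE.
Qed.

(** The first two relations will kill the nu components of the connection; the third is the radial
    equation for kappa. *)
Lemma hodge_I : hodge_equation cI ->
  [/\ F (o 1) (o 3) = - F (o 2) (o 4), F (o 1) (o 4) = F (o 2) (o 3) &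
     F (o 1) (o 2) = F (o 3) (o 4) - F (o 5) (o 6) + F (o 0) (o 7)].
Proof.
move=> H; split.
- have := @hodge_equation_ind cI (o 1) (o 3) (nseq 2 (true, (o 2, o 4))) isT H isT erefl.
  by rewrite !big_cons big_nil addr0 half_double opprK /= => <-; rewrite opprK.
- have := @hodge_equation_ind cI (o 1) (o 4) (nseq 2 (true, (o 2, o 3))) isT H isT erefl.
  by rewrite !big_cons big_nil addr0 half_double opprK.
- have := @hodge_equation_ind cI (o 1) (o 2) [:: (true, (o 3, o 4)); (false, (o 5, o 6));
    (true, (o 3, o 4)); (true, (o 0, o 7)); (false, (o 5, o 6)); (true, (o 0, o 7))] isT H isT erefl.
  by rewrite !big_cons big_nil addr0 half_triple !opprD !opprK.
Qed.

(** Here the first two relations will kill nu_1 and kappa; the third is the radial equation for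
    nu_2. *)
Lemma hodge_J : hodge_equation cJ ->
  [/\ F (o 1) (o 3) = - F (o 2) (o 4), F (o 1) (o 2) = F (o 3) (o 4) &
     F (o 1) (o 4) = F (o 2) (o 3) + F (o 5) (o 7) + F (o 0) (o 6)].
Proof.
move=> H; split.
- have := @hodge_equation_ind cJ (o 1) (o 3) (nseq 2 (true, (o 2, o 4))) isT H isT erefl.
  by rewrite !big_cons big_nil addr0 half_double opprK /= => <-; rewrite opprK.
- have := @hodge_equation_ind cJ (o 1) (o 2) (nseq 2 (true, (o 3, o 4))) isT H isT erefl.
  by rewrite !big_cons big_nil addr0 half_double opprK.
- have := @hodge_equation_ind cJ (o 1) (o 4) [:: (true, (o 2, o 3)); (true, (o 5, o 7));
    (true, (o 2, o 3)); (true, (o 0, o 6)); (true, (o 5, o 7)); (true, (o 0, o 6))] isT H isT erefl.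
  by rewrite !big_cons big_nil addr0 half_triple !opprD !opprK.
Qed.

(** Here the first two relations will kill nu_2 and kappa; the third is the radial equation for
    nu_1. *)
Lemma hodge_K : hodge_equation cK ->
  [/\ F (o 1) (o 4) = F (o 2) (o 3), F (o 1) (o 2) = F (o 3) (o 4) &
     F (o 1) (o 3) = - F (o 2) (o 4) + F (o 6) (o 7) - F (o 0) (o 5)].
Proof.
move=> H; split.
- have := @hodge_equation_ind cK (o 1) (o 4) (nseq 2 (true, (o 2, o 3))) isT H isT erefl.
  by rewrite !big_cons big_nil addr0 half_double opprK.
- have := @hodge_equation_ind cK (o 1) (o 2) (nseq 2 (true, (o 3, o 4))) isT H isT erefl.
  by rewrite !big_cons big_nil addr0 half_double opprK.
- have := @hodge_equation_ind cK (o 1) (o 3) [:: (true, (o 2, o 4)); (false, (o 6, o 7));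
    (true, (o 2, o 4)); (true, (o 0, o 5)); (false, (o 6, o 7)); (true, (o 0, o 5))] isT H isT erefl.
  by rewrite !big_cons big_nil addr0 half_triple => /oppr_inj.
Qed.
End Relations.
End HodgeAlgebra.

(** * Bracket relations of su(3) *)

Section AbstractBrackets.
Variables (F : comNzRingType) (I : F).
Hypothesis II : I * I = -1.
Local Notation d i j := (delta_mx i j : 'M[F]_3).
Local Notation r i j := (1 *: delta_mx i j + (-1) *: delta_mx j i : 'M[F]_3).
Local Notation m i j := (I *: delta_mx i j + I *: delta_mx j i : 'M[F]_3).
Local Notation k := (I *: (delta_mx 0 0 - delta_mx 1 1) : 'M[F]_3).
Local Notation z := (I *: (delta_mx 0 0 + delta_mx 1 1 - delta_mx 2 2 - delta_mx 2 2) : 'M[F]_3).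
Ltac bracket :=
  rewrite !(mulmxDl, mulmxDr, mulmxN, mulNmx) -!(scalemxAl, scalemxAr)
    ?(mulmxDl, mulmxDr, mulmxN, mulNmx) !mul_delta_mx_cond -!val_eqE /=
    ?mulr0n ?mulr1n ?(scalerA, II);
  apply/matrixP => i j; rewrite !mxE; ring.

(** [z] spans the Lie algebra of K_0, so modulo the stabiliser the sigma and mu directions generate
    kappa, nu_1 and nu_2. An abstract square root of -1 is an atom for [ring]. *)
Lemma brackets :
  [/\ r 0 2 *m m 0 2 - m 0 2 *m r 0 2 = k + z, r 1 2 *m m 1 2 - m 1 2 *m r 1 2 = - k + z
    & r 0 1 *m m 0 1 - m 0 1 *m r 0 1 = k + k] /\
  [/\ r 0 2 *m r 1 2 - r 1 2 *m r 0 2 = - r 0 1, m 0 2 *m m 1 2 - m 1 2 *m m 0 2 = - r 0 1,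
      m 0 2 *m r 1 2 - r 1 2 *m m 0 2 = - m 0 1 & r 0 2 *m m 1 2 - m 1 2 *m r 0 2 = m 0 1] /\
  r 0 1 *m k - k *m r 0 1 = - m 0 1 - m 0 1 /\ m 0 1 *m k - k *m m 0 1 = r 0 1 + r 0 1.
Proof.
split; [split|split; [split|split]].
- bracket.
- bracket.
- bracket.
- bracket.
- bracket.
- bracket.
- bracket.
- bracket.
- bracket.
Qed.

End AbstractBrackets.

(** * Invariant connections *)

Section InvariantConnections.
Variable R : realType.
Local Notation M3 := 'M[R]_3.
Local Notation C3 := 'M[R[i]]_3.
Local Notation CM := (CM R).
Local Notation E0S := (E0_space R).

(** * Smooth curves and tangent vectors *)

Lemma smooth_curve_is_derive (V : normedModType R) (S : set V) (c : R -> V) :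
  smooth_curve S c -> is_derive (0 : R) 1 c (velocity c).
Proof.
move=> [I [oI I0 Ic _]]; rewrite /velocity derive1E.
exact: Ck_is_derive (Ic 1%N) I0.
Qed.

Lemma is_derive_val (V W : normedModType R) (f : V -> W) x v df :
  is_derive x v f df -> 'D_v f x = df.
Proof. by case. Qed.

Lemma velocityE (V : normedModType R) (c : R -> V) w :
  is_derive (0 : R) 1 c w -> velocity c = w.
Proof. by move=> [_ <-]; rewrite /velocity derive1E. Qed.

Lemma open_line (V : normedModType R) (O : set V) y v : open O ->
  open [set t : R | O (t *: v + y)].
Proof.
move=> oO; apply: open_comp oO => t _.
by apply: cvgD; [apply: cvgZr_tmp; exact: cvg_id|exact: cvg_cst].
Qed.

Lemma Ck_line (V : normedModType R) k (U : set R) y v : open U -> findim V ->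
  Ck k U (fun t : R => t *: v + y : V).
Proof.
move=> oU fV; apply: Ck_add => //; last exact: Ck_cst.
by apply: Ck_scale => //; [exact: Ck_id|exact: Ck_cst].
Qed.

Lemma smooth_curve_line (V0 V : normedModType R) (O : set V0) (S : set V) (G : V0 -> V) y v :
  findim V0 -> findim V -> open O -> (forall k, Ck k O G) ->
  (forall y, O y -> S (G y)) -> O y ->
  smooth_curve S (fun t : R => G (t *: v + y)).
Proof.
move=> fV0 fV oO GC GS Oy; exists [set t : R | O (t *: v + y)]; split.
- exact: open_line.
- by rewrite /= scale0r add0r.
- move=> k; apply: (@Ck_comp _ R V0 V k _ O G (fun t : R => t *: v + y)) => //.
    exact: open_line.
  by apply: Ck_line => //; exact: open_line.
- by move=> t /GS.
Qed.

Lemma velocity_line (V0 V : normedModType R) (G : V0 -> V) y v :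
  velocity (fun t : R => G (t *: v + y)) = 'D_v G y.
Proof.
have E : (fun h : R => h^-1 *: (((fun t : R => G (t *: v + y)) \o shift (0 : R)) (h *: (1 : R))
    - G ((0 : R) *: v + y))) = (fun h : R => h^-1 *: ((G \o shift y) (h *: v) - G y)).
  by apply/funext => h /=; rewrite addr0 scale0r add0r [h *: 1]mulr1.
by rewrite /velocity derive1E /derive E.
Qed.

(** The standard source of tangent vectors: directional derivatives of smooth maps with values in
    [S]. *)
Lemma tangent_line (V0 V : normedModType R) (O : set V0) (S : set V) (G : V0 -> V) y v :
  findim V0 -> findim V -> open O -> (forall k, Ck k O G) ->
  (forall y, O y -> S (G y)) -> O y -> tangent S (G y) ('D_v G y).
Proof.
move=> fV0 fV oO GC GS Oy; exists (fun t : R => G (t *: v + y)); split.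
- exact: smooth_curve_line fV0 fV oO GC GS Oy.
- by rewrite scale0r add0r.
- exact: velocity_line.
Qed.

Lemma linear_scale (V W : lmodType R) (f : V -> W) a x : linear f -> f (a *: x) = a *: f x.
Proof.
move=> lf; have f0 : f 0 = 0.
  by have := lf (-1) 0 0; rewrite scaler0 addr0 scaleN1r addNr.
by rewrite -[a *: x]addr0 lf f0 addr0.
Qed.

Lemma linear_add (V W : lmodType R) (f : V -> W) x y : linear f -> f (x + y) = f x + f y.
Proof. by move=> lf; rewrite -[x]scale1r lf !scale1r. Qed.

Lemma linear_zero (V W : lmodType R) (f : V -> W) : linear f -> f 0 = 0.
Proof. by move=> lf; rewrite -(scale0r 0) linear_scale // scale0r. Qed.

(* The covector of norm [s] over the line spanned by the second basis vector. *)
Definition xs (s : R) : CM * CM :=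
  (uncplx (delta_mx 1 1), s *: uncplx (delta_mx 1 0)).

Lemma TCP2_xs s : TCP2 (xs s).
Proof.
rewrite /TCP2 /xs /= cplxZ !uncplxK; split.
- by rewrite mul_delta_mx.
- exact: trC_delta.
- by rewrite /mxtrace sum3 !mxE !ord3E !eqxx /= addr0 add0r.
- by rewrite -scalemxAr mul_delta_mx.
- by rewrite -scalemxAl mul_delta_mx_cond !ord3E scaler0.
Qed.

Lemma TCP2_star_xs s : s != 0 -> TCP2_star (xs s).
Proof.
move=> s0; split; first exact: TCP2_xs.
rewrite /xs /=; apply/eqP => /(congr1 (fun x : CM => x.1 1 0)) /=.
by rewrite !mxE !eqxx /= mulr1 => /eqP; rewrite (negPf s0).
Qed.

Lemma calabi_mapE y : calabi_map y = su3_act y.2 (xs (Num.sqrt (y.1 ^+ 4 - 1))).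
Proof.
have E (a : R) (x : CM) : conj_by y.2 (cplx (a *: x)) = a *: conj_by y.2 (cplx x).
  exact: linear_scale (conj_by_linear y.2).
by rewrite /calabi_map /su3_act /xs /= E !uncplxK.
Qed.

Lemma Ck_xs (V : normedModType R) k (U : set V) (f : V -> R) : open U ->
  Ck k U f -> Ck k U (fun y => xs (f y)).
Proof.
move=> oU fC; apply: Ck_pair => //; try exact: findim_CM; first exact: Ck_cst.
by apply: Ck_scale => //; [exact: findim_CM|exact: Ck_cst].
Qed.

Lemma is_derive_xs (V : normedModType R) (f : V -> R) x v df :
  is_derive x v f df -> is_derive x v (fun y => xs (f y)) (0, df *: uncplx (delta_mx 1 0)).
Proof.
move=> D; exact: (is_derive_pair (findim_CM R) (findim_CM R)
  (is_derive_cst _ x v) (is_derive_scalel _ D)).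
Qed.

Lemma E0_su3_act (g : CM) (z : E0S) : SU3 g -> E0 z -> E0 (su3_act g z.1, z.2).
Proof. by move=> gS [zT zS]; split=> //; exact: TCP2_star_su3_act. Qed.

Lemma SO3_tr (h : M3) : SO3 h -> h *m h^T = 1%:M.
Proof. by move=> [/mulmx1C]. Qed.

Lemma SO3_1 : SO3 (1%:M : M3).
Proof. by split; rewrite ?trmx1 ?mul1mx ?det1. Qed.

Lemma skew_conj (X : C3) (h : CM) : X^t* = - X ->
  ((cplx h)^t* *m X *m cplx h)^t* = - ((cplx h)^t* *m X *m cplx h).
Proof. by move=> XS; rewrite !trC_M trmxCK XS mulNmx mulmxN mulmxA. Qed.

Lemma rotgen_skew (X : C3) : rotgen X -> X^t* = - X.
Proof. by case. Qed.

Lemma det_k0 (F : comNzRingType) : \det (delta_mx 2 2 - delta_mx 0 0 - delta_mx 1 1 : 'M[F]_3) = 1.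
Proof. by rewrite det3 !mxE -!val_eqE /=; ring. Qed.

Lemma sqr_k0 (F : comNzRingType) (k := delta_mx 2 2 - delta_mx 0 0 - delta_mx 1 1 : 'M[F]_3) :
  k *m k = 1%:M.
Proof.
rewrite /k !(mulmxDl, mulmxDr, mulmxN, mulNmx) !mul_delta_mx_cond -!val_eqE /= ?mulr0n ?mulr1n.
by apply: mx3P; rewrite !mxE -!val_eqE /=; ring.
Qed.

Lemma k0_fixed (F : comNzRingType) (k := delta_mx 2 2 - delta_mx 0 0 - delta_mx 1 1 : 'M[F]_3) :
  k *m delta_mx 1 1 *m k = delta_mx 1 1 /\ k *m delta_mx 1 0 *m k = delta_mx 1 0.
Proof.
by rewrite /k; split; rewrite !(mulmxDl, mulmxDr, mulmxN, mulNmx) !mul_delta_mx_cond -!val_eqE /=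
  ?(mulr0n, mulr1n, mul_delta_mx_cond, mul0mx, mulmx0, mulNmx, mulmxN, mulmxDl) -?val_eqE /=
  ?mulr0n ?mulr1n ?oppr0 ?addr0 ?add0r ?opprK ?addr0 ?add0r.
Qed.

(** The diagonal matrix [k] has opposite signs at [i] and at 2. *)
Lemma k0_anti (F : comNzRingType) (u w : F) (i : 'I_3) (k := delta_mx 2 2 - delta_mx 0 0 - delta_mx 1 1 : 'M[F]_3) :
  i != 2 -> k *m (u *: delta_mx i 2 + w *: delta_mx 2 i) *m k = - (u *: delta_mx i 2 + w *: delta_mx 2 i).
Proof.
move=> i2; have K2 : k *m delta_mx 2 i = delta_mx 2 i.
  by rewrite /k !(mulmxDl, mulNmx) !mul_delta_mx_cond -!val_eqE /= ?mulr0n ?mulr1n oppr0 !addr0.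
have K2' : delta_mx i 2 *m k = delta_mx i 2.
  by rewrite /k !(mulmxDr, mulmxN) !mul_delta_mx_cond -!val_eqE /= ?mulr0n ?mulr1n oppr0 !addr0.
have Ki : k *m delta_mx i 2 = - (delta_mx i 2 : 'M[F]_3).
  rewrite /k !(mulmxDl, mulNmx) !mul_delta_mx_cond.
  case: i i2 {K2 K2'} => [[|[|[|//]]] ip] // _; rewrite -!val_eqE /= ?mulr0n ?mulr1n ?subr0 ?sub0r ?addr0 //.
have Ki' : delta_mx 2 i *m k = - (delta_mx 2 i : 'M[F]_3).
  rewrite /k !(mulmxDr, mulmxN) !mul_delta_mx_cond.
  case: i i2 {K2 K2' Ki} => [[|[|[|//]]] ip] // _; rewrite -!val_eqE /= ?mulr0n ?mulr1n ?subr0 ?sub0r ?addr0 //.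
clearbody k; rewrite mulmxDr mulmxDl -!scalemxAr -!scalemxAl Ki K2 mulNmx K2' Ki'.
by rewrite !scalerN opprD.
Qed.

Lemma is_derive_conj_rotation (X : C3) (h : CM) (t : R) : rotgen X -> SU3 h ->
  is_derive t 1 (fun t => cmul (cadj h) (cmul (rotation X t) h))
   (uncplx (cplx (cmul (cadj h) (cmul (rotation X t) h)) *m ((cplx h)^t* *m X *m cplx h))).
Proof.
move=> rX hS; have fC := findim_CM R.
have D := is_derive_lin fC fC (cmul_linear_r (cadj h))
  (is_derive_lin fC fC (cmul_linear_l h) (is_derive_rotation t rX)).
apply: (is_derive_eq D); move: (rotation X t) => r.
have [/unitarymxP hu _] := hS.
rewrite /cmul /cadj.
rewrite !uncplxK.
apply: (congr1 (@uncplx R)).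
by rewrite !mulmxA -[in RHS](mulmxA _ (cplx h) ((cplx h)^t*)) hu mulmx1.
Qed.

(** The vector is realised by the curve of conjugates by [h] of the rotations of [X]. Conjugated
    generators appear because moving along a second rotation changes [X] by the adjoint action. *)
Lemma tangent_ad s (k : M3) (X : C3) (h : CM) : s != 0 -> SO3 k -> rotgen X -> SU3 h ->
  tangent (@E0 R) (xs s, k) (ad ((cplx h)^t* *m X *m cplx h) (xs s), 0).
Proof.
move=> s0 kS rX hS.
pose g (t : R) := cmul (cadj h) (cmul (rotation X t) h).
have gS t : SU3 (g t).
  by apply: SU3_cmul; [exact: SU3_cadj|apply: SU3_cmul => //; exact: SU3_rotation].
have g0 : g 0 = uncplx 1%:M.
  rewrite /g rotation0 (_ : cmul (uncplx 1%:M) h = h) ?cadj_cmul //.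
  by rewrite /cmul uncplxK mul1mx cplxK.
pose G (t : R) : E0S := (su3_act (g t) (xs s), k).
have GC n : Ck n setT G.
  apply: Ck_pair; [exact: openT|exact: findim_TCP|exact: findim_mx| |exact: Ck_cst].
  apply: Ck_su3_act; [exact: openT| |exact: Ck_cst].
  apply: Ck_cmul; [exact: openT|exact: Ck_cst|].
  by apply: Ck_cmul; [exact: openT|apply: Ck_rotation; exact: openT|exact: Ck_cst].
have GE t : E0 (G t) by split => //=; apply: TCP2_star_su3_act => //; exact: TCP2_star_xs.
have := @tangent_line _ _ setT _ G 0 1 (findim_R R) (findim_E0 R) openT GC (fun t _ => GE t) I.
rewrite {1}/G g0 su3_act1.
have D := is_derive_conj_rotation 0 rX hS; rewrite -/(g 0) in D.
have DG := is_derive_pair (findim_TCP R) (findim_mx R 2 2)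
  (is_derive_su3_act (skew_conj h (rotgen_skew rX)) D (is_derive_cst (xs s) (0 : R) 1))
  (is_derive_cst k (0 : R) 1).
have E : 'D_1 G 0 = (su3_act (g 0) (ad ((cplx h)^t* *m X *m cplx h) (xs s) + 0), 0) := is_derive_val DG.
by rewrite E g0 su3_act1 addr0.
Qed.

Lemma open_gt0 (V : normedModType R) (f : V -> R) : continuous f -> open [set y | 0 < f y].
Proof.
by move=> fc; apply: (open_comp (f := f) (D := [set t | 0 < t])); [move=> y _; exact: fc|exact: open_gt].
Qed.

Lemma tangent_radial s (k : M3) : 0 < s -> SO3 k ->
  tangent (@E0 R) (xs s, k) ((0, uncplx (delta_mx 1 0)), 0).
Proof.
move=> s0 kS.
pose G (t : R) : E0S := (xs t, k).
have GC n : Ck n [set t : R | 0 < t] G.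
  apply: Ck_pair; [exact: open_gt|exact: findim_TCP|exact: findim_mx| |exact: Ck_cst].
  by apply: Ck_xs; [exact: open_gt|exact: Ck_id].
have GE t : 0 < t -> E0 (G t) by move=> t0; split=> //=; exact/TCP2_star_xs/lt0r_neq0.
have := @tangent_line _ _ [set t : R | 0 < t] _ G s 1 (findim_R R) (findim_E0 R) (@open_gt R 0) GC GE s0.
have D := is_derive_pair (findim_TCP R) (findim_mx R 2 2)
  (is_derive_xs (is_derive_id s 1)) (is_derive_cst k s 1).
by have [_ ->] := D; rewrite scale1r.
Qed.

(** * Horizontal lifts in a local trivialisation *)

Section HorizontalLift.
Variables V W : normedModType R.
Hypotheses (fV : findim V) (fW : findim W).

Lemma open_preimage (T U : normedModType R) k (I : set T) (c : T -> U) (O : set U) : open I -> Ck k I c ->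
  open O -> open (I `&` c @^-1` O).
Proof.
move=> oI cC oO; rewrite openE => t [It Ot]; rewrite /interior.
apply: filterI; first exact: open_nbhs_nbhs.
exact: (Ck_continuous cC It) (open_nbhs_nbhs (conj oO Ot)).
Qed.

Lemma smooth_on_curve (V1 V2 : normedModType R) (S : set V1) (f : V1 -> V2) (c : R -> V1) :
  findim V1 -> findim V2 -> smooth_on S f -> smooth_curve S c ->
  exists I : set R, [/\ open I, I 0, Cinfty I (f \o c) & forall t, I t -> S (c t)].
Proof.
move=> f1 f2 fS [I [oI I0 Ic IS]]; have [U [f' [oU Uc fC fE]]] := fS _ (IS 0 I0).
have oJ := open_preimage oI (Ic 0%N) oU.
exists (I `&` c @^-1` U); split=> //; last by move=> t [/IS].
move=> k; apply: (@Ck_eq _ _ _ k _ (f' \o c)) => // [t [It Ut]|].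
  by rewrite /= fE //; exact: IS.
apply: (Ck_comp oJ oU f1 f2 _ (fC k)); first by move=> t [].
by apply: Ck_subset (Ic k) => t [].
Qed.

Lemma smooth_curve_comp (V1 V2 : normedModType R) (S : set V1) (S' : set V2) (f : V1 -> V2) (c : R -> V1) :
  findim V1 -> findim V2 -> smooth_on S f -> (forall x, S x -> S' (f x)) ->
  smooth_curve S c -> smooth_curve S' (f \o c).
Proof.
move=> f1 f2 fS SS' /(smooth_on_curve f1 f2 fS)[I [oI I0 Ic IS]].
by exists I; split=> // t /IS/SS'.
Qed.

Lemma smooth_curve_restrict (V1 V2 : normedModType R) (S : set V1) (f : V1 -> V2) (c : R -> V1) (U : set V2) :
  findim V1 -> findim V2 -> smooth_on S f -> smooth_curve S c -> open U -> U (f (c 0)) ->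
  smooth_curve (S `&` f @^-1` U) c.
Proof.
move=> f1 f2 fS cS oU U0; have [I [oI I0 Ic IS]] := smooth_on_curve f1 f2 fS cS.
have [J [oJ J0 Jc _]] := cS; have oK := open_preimage oI (Ic 0%N) oU.
exists ((I `&` (f \o c) @^-1` U) `&` J); split.
- exact: openI.
- by [].
- by move=> k; apply: Ck_subset (Jc k) => t [].
- by move=> t [[It Ut] _]; split=> //; exact: IS.
Qed.

Lemma velocity_near (V1 : normedModType R) (c c' : R -> V1) :
  (\forall t \near (0 : R), c t = c' t) -> velocity c = velocity c'.
Proof. by move=> H; rewrite /velocity !derive1E; exact: near_eq_derive. Qed.

Lemma velocity_comp (V1 V2 : normedModType R) (S : set V1) (c : R -> V1) (O : set V1) (f : V1 -> V2) :
  findim V1 -> findim V2 -> smooth_curve S c -> open O -> O (c 0) -> Ck 1 O f ->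
  velocity (f \o c) = 'D_(velocity c) f (c 0).
Proof.
move=> f1 f2 cS oO O0 fC; apply: velocityE.
exact: (is_derive_comp oO f1 f2 fC O0 (smooth_curve_is_derive cS)).
Qed.

Lemma smooth_curve_near (V1 : normedModType R) (S : set V1) (c : R -> V1) (O : set V1) :
  smooth_curve S c -> open O -> O (c 0) -> \forall t \near (0 : R), S (c t) /\ O (c t).
Proof.
move=> [I [oI I0 Ic IS]] oO O0; have oJ := open_preimage oI (Ic 0%N) oO.
near=> t; have [It Ot] : (I `&` c @^-1` O) t.
  by near: t; exact: (open_nbhs_nbhs (conj oJ (conj I0 O0))).
by split=> //; exact: IS.
Unshelve. all: by end_near. Qed.

Variables (B : set V) (P : set W) (p : W -> V) (act : W -> M3 -> W) (theta : W -> W -> M3).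
Variables (U : set V) (triv : V * M3 -> W) (triv' : W -> V * M3).
Let D := (B `&` U) `*` @SO3 R.
Let Q := P `&` p @^-1` U.
Hypotheses (pS : smooth_on P p) (Uo : open U) (triv'S : smooth_on Q triv').
Hypothesis trivD : forall d, D d -> Q (triv d) /\ triv' (triv d) = d.
Hypothesis trivQ : forall z, Q z -> D (triv' z) /\ triv (triv' z) = z.
Hypothesis triv_act : forall y h k, D (y, h) -> SO3 k ->
  p (triv (y, h)) = y /\ triv (y, h *m k) = act (triv (y, h)) k.
Hypothesis vertical : forall z (k : R -> M3), P z -> smooth_curve (@SO3 R) k -> k 0 = 1%:M ->
         theta z (velocity (fun t => act z (k t))) = velocity k.
Variables (O : set (V * M3)) (T : V * M3 -> W) (beta : W -> W -> M3) (N : set W).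
Hypotheses (oO : open O) (TC : Cinfty O T) (TE : forall d, D d -> O d -> triv d = T d).
Hypotheses (beta_lin : forall z, linear (beta z))
  (beta_theta : forall z v, P z -> N z -> tangent P z v -> theta z v = beta z v).

(* The horizontal lift of [xi], in the trivialisation. *)
Definition hlift (x xi : V) : W :=
  'D_(xi, - beta (T (x, 1%:M)) ('D_(xi, 0) T (x, 1%:M))) T (x, 1%:M).

Lemma tangent_triv (x : V) (e : R -> V * M3) : smooth_curve D e -> e 0 = (x, 1%:M) -> O (x, 1%:M) ->
  tangent P (T (x, 1%:M)) ('D_(velocity e) T (x, 1%:M)).
Proof.
move=> eD e0 Ox; have fVM := findim_prod fV (findim_mx R 2 2); have Oe : O (e 0) by rewrite e0.
exists (T \o e); split; last 2 first.
- by rewrite /= e0.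
- by rewrite -e0; exact: (velocity_comp fVM fW eD oO Oe (TC 1%N)).
have [I [oI I0 Ic ID]] := eD; have oJ := open_preimage oI (Ic 0%N) oO.
exists (I `&` e @^-1` O); split=> //; last first.
  by move=> t [/ID De Ot]; rewrite /= -TE //; have [[]] := trivD De.
move=> k; apply: (Ck_comp oJ oO fVM fW _ (TC k)); first by move=> t [].
by apply: Ck_subset (Ic k) => t [].
Qed.

(** In the trivialisation the curve is a pair of a base curve and a curve h in SO(3) with h(0) = 1.
    The fibre part contributes h'(0) to theta, so horizontality determines h'(0) as minus the value
    of theta on the base part. *)
Lemma horizontal_velocity (x xi : V) (c : R -> W) :
  B x -> U x -> O (x, 1%:M) -> N (T (x, 1%:M)) ->
  smooth_curve P c -> c 0 = T (x, 1%:M) -> theta (c 0) (velocity c) = 0 ->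
  is_derive (0 : R) 1 (p \o c) xi ->
  velocity c = hlift x xi.
Proof.
move=> Bx Ux Ox Nx cP c0 th0 pc.
have fM := findim_mx R 2 2; have fVM := findim_prod fV fM.
have Dx : D (x, 1%:M) by split=> //=; exact: SO3_1.
have [Qx triv'x] := trivD Dx.
have tx : triv (x, 1%:M) = T (x, 1%:M) by exact: TE.
have Upc : U (p (c 0)) by rewrite c0 -tx; case: Qx.
have cQ : smooth_curve Q c := smooth_curve_restrict fW fV pS cP Uo Upc.
pose d := triv' \o c.
have dD : smooth_curve D d.
  by apply: (smooth_curve_comp fW fVM triv'S _ cQ) => z /trivQ[].
have d0 : d 0 = (x, 1%:M) by rewrite /d /= c0 -tx.
have cE : \forall t \near (0 : R), c t = T (d t).
  have O0 : O (d 0) by rewrite d0.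
  have [I [oI I0 _ IQ]] := cQ.
  near=> t; have [Dt Ot] : D (d t) /\ O (d t) by near: t; exact: smooth_curve_near dD oO O0.
  rewrite -TE //; have [_ ->] // : D (d t) /\ triv (d t) = c t.
  by apply: trivQ; apply: IQ; near: t; exact: open_nbhs_nbhs.
have Dd := smooth_curve_is_derive dD; set w := velocity d in Dd.
have w1 : w.1 = xi.
  have [_ <-] := is_derive_lin fVM fV (l := fst) (fun _ _ _ => erefl) Dd.
  have [_ <-] := pc; apply: near_eq_derive.
  have [I [oI I0 _ IQ]] := cQ.
  near=> t; have Qt : Q (c t) by apply: IQ; near: t; exact: open_nbhs_nbhs.
  have [Dt tE] := trivQ Qt.
  have H (q : V * M3) : D q -> p (triv q) = q.1.
    by case: q => y k Dq; have [] := triv_act Dq SO3_1.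
  by rewrite /= -(H _ Dt) tE.
pose h := snd \o d.
have hS : smooth_curve (@SO3 R) h.
  have [I [oI I0 Ic ID]] := dD; exists I; split=> //; last by move=> t /ID[].
  by move=> k; apply: (Ck_linear_comp (l := snd) oI fVM fM).
have h0 : h 0 = 1%:M by rewrite /h /= d0.
have Dh : is_derive (0 : R) 1 h w.2 := is_derive_lin fVM fM (l := snd) (fun _ _ _ => erefl) Dd.
have Pz : P (T (x, 1%:M)) by rewrite -tx; case: Qx.
have [I [oI I0 Ic IS]] := hS.
have eD : smooth_curve D (fun t => (x, h t)).
  exists I; split=> // [k|t /IS Ht]; last by split.
  by apply: Ck_pair => //; exact: Ck_cst.
have xh0 : (x, h 0) = (x, 1%:M) by rewrite h0.
(* T(x, h t) is the translate of T(x, 1) by h t, so the derivative of [T] in the fibre direction is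
   the velocity of an orbit of the right action, to which [vertical] applies. *)
have vE : velocity (fun t => act (T (x, 1%:M)) (h t)) = 'D_(0, w.2) T (x, 1%:M).
  have Dxh := is_derive_pair fV fM (is_derive_cst x (0 : R) 1) Dh.
  have Oh : O (x, h 0) by rewrite xh0.
  have DT := is_derive_comp oO fVM fW (TC 1%N) Oh Dxh.
  rewrite xh0 in DT; rewrite -(velocityE DT).
  apply: velocity_near; near=> t.
  have [Dt Ot] : D (x, h t) /\ O (x, h t) by near: t; exact: (smooth_curve_near eD oO Oh).
  have [_ E] := @triv_act x 1%:M (h t) Dx Dt.2.
  by rewrite -tx -E mul1mx /= TE.
have TT := tangent_triv eD xh0 Ox.
rewrite (velocityE (is_derive_pair fV fM (is_derive_cst x (0 : R) 1) Dh)) in TT.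
have vert := vertical Pz hS h0.
rewrite vE (beta_theta Pz Nx TT) (velocityE Dh) in vert.
have cT : tangent P (T (x, 1%:M)) (velocity c) by exists c.
have vc : velocity c = 'D_w T (x, 1%:M).
  rewrite (velocity_near cE) -d0; apply: (velocity_comp fVM fW dD oO _ (TC 1%N)).
  by rewrite d0.
rewrite c0 (beta_theta Pz Nx cT) vc in th0.
have TL := derive_linear oO fVM fW (TC 1%N) Ox.
have wE : w = (xi, 0) + (0, w.2).
  by rewrite [LHS]surjective_pairing w1; apply: (f_equal2 pair); rewrite ?addr0 ?add0r.
have Tw : 'D_w T (x, 1%:M) = 'D_(xi, 0) T (x, 1%:M) + 'D_(0, w.2) T (x, 1%:M).
  by rewrite {1}wE; exact: (linear_add _ _ TL).
move: th0; rewrite Tw (linear_add _ _ (beta_lin _)) vert => /eqP; rewrite addrC addr_eq0 => /eqP w2.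
by rewrite vc /hlift -w2 -w1 -surjective_pairing.
Unshelve. all: by end_near. Qed.

Hypotheses (oN : open N) (betaC : forall v, Cinfty N (beta^~ v)).

Lemma form_coord n (e : 'I_n -> W) c y v : coordinates e c -> beta y v = \sum_i c i v *: beta y (e i).
Proof. by move=> ec; exact: (linear_coord ec (beta_lin y)). Qed.

Lemma derive_form_coord n (e : 'I_n -> W) c y u v : coordinates e c -> N y ->
  'D_u (beta^~ v) y = \sum_i c i v *: 'D_u (beta^~ (e i)) y.
Proof.
move=> ec Ny.
have -> : beta^~ v = \sum_i c i v \*: beta^~ (e i).
  by apply/funext => z; rewrite fct_sumE (form_coord _ _ ec).
apply: is_derive_val; apply: is_derive_sum => i.
exact: is_deriveZ (Ck_is_derive u (betaC (e i) 1%N) Ny).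
Qed.

Section Limits.
Variables (S : Type) (F : set_system S).
Hypothesis FF : Filter F.

Lemma cvg_form (y v : S -> W) y0 v0 : N y0 -> y @ F --> y0 -> v @ F --> v0 ->
  beta (y t) (v t) @[t --> F] --> beta y0 v0.
Proof.
move=> Ny yc vc; have [n [e [c ec]]] := fW; have [_ cc _ _] := ec.
rewrite (form_coord _ _ ec).
rewrite (_ : (fun t => beta (y t) (v t)) = fun t => \sum_i c i (v t) *: beta (y t) (e i)); last first.
  by apply/funext => t; rewrite (form_coord _ _ ec).
apply: (@cvg_big _ _ _ _ _ _ _ _ _ (fun i t => c i (v t) *: beta (y t) (e i))) => [|i _].
  exact: add_continuous.
apply: cvgZ; first exact: (cvg_comp _ _ vc (cc i v0)).
exact: (cvg_comp _ _ yc (Ck_continuous (betaC (e i) 0%N) Ny)).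
Qed.

Lemma cvg_derive_form (y u v : S -> W) y0 u0 v0 : N y0 -> y @ F --> y0 -> u @ F --> u0 -> v @ F --> v0 ->
  'D_(u t) (beta^~ (v t)) (y t) @[t --> F] --> 'D_u0 (beta^~ v0) y0.
Proof.
move=> Ny yc uc vc; have [n [e [c ec]]] := fW; have [_ cc _ _] := ec.
have fM := findim_mx R 2 2.
rewrite (derive_form_coord _ _ ec Ny).
have nN : \forall t \near F, N (y t) by apply: yc; exact: open_nbhs_nbhs.
have E : \forall t \near F, \sum_i c i (v t) *: 'D_(u t) (beta^~ (e i)) (y t) = 'D_(u t) (beta^~ (v t)) (y t).
  by apply: filterS nN => t Nt; rewrite (derive_form_coord _ _ ec Nt).
suff H : \sum_i c i (v t) *: 'D_(u t) (beta^~ (e i)) (y t) @[t --> F] -->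
    \sum_i c i v0 *: 'D_u0 (beta^~ (e i)) y0.
  by apply: cvg_trans H; apply: near_eq_cvg; apply: filterS E => t.
apply: (@cvg_big _ _ _ _ _ _ _ _ _ (fun i t => c i (v t) *: 'D_(u t) (beta^~ (e i)) (y t))) => [|i _].
  exact: add_continuous.
apply: cvgZ; first exact: (cvg_comp _ _ vc (cc i v0)).
exact: (cvg_derive FF oN fW fM (betaC (e i) 1%N) Ny yc uc).
Qed.

Variables (x : S -> V) (x0 : V).
Hypotheses (Ox : O (x0, 1%:M)) (Nx : N (T (x0, 1%:M))) (xc : x @ F --> x0).

Lemma cvg_pair_cst (U1 U2 : normedModType R) (f : S -> U1) (f0 : U1) (w : U2) : f @ F --> f0 ->
  (f t, w) @[t --> F] --> (f0, w).
Proof. by move=> fc; exact: (cvg_pair fc (cvg_cst w)). Qed.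

Lemma cvg_triv1 : T (x t, 1%:M) @[t --> F] --> T (x0, 1%:M).
Proof.
have xc1 := cvg_pair_cst (w := (1%:M : M3)) xc.
exact: (cvg_comp _ _ xc1 (Ck_continuous (TC 0%N) Ox)).
Qed.

Lemma cvg_hlift (xi : S -> V) xi0 : xi @ F --> xi0 -> hlift (x t) (xi t) @[t --> F] --> hlift x0 xi0.
Proof.
move=> xic; have fVM := findim_prod fV (findim_mx R 2 2).
have xc1 := cvg_pair_cst (w := (1%:M : M3)) xc.
apply: (cvg_derive FF oO fVM fW (TC 1%N) Ox xc1).
suff H : - beta (T (x t, 1%:M)) ('D_(xi t, 0) T (x t, 1%:M)) @[t --> F] -->
    - beta (T (x0, 1%:M)) ('D_(xi0, 0) T (x0, 1%:M)) by exact: (cvg_pair xic H).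
apply: cvgN; apply: (cvg_form Nx cvg_triv1).
apply: (cvg_derive FF oO fVM fW (TC 1%N) Ox xc1).
exact: (cvg_pair_cst xic).
Qed.

(** d theta on two horizontal vectors, where the quadratic term of the curvature is absent. *)
Definition hcurv (x xi eta : V) : M3 :=
  'D_(hlift x xi) (beta^~ (hlift x eta)) (T (x, 1%:M)) -
  'D_(hlift x eta) (beta^~ (hlift x xi)) (T (x, 1%:M)).

Lemma cvg_hcurv (xi eta : S -> V) xi0 eta0 : xi @ F --> xi0 -> eta @ F --> eta0 ->
  hcurv (x t) (xi t) (eta t) @[t --> F] --> hcurv x0 xi0 eta0.
Proof.
move=> xic ec; apply: cvgB; apply: (cvg_derive_form Nx cvg_triv1); exact: cvg_hlift.
Qed.
End Limits.
End HorizontalLift.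

(** All local choices around [x0] at once, with the conclusion that a horizontal velocity at T(x, 1)
    is determined by its projection. It will be applied at a point of the zero section. *)
Lemma bundle_gauge (V W : normedModType R) (B : set V) (P : set W) (p : W -> V)
    (act : W -> M3 -> W) (theta : W -> W -> M3) (x0 : V) :
  findim V -> findim W -> principal_bundle B P p act -> principal_connection P act theta -> B x0 ->
  exists (U : set V) (O : set (V * M3)) (N : set W) (T : V * M3 -> W) (beta : W -> W -> M3),
  [/\ [/\ open U /\ U x0, open O /\ O (x0, 1%:M) & open N /\ N (T (x0, 1%:M))],
      Cinfty O T, (forall v, Cinfty N (beta^~ v)) /\ (forall z, linear (beta z)),
      (forall z v, P z -> N z -> tangent P z v -> theta z v = beta z v)
    & forall x, B x -> U x -> O (x, 1%:M) -> N (T (x, 1%:M)) ->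
      [/\ P (T (x, 1%:M)), p (T (x, 1%:M)) = x &
        forall xi (c : R -> W), smooth_curve P c -> c 0 = T (x, 1%:M) ->
          theta (c 0) (velocity c) = 0 -> is_derive (0 : R) 1 (p \o c) xi ->
          velocity c = hlift T beta x xi]].
Proof.
move=> fV fW [[pS _] _ _ _ triv] [thS _ vertical _] Bx0.
have [U [tr [tr' [[Uo Ux0] [trS tr'S] trD trQ tr_act]]]] := triv _ Bx0.
have Dx : B x0 -> U x0 -> ((B `&` U) `*` @SO3 R) (x0, 1%:M).
  by move=> Bx Ux; split=> //=; exact: SO3_1.
have [Om [T [oO Ox0 TC TE]]] := trS _ (Dx Bx0 Ux0).
have tx0 : tr (x0, 1%:M) = T (x0, 1%:M) by apply: TE => //; exact: Dx.
have [[Pz0 _] _] := trD _ (Dx Bx0 Ux0).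
have [beta [N [oN Nz bC bl bE]]] := thS _ Pz0; rewrite tx0 in Nz.
exists U, Om, N, T, beta; split.
- by split.
- exact: TC.
- by split.
- by move=> z v Pz Nz' vT; exact: bE.
move=> x Bx Ux Ox Nx.
have Dx' : ((B `&` U) `*` @SO3 R) (x, 1%:M) by split=> //=; exact: SO3_1.
have tx : tr (x, 1%:M) = T (x, 1%:M) by apply: TE.
have [[Pz Uz] _] := trD _ Dx'; rewrite tx in Pz.
split=> //; first by rewrite -tx; have [] := tr_act x 1%:M 1%:M Dx' SO3_1.
move=> xi c cP c0 th0 pc.
exact: (horizontal_velocity fV fW pS Uo tr'S trD trQ tr_act vertical oO TC TE bl
  (fun z v Pz Nz vT => bE z v Pz Nz vT) Bx Ux Ox Nx cP c0 th0 pc).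
Qed.

(** * Bounded solutions of singular equations, and the Frobenius norm *)

Lemma constant_gt0 (f : R -> R) : (forall s : R, 0 < s -> is_derive s 1 f 0) ->
  forall a b : R, 0 < a -> a < b -> f a = f b.
Proof.
move=> fd a b a0 ab.
have [|t _ E] := @MVT_line _ R f a (b - a) (fun _ => 0).
  move=> t /andP[t0 _]; have t1 : 0 < t *: (b - a) + a.
    by rewrite ltr_wpDl // mulr_ge0 // subr_ge0 ltW.
  by have := is_derive_scale_dir (b - a) (fd _ t1); rewrite scaler0 [(b - a) *: 1]mulr1.
by apply/esym/eqP; rewrite -subr_eq0 -[X in f X - _](subrK a) E.
Qed.

(** w^2 phi is constant, while a bound on w^2 near zero and phi <= 2 s force it to tend to zero. *)
Lemma decay (w phi q : R -> R) (M : R) :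
  (forall s : R, 0 < s -> is_derive s 1 w (- q s * w s)) ->
  (forall s : R, 0 < s -> is_derive s 1 phi (2 * q s * phi s)) ->
  (forall s : R, 0 < s -> 0 < phi s) -> (forall s : R, 0 < s -> s <= 1 -> phi s <= 2 * s) ->
  (\forall s \near (0 : R), 0 < s -> w s ^+ 2 <= M) -> forall s : R, 0 < s -> w s = 0.
Proof.
move=> wd pd p0 p2 /nbhs_ballP[d /= d0 dM] b b0.
pose f s := w s * w s * phi s.
have fd (s : R) : 0 < s -> is_derive s 1 f 0.
  move=> s0; have D := is_deriveM (is_deriveM (wd s s0) (wd s s0)) (pd s s0).
  apply: (is_derive_eq D).
  transitivity (w s * w s * (2 * q s * phi s) + phi s * (w s * (- q s * w s) + w s * (- q s * w s))) => //.
  by ring.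
apply/eqP; apply: contraT => wb; exfalso.
have M0 : 0 <= M.
  have H : 0 < d / 2 by rewrite divr_gt0.
  apply: le_trans (sqr_ge0 (w (d / 2))) (dM _ _ H).
  by rewrite /ball /= sub0r normrN gtr0_norm // ltr_pdivrMr // mulr_natr mulr2n ltrDl.
have C0 : 0 < f b by rewrite mulr_gt0 // ?p0 // -expr2 exprn_even_gt0.
(* At this s both bounds hold and the constant f b would satisfy f b <= 2 M s < (2 M + 1) s <= f
   b. *)
pose s := Num.min (d / 2) (Num.min 1 (Num.min (b / 2) (f b / (2 * M + 1)))).
have M1 : 0 < 2 * M + 1 by rewrite ltr_wpDl // mulr_ge0.
have s0 : 0 < s by rewrite /s !lt_min ltr01 !divr_gt0.
have sd : s <= d / 2 by rewrite /s ge_min lexx.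
have s1 : s <= 1 by rewrite /s !ge_min lexx orbT.
have sb : s <= b / 2 by rewrite /s !ge_min lexx !orbT.
have sC : s <= f b / (2 * M + 1) by rewrite /s !ge_min lexx !orbT.
have E : f s = f b.
  by apply: constant_gt0 => //; apply: le_lt_trans sb _; rewrite ltr_pdivrMr // mulr_natr mulr2n ltrDl.
have wM : w s ^+ 2 <= M.
  apply: dM => //; rewrite /ball /= sub0r normrN gtr0_norm //.
  by apply: le_lt_trans sd _; rewrite ltr_pdivrMr // mulr_natr mulr2n ltrDl.
have F : f b <= M * (2 * s).
  by rewrite -E /f -expr2 ler_pM ?sqr_ge0 ?p2 // ltW ?p0.
move: sC; rewrite ler_pdivlMr // => sC.
have : M * (2 * s) < s * (2 * M + 1).
  by rewrite (_ : s * (2 * M + 1) = M * (2 * s) + s) ?ltrDl //; ring.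
by rewrite ltNge (le_trans sC F).
Qed.

(** The squared Frobenius norm: a size of the curvature that is insensitive to the unknown
    conjugation by SO(3). *)
Definition frob (M : M3) : R := \tr (M *m M^T).

Lemma frob_conj (k M : M3) : SO3 k -> frob (k^T *m M *m k) = frob M.
Proof.
move=> kS; rewrite /frob !trmx_mul trmxK !mulmxA.
rewrite -[_ *m k *m k^T]mulmxA (SO3_tr kS) mulmx1 -!mulmxA mxtrace_mulC !mulmxA.
by rewrite -!mulmxA (SO3_tr kS) mulmx1.
Qed.

Lemma entry_le_frob (M : M3) i0 j0 : M i0 j0 ^+ 2 <= frob M.
Proof.
rewrite /frob /mxtrace (bigD1 i0) //= mxE (bigD1 j0) //= mxE -expr2 -addrA lerDl addr_ge0 //.
  by apply: sumr_ge0 => j _; rewrite mxE -expr2 sqr_ge0.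
by apply: sumr_ge0 => i _; rewrite mxE sumr_ge0 // => j _; rewrite mxE -expr2 sqr_ge0.
Qed.

Lemma frob_continuous : continuous frob.
Proof.
move=> M; have fM := findim_mx R 2 2.
have b1 (y : M3) : linear (fun x : M3 => \tr (x *m y^T) : R).
  by move=> a u v; rewrite mulmxDl -scalemxAl linearD linearZ.
have b2 (x : M3) : linear (fun y : M3 => \tr (x *m y^T) : R).
  by move=> a u v; rewrite linearD linearZ /= mulmxDr -scalemxAr linearD linearZ.
exact: (Ck_continuous (Ck_bilinear openT fM fM (findim_R R) b1 b2 (Ck_id 0 setT) (Ck_id 0 setT)) (I : setT M)).
Qed.

Lemma smooth_on_global (V W : normedModType R) (S : set V) (f : V -> W) :
  (forall k, Ck k setT f) -> smooth_on S f.
Proof. by move=> fC x Sx; exists setT, f; split=> //; exact: openT. Qed.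

(** [extends_across_zero_section] wants the total space among row vectors of positive length, hence
    the nonzero vector. *)
Lemma findim_row_iso (V : normedModType R) : findim V -> (exists v : V, v != 0) ->
  exists n (f : V -> 'rV[R]_n.+1) (f' : 'rV[R]_n.+1 -> V),
    [/\ linear f, linear f', cancel f f' & cancel f' f].
Proof.
move=> [n [e [c ec]]] [v v0]; have [cl _ cs cd] := ec.
case: n e c ec cl cs cd => [|n] e c ec cl cs cd.
  by case/eqP: v0; rewrite (cs v) big_ord0.
exists n, (fun x => \row_i c i x), (fun r => \sum_i r 0 i *: e i); split.
- by move=> a x y; apply/rowP => i; rewrite !mxE cl.
- move=> a x y; rewrite scaler_sumr -big_split; apply: eq_bigr => i _.
  by rewrite !mxE scalerDl scalerA.
- by move=> x; rewrite [RHS]cs; apply: eq_bigr => i _; rewrite mxE.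
- move=> r; apply/rowP => i; rewrite mxE (coord_sum ec) (bigD1 i) //= (coordZ ec) cd eqxx mulr1.
  by rewrite big1 ?addr0 // => j ji; rewrite (coordZ ec) cd eq_sym (negPf ji) mulr0.
Qed.

(** * The canonical connection extends *)

Section Canonical.
Variables (n : nat) (f : E0S -> 'rV[R]_n.+1) (f' : 'rV[R]_n.+1 -> E0S).
Hypotheses (fl : linear f) (f'l : linear f') (fK : cancel f f') (f'K : cancel f' f).

Let P : set 'rV[R]_n.+1 := [set w | TCP2 (f' w).1 /\ SO3 (f' w).2].
Let p (w : 'rV[R]_n.+1) : CM * CM := (f' w).1.
Let act (w : 'rV[R]_n.+1) (h : M3) : 'rV[R]_n.+1 := f ((f' w).1, (f' w).2 *m h).
Let theta (w v : 'rV[R]_n.+1) : M3 := (f' w).2^T *m (f' v).2.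

Let fW := findim_mx R 0 n.
Let fE := findim_E0 R.
Let fM := findim_mx R 2 2.
Let fT := findim_TCP R.

Let fC k : Ck k setT f. Proof. exact: (Ck_linear k openT fE fW fl). Qed.
Let f'C k : Ck k setT f'. Proof. exact: (Ck_linear k openT fW fE f'l). Qed.

Lemma SO3_mulmx (g h : M3) : SO3 g -> SO3 h -> SO3 (g *m h).
Proof.
move=> [g1 g2] [h1 h2]; split; last by rewrite det_mulmx g2 h2 mulr1.
by rewrite trmx_mul mulmxA -[h^T *m g^T *m g]mulmxA g1 mulmx1.
Qed.

Lemma mulmx_bilinear_l (y : M3) : linear (fun x : M3 => x *m y).
Proof. by move=> a u v; rewrite mulmxDl scalemxAl. Qed.

Lemma mulmx_bilinear_r (x : M3) : linear (fun y : M3 => x *m y).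
Proof. by move=> a u v; rewrite mulmxDr scalemxAr. Qed.

Lemma trmx_linear : linear (fun x : M3 => x^T).
Proof. by move=> a u v; rewrite linearD linearZ. Qed.

(** The product bundle over the whole of X, transported to row vectors; [f] itself is a global
    trivialisation. *)
Lemma canonical_bundle : principal_bundle (@TCP2 R) P p act.
Proof.
have fWM := findim_prod fW fM.
have f'C1 k : Ck k setT (fun w => (f' w).1).
  by apply: (Ck_linear_comp (l := fst) openT fE fT _ (f'C k)).
split.
- by split; [exact: smooth_on_global|move=> z []].
- apply: smooth_on_global => k.
  have d1 : Ck k setT (fun zh : 'rV[R]_n.+1 * M3 => f' zh.1).
    apply: (Ck_linear_comp (f := fst) openT fW fE f'l).
    exact: (Ck_linear (l := fst) k openT fWM fW (fun _ _ _ => erefl)).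
  have d2 : Ck k setT (fun zh : 'rV[R]_n.+1 * M3 => zh.2).
    exact: (Ck_linear (l := snd) k openT fWM fM (fun _ _ _ => erefl)).
  apply: (Ck_linear_comp (f := fun zh : 'rV[R]_n.+1 * M3 => ((f' zh.1).1, (f' zh.1).2 *m zh.2)) openT fE fW fl).
  apply: Ck_pair => //; [exact: openT|exact: (Ck_linear_comp (l := fst) openT fE fT _ d1)|].
  apply: (Ck_bilinear openT fM fM fM mulmx_bilinear_l mulmx_bilinear_r _ d2).
  exact: (Ck_linear_comp (l := snd) openT fE fM _ d1).
- by move=> z _; rewrite /act mulmx1 -surjective_pairing f'K.
- move=> z h k [zT zS] hS kS; rewrite /P /p /act /= !fK /=; split=> //.
    by split=> //; exact: SO3_mulmx.
  by rewrite mulmxA.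
- move=> x xT; exists setT, f, f'; split.
  + by split; [exact: openT|].
  + by split; exact: smooth_on_global.
  + by move=> [y h] [[/= yT _] hS]; rewrite /P /p /= fK.
  + by move=> z [[zT zS] _]; rewrite f'K.
  + by move=> y h k [[/= yT _] hS] kS; rewrite /p /act !fK.
Qed.

(** [theta] is the Maurer-Cartan form of the SO(3) factor; its values are skew because h^T h = 1 can
    be differentiated along curves. *)
Lemma canonical_connection : principal_connection P act theta.
Proof.
have curve2 (c : R -> 'rV[R]_n.+1) : smooth_curve P c ->
    is_derive (0 : R) 1 (fun t => (f' (c t)).2) (f' (velocity c)).2.
  move=> cS; have D := is_derive_lin fW fE f'l (smooth_curve_is_derive cS).
  exact: (is_derive_lin fE fM (l := snd) (fun _ _ _ => erefl) D).
split.
- move=> z Pz; exists theta, setT; split=> //; first exact: openT.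
  + move=> v k; apply: (Ck_linear k openT fW fM) => a x y.
    by rewrite /theta f'l /= linearD linearZ mulmxDl -scalemxAl.
  + by move=> y a u v; rewrite /theta f'l /= mulmxDr -scalemxAr.
- move=> z v Pz [c [cS c0 cv]].
  have := curve2 c cS; rewrite cv => D.
  have D' := is_derive_lin fM fM trmx_linear D.
  have DD := is_derive_bilinear fM fM fM mulmx_bilinear_l mulmx_bilinear_r D' D.
  have D1 : is_derive (0 : R) 1 (fun t => (f' (c t)).2^T *m (f' (c t)).2) 0.
    apply: (is_derive_near _ (is_derive_cst (1%:M : M3) (0 : R) 1)).
    have [I [oI I0 _ IP]] := cS.
    by apply: (filterS _ (open_nbhs_nbhs (conj oI I0))) => t /IP[_ []].
  have := etrans (esym (is_derive_val DD)) (is_derive_val D1).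
  rewrite /= c0 => /eqP; rewrite addr_eq0 => /eqP E.
  by rewrite /so3 /theta /= trmx_mul trmxK.
- move=> z k [zT zS] kS k0.
  have Dk := smooth_curve_is_derive kS.
  have D1 := is_derive_lin fM fM (mulmx_bilinear_r (f' z).2) Dk.
  have D2 := is_derive_pair fT fM (is_derive_cst (f' z).1 (0 : R) 1) D1.
  rewrite (velocityE (is_derive_lin fE fW fl D2)) /theta fK /= mulmxA.
  by case: zS => -> _; rewrite mul1mx.
- move=> c h cS hS.
  have D := smooth_curve_is_derive cS; have D' := is_derive_lin fW fE f'l D.
  have D1 := is_derive_lin fE fT (l := fst) (fun _ _ _ => erefl) D'.
  have D2 := is_derive_lin fM fM (mulmx_bilinear_l h) (curve2 c cS).
  rewrite (velocityE (is_derive_lin fE fW fl (is_derive_pair fT fM D1 D2))).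
  by rewrite /theta /act !fK /= trmx_mul !mulmxA.
Qed.

Lemma canonical_iso (A : E0S -> E0S -> M3) : is_canonical A ->
  bundle_connection_iso (@E0 R) (@E0_proj R) (@E0_act R) A
    (P `&` p @^-1` (@TCP2_star R)) p act theta.
Proof.
move=> Acan; exists f, f'; split.
- by split; exact: smooth_on_global.
- move=> z [zT zS]; rewrite /P /p /E0_proj /= fK; split=> //.
  by split=> //; split=> //; case: zT.
- by move=> z [[_ zS] zT]; rewrite f'K; split=> //; split.
- by move=> z h _ _; rewrite /act fK.
- move=> c cS; have D := is_derive_lin fE fW fl (smooth_curve_is_derive cS).
  rewrite (velocityE D) /theta !fK; apply/esym/Acan; last by exists c.
  by have [I [_ I0 _ IE]] := cS; exact: IE.
Qed.
End Canonical.

Lemma canonical_extends (A : E0S -> E0S -> M3) : is_canonical A -> extends_across_zero_section A.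
Proof.
move=> Acan; have [|n [f [f' [fl f'l fK f'K]]]] := findim_row_iso (findim_E0 R).
  exists (0, 1%:M : M3); apply/eqP => /(congr1 (fun z : E0S => z.2 0 0)); rewrite !mxE => /eqP.
  by rewrite oner_eq0.
exists n, [set w | TCP2 (f' w).1 /\ SO3 (f' w).2], (fun w => (f' w).1).
exists (fun w h => f ((f' w).1, (f' w).2 *m h)), (fun w v => (f' w).2^T *m (f' v).2); split.
- exact: canonical_bundle.
- exact: canonical_connection.
- exact: canonical_iso.
Qed.

(** * SU(3)-orbits of nonzero covectors and the tangent space at a representative *)

Lemma cplx_normalize (z : 'cV[R[i]]_3) : z != 0 ->
  exists s (u : 'cV[R[i]]_3), [/\ 0 < s, u^t* *m u = 1%:M & z = s%:C *: u].
Proof.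
move=> z0; pose N : R := \sum_i (complex.Re (z i 0) ^+ 2 + complex.Im (z i 0) ^+ 2).
have zz : z^t* *m z = N%:C%:M.
  apply/matrixP => i j; rewrite !ord1 !mxE rmorph_sum; apply: eq_bigr => k _.
  rewrite !mxE; case: (z k 0) => a b /=.
  by apply/eqP; rewrite eq_complex /=; apply/andP; split; apply/eqP; ring.
have N0 : 0 <= N by apply: sumr_ge0 => i _; rewrite addr_ge0 // sqr_ge0.
have Np : 0 < N.
  rewrite lt_neqAle N0 andbT; apply: contra z0 => /eqP NE.
  apply/eqP/matrixP => i j; rewrite ord1 mxE.
  have /eqP := esym NE; rewrite psumr_eq0; last by move=> k _; rewrite addr_ge0 // sqr_ge0.
  move=> /allP /(_ i (mem_index_enum i)) /=; rewrite paddr_eq0 ?sqr_ge0 // !sqrf_eq0.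
  by case: (z i 0) => a b /= /andP[/eqP -> /eqP ->].
have sp : 0 < Num.sqrt N by rewrite sqrtr_gt0.
have sn0 : (Num.sqrt N)%:C != 0 :> R[i].
  by rewrite eq_complex /= eqxx andbT gt_eqF.
exists (Num.sqrt N), ((Num.sqrt N)%:C^-1 *: z); split=> //; last by rewrite scalerA mulfV // scale1r.
have -> : ((Num.sqrt N)%:C^-1 *: z)^t* = (Num.sqrt N)%:C^-1 *: z^t*.
  apply/matrixP => i j; rewrite !mxE rmorphM; congr (_ * _).
  rewrite fmorphV; congr (_^-1); apply/eqP.
  by rewrite eq_complex /= oppr0 !eqxx.
rewrite -scalemxAl -scalemxAr zz scalerA scale_scalar_mx; congr (_%:M).
have -> : N%:C = (Num.sqrt N)%:C * (Num.sqrt N)%:C :> R[i].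
  by rewrite -rmorphM -expr2 sqr_sqrtr.
by rewrite mulrACA mulVf // mulr1.
Qed.

Lemma trC_entries m n (z : 'M[R[i]]_(m, n)) i j : z^t* i j = Num.conj (z j i).
Proof. by rewrite !mxE. Qed.

Lemma frob0_eq0 (r : C3) : r *m r^t* = 0 -> r = 0.
Proof.
move=> H; apply/matrixP => i j; rewrite mxE.
have := congr1 (fun m : C3 => m i i) H; rewrite mxE [RHS]mxE => /eqP.
rewrite psumr_eq0; last by move=> k _; rewrite !mxE mul_conjC_ge0.
by move=> /allP /(_ j (mem_index_enum j)) /=; rewrite !mxE mul_conjC_eq0 => /eqP.
Qed.

(** The diagonal entries of a Hermitian idempotent are the squared norms of its rows, so trace zero
    kills every entry. *)
Lemma trace0_projection (r : C3) : r^t* = r -> r *m r = r -> \tr r = 0 -> r = 0.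
Proof.
move=> rh rr r0; apply: frob0_eq0; rewrite rh rr.
apply/matrixP => i j; rewrite [RHS]mxE.
have : \tr r == 0 by rewrite r0.
have rE k : r k k = \sum_l r k l * Num.conj (r k l).
  rewrite -[LHS]/((r : C3) k k) -[in LHS]rr mxE; apply: eq_bigr => l _.
  by congr (_ * _); have := congr1 (fun m : C3 => m l k) rh; rewrite trC_entries => ->.
rewrite /mxtrace psumr_eq0; last by move=> k _; rewrite rE sumr_ge0 // => l _; rewrite mul_conjC_ge0.
move=> /allP /(_ i (mem_index_enum i)) /=; rewrite rE psumr_eq0; last by move=> k _; rewrite mul_conjC_ge0.
by move=> /allP /(_ j (mem_index_enum j)) /=; rewrite mul_conjC_eq0 => /eqP.
Qed.

(** Let u be a normalised nonzero column of [p]. Then p - u u^* is a Hermitian idempotent of trace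
    zero. *)
Lemma rank1_projection (p : C3) : p *m p = p -> p^t* = p -> \tr p = 1 ->
  exists u : 'cV[R[i]]_3, u^t* *m u = 1%:M /\ p = u *m u^t*.
Proof.
move=> pp ph p1; have [j pj] : exists j, col j p != 0.
  apply/existsP; apply: contraT; rewrite negb_exists => /forallP H.
  have p0 : p = 0.
    by apply/matrixP => i j; have /negPn/eqP/matrixP/(_ i 0) := H j; rewrite !mxE.
  by move: p1; rewrite p0 mxtrace0 => /eqP; rewrite eq_sym oner_eq0.
have [s [u [s0 uu pu]]] := cplx_normalize pj.
exists u; split=> //.
have sn0 : s%:C != 0 :> R[i] by rewrite eq_complex /= eqxx andbT gt_eqF.
have pu' : p *m u = u.
  have : p *m col j p = col j p by rewrite colE mulmxA pp.
  by rewrite pu -scalemxAr => /(scalerI sn0).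
have up : u^t* *m p = u^t* by rewrite -[in LHS]ph -trC_M pu'.
apply/eqP; rewrite -subr_eq0; apply/eqP; apply: trace0_projection.
- by rewrite trC_D trC_N trC_M trmxCK ph.
- rewrite mulmxBl !mulmxBr pp !mulmxA pu' -[u *m u^t* *m p]mulmxA up -[u *m u^t* *m u]mulmxA uu mulmx1.
  by rewrite subrr subr0.
- by rewrite linearB /= p1 mxtrace_mulC uu mxtrace1 subrr.
Qed.

(** The capitals V and U stand for the conjugates of v and u, which makes all identities polynomial.
    The first conclusion is Lagrange's identity. *)
Lemma cross_product (F : comNzRingType) (v0 v1 v2 u0 u1 u2 V0 V1 V2 U0 U1 U2 : F)
    (w0 := V1 * U2 - V2 * U1) (w1 := V2 * U0 - V0 * U2) (w2 := V0 * U1 - V1 * U0)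
    (W0 := v1 * u2 - v2 * u1) (W1 := v2 * u0 - v0 * u2) (W2 := v0 * u1 - v1 * u0) :
  V0 * v0 + V1 * v1 + V2 * v2 = 1 -> U0 * u0 + U1 * u1 + U2 * u2 = 1 ->
  V0 * u0 + V1 * u1 + V2 * u2 = 0 ->
  [/\ W0 * w0 + W1 * w1 + W2 * w2 = 1,
      V0 * w0 + V1 * w1 + V2 * w2 = 0 /\ U0 * w0 + U1 * w1 + U2 * w2 = 0
    & W0 * v0 + W1 * v1 + W2 * v2 = 0 /\ W0 * u0 + W1 * u1 + W2 * u2 = 0].
Proof.
move=> vv uu vu; split; last 2 first.
- by split; rewrite /w0 /w1 /w2; ring.
- by split; rewrite /W0 /W1 /W2; ring.
transitivity ((V0 * v0 + V1 * v1 + V2 * v2) * (U0 * u0 + U1 * u1 + U2 * u2) -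
   (V0 * u0 + V1 * u1 + V2 * u2) * (U0 * v0 + U1 * v1 + U2 * v2)).
  by rewrite /W0 /W1 /W2 /w0 /w1 /w2; ring.
by rewrite vv uu vu mul0r subr0 mulr1.
Qed.

(** The third column is the conjugate of the cross product of the first two, so that the determinant
    is its squared norm, which is 1. *)
Lemma unitary_completion (v u : 'cV[R[i]]_3) :
  v^t* *m v = 1%:M -> u^t* *m u = 1%:M -> v^t* *m u = 0 ->
  exists g : C3, [/\ g^t* *m g = 1%:M, \det g = 1, col 0 g = v & col 1 g = u].
Proof.
have entry (x y : 'cV[R[i]]_3) : (x^t* *m y) 0 0 =
    Num.conj (x 0 0) * y 0 0 + Num.conj (x 1 0) * y 1 0 + Num.conj (x 2 0) * y 2 0.
  by rewrite mxE sum3 !trC_entries.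
have to_entry (x y : 'cV[R[i]]_3) c : x^t* *m y = c%:M ->
    Num.conj (x 0 0) * y 0 0 + Num.conj (x 1 0) * y 1 0 + Num.conj (x 2 0) * y 2 0 = c.
  by move=> xy; rewrite -entry xy mxE eqxx.
have cK (z : R[i]) : Num.conj (Num.conj z) = z by exact: conjCK.
have cM (x y x' y' : R[i]) : Num.conj (Num.conj x * Num.conj y - Num.conj x' * Num.conj y') = x * y - x' * y'.
  by rewrite rmorphB; congr (_ - _); rewrite rmorphM; congr (_ * _); exact: cK.
move=> vvM uuM vuM.
have uvM : u^t* *m v = 0%:M by rewrite -[v]trmxCK -trC_M vuM trmx0 map_mx0 raddf0.
have {}vuM : v^t* *m u = 0%:M by rewrite vuM raddf0.
have vv := to_entry _ _ _ vvM; have uu := to_entry _ _ _ uuM.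
have vu := to_entry _ _ _ vuM; have uv := to_entry _ _ _ uvM.
have [ww [vw uw] [wv wu]] := cross_product vv uu vu.
set V0 := Num.conj (v 0 0) in vv vu ww vw uw; set V1 := Num.conj (v 1 0) in vv vu ww vw uw.
set V2 := Num.conj (v 2 0) in vv vu ww vw uw.
set U0 := Num.conj (u 0 0) in uu uv ww vw uw; set U1 := Num.conj (u 1 0) in uu uv ww vw uw.
set U2 := Num.conj (u 2 0) in uu uv ww vw uw.
pose w : 'I_3 -> R[i] := fun i => if i == 0 then V1 * U2 - V2 * U1
  else if i == 1 then V2 * U0 - V0 * U2 else V0 * U1 - V1 * U0.
pose g : C3 := \matrix_(i, j) if j == 0 then v i 0 else if j == 1 then u i 0 else w i.
have g0 i : g i 0 = v i 0 by rewrite mxE.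
have g1 i : g i 1 = u i 0 by rewrite mxE.
have g2 i : g i 2 = w i by rewrite mxE.
have W0 : Num.conj (w 0) = v 1 0 * u 2 0 - v 2 0 * u 1 0 by exact: cM.
have W1 : Num.conj (w 1) = v 2 0 * u 0 0 - v 0 0 * u 2 0 by exact: cM.
have W2 : Num.conj (w 2) = v 0 0 * u 1 0 - v 1 0 * u 0 0 by exact: cM.
exists g; split.
- by apply: mx3P; rewrite !mxE !sum3 !trC_entries ?g0 ?g1 ?g2 ?W0 ?W1 ?W2 ?ord3E ?eqxx.
- by rewrite det3 !(g0, g1, g2) -ww /w /=; ring.
- by apply/matrixP => i j; rewrite ord1 !mxE.
- by apply/matrixP => i j; rewrite ord1 !mxE.
Qed.

Lemma conj_delta (g : C3) i j : g *m delta_mx i j *m g^t* = col i g *m (col j g)^t*.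
Proof.
have trCd : (delta_mx j 0 : 'cV[R[i]]_3)^t* = delta_mx 0 j.
  by apply/matrixP => k l; rewrite !mxE andbC rmorph_nat.
by rewrite !colE trC_M trCd !mulmxA -[g *m _ *m delta_mx 0 j]mulmxA mul_delta_mx.
Qed.

(** A unit vector u on the line becomes the second column of g. The covector is q = s u v^* with v a
    unit vector, orthogonal to u because q p = 0, and v becomes the first column. *)
Lemma TCP2_star_orbit (x : CM * CM) : TCP2_star x ->
  exists s (g : CM), [/\ 0 < s, SU3 g & x = su3_act g (xs s)].
Proof.
move=> [[pp ph pt pq qp] q0]; set p := cplx x.1 in pp ph pt pq qp; set q := cplx x.2 in pq qp.
have [u [uu pE]] := rank1_projection pp ph pt.
pose y := u^t* *m q.
have qE : q = u *m y by rewrite -[LHS]pq pE mulmxA.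
have y0 : y^t* != 0.
  apply: contra_neq q0 => y0; rewrite -[x.2]cplxK -/q qE -[y]trmxCK y0 trmx0 map_mx0 mulmx0.
  exact: uncplx0.
have [s [v [s0 vv yE]]] := cplx_normalize y0.
have sn0 : s%:C != 0 :> R[i] by rewrite eq_complex /= eqxx andbT gt_eqF.
have yE' : y = s%:C *: v^t*.
  rewrite -[y]trmxCK yE; apply/matrixP => i j; rewrite !mxE rmorphM; congr (_ * _).
  by apply/eqP; rewrite eq_complex /= oppr0 !eqxx.
have vu : v^t* *m u = 0.
  have : u^t* *m (q *m p) *m u = 0 by rewrite qp mulmx0 mul0mx.
  rewrite mulmxA -/y pE !mulmxA -[y *m u *m u^t* *m u]mulmxA uu mulmx1 yE' -scalemxAl => /eqP.
  by rewrite scaler_eq0 (negPf sn0) => /eqP.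
have [g [gg g1 gv gu]] := unitary_completion vv uu vu.
exists s, (uncplx g); split=> //.
  split; rewrite uncplxK //; apply/unitarymxP; exact: mulmx1C.
have E : conj_by (uncplx g) (cplx (s *: uncplx (delta_mx 1 0))) = s *: conj_by (uncplx g) (delta_mx 1 0).
  by have := linear_scale s (uncplx (delta_mx 1 0)) (conj_by_linear (uncplx g)); rewrite uncplxK.
rewrite [LHS]surjective_pairing /su3_act /xs /= E uncplxK.
apply: (f_equal2 pair).
  by rewrite /conj_by uncplxK conj_delta gu -pE cplxK.
rewrite /conj_by uncplxK conj_delta gu gv -[LHS]cplxK -/q qE yE' -scalemxAr.
exact: uncplxZ.
Qed.

Lemma mulmx_delta (F : comNzRingType) (m : 'M[F]_3) (i j k l : 'I_3) : (m *m (delta_mx i j : 'M[F]_3)) k l = m k i *+ (l == j).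
Proof.
rewrite mxE (bigD1 i) //= big1 ?addr0 => [|n ni]; rewrite mxE ?eqxx ?(negPf ni) /= ?mulr0 //.
by case: eqP => _; rewrite ?mulr1 ?mulr0.
Qed.

Lemma delta_mulmx (F : comNzRingType) (m : 'M[F]_3) (i j k l : 'I_3) : ((delta_mx i j : 'M[F]_3) *m m) k l = m j l *+ (k == i).
Proof.
rewrite mxE (bigD1 j) //= big1 ?addr0 => [|n nj]; rewrite mxE ?eqxx ?(negPf nj) ?andbF ?andbT ?mul0r //.
by case: eqP => _; rewrite ?mul1r ?mul0r.
Qed.

(** A solution of the linearised equations of T*CP^2 at [xs s] is a motion by Z plus a radial part.
    P determines the coefficients of Z mixing index 1 with 0 and 2, the entry (1, 2) of Q determines
    c, and the entry (1, 0) of Q is shared between the rotation k, acting at speed 2, and [rho]. *)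
Lemma tangent_equations (F : comNzRingType) (P Q : 'M[F]_3) (s rho a a' b b' c c' k : F)
    (Z := a *: delta_mx 0 1 + a' *: delta_mx 1 0 + (b *: delta_mx 1 2 + b' *: delta_mx 2 1)
      + (c *: delta_mx 0 2 + c' *: delta_mx 2 0) + k *: (delta_mx 0 0 - delta_mx 1 1)) :
  P *m delta_mx 1 1 + delta_mx 1 1 *m P = P ->
  P *m (s *: delta_mx 1 0) + delta_mx 1 1 *m Q = Q ->
  Q *m delta_mx 1 1 + s *: delta_mx 1 0 *m P = 0 ->
  a = P 0 1 -> a' = - P 1 0 -> b = - P 1 2 -> b' = P 2 1 -> s * c = - Q 1 2 ->
  s * (- k - k) + rho = Q 1 0 ->
  P = Z *m delta_mx 1 1 - delta_mx 1 1 *m Z /\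
  Q = Z *m (s *: delta_mx 1 0) - s *: delta_mx 1 0 *m Z + rho *: delta_mx 1 0.
Proof.
move=> E1 E2 E3 Ea Ea' Eb Eb' Ec Ek.
have Zij (i j : 'I_3) : Z i j = a *+ ((i == 0) && (j == 1)) + a' *+ ((i == 1) && (j == 0))
   + (b *+ ((i == 1) && (j == 2)) + b' *+ ((i == 2) && (j == 1)))
   + (c *+ ((i == 0) && (j == 2)) + c' *+ ((i == 2) && (j == 0)))
   + (k *+ ((i == 0) && (j == 0)) - k *+ ((i == 1) && (j == 1))).
  by rewrite /Z !mxE mulrBr !mulr_natr.
clearbody Z.
have sc (x : F) (m : 'M[F]_3) i j : (x *: m) i j = x * m i j by rewrite mxE.
have ad (m n : 'M[F]_3) i j : (m + n) i j = m i j + n i j by rewrite mxE.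
have op (m : 'M[F]_3) i j : (- m) i j = - m i j by rewrite mxE.
have e1 (i j : 'I_3) := congr1 (fun m : 'M[F]_3 => m i j) E1.
have e2 (i j : 'I_3) := congr1 (fun m : 'M[F]_3 => m i j) E2.
have e3 (i j : 'I_3) := congr1 (fun m : 'M[F]_3 => m i j) E3.
have {}e1 (i j : 'I_3) : P i 1 *+ (j == 1) + P 1 j *+ (i == 1) = P i j.
  by have := e1 i j; rewrite ad mulmx_delta delta_mulmx.
have {}e2 (i j : 'I_3) : s * (P i 1 *+ (j == 0)) + Q 1 j *+ (i == 1) = Q i j.
  by have := e2 i j; rewrite ad -scalemxAr sc mulmx_delta delta_mulmx.
have {}e3 (i j : 'I_3) : Q i 1 *+ (j == 1) + s * (P 0 j *+ (i == 1)) = 0.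
  by have := e3 i j; rewrite ad -scalemxAl sc mulmx_delta delta_mulmx mxE.
have P11 : P 1 1 = 0.
  by have /eqP := e1 1 1; rewrite !eqxx !mulr1n -subr_eq0 addrK => /eqP.
have Q11 : Q 1 1 = - (s * P 0 1).
  by have /eqP := e3 1 1; rewrite !eqxx !mulr1n addr_eq0 => /eqP.
have rE (i j : 'I_3) : (Z *m delta_mx 1 1 - delta_mx 1 1 *m Z) i j = Z i 1 *+ (j == 1) - Z 1 j *+ (i == 1).
  by rewrite ad op mulmx_delta delta_mulmx.
have sE (i j : 'I_3) : (Z *m (s *: delta_mx 1 0) - s *: delta_mx 1 0 *m Z + rho *: delta_mx 1 0) i j =
    s * (Z i 1 *+ (j == 0)) - s * (Z 0 j *+ (i == 1)) + rho * ((i == 1) && (j == 0))%:R.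
  by rewrite !ad op -scalemxAr -scalemxAl !sc mulmx_delta delta_mulmx mxE.
split.
  apply: mx3P; rewrite rE !Zij !ord3E !eqxx /= ?mulr1n ?mulr0n ?subr0 ?addr0 ?add0r ?Ea ?Ea' ?Eb ?Eb' ?opprK ?sub0r ?subrr ?opprK.
  - by rewrite -e1 !ord3E /= mulr0n addr0.
  - by [].
  - by rewrite -e1 !ord3E /= mulr0n addr0.
  - by [].
  - by rewrite addNr P11.
  - by [].
  - by rewrite -e1 !ord3E /= mulr0n addr0.
  - by [].
  - by rewrite -e1 !ord3E /= mulr0n addr0.
apply: mx3P; rewrite sE !Zij !ord3E !eqxx /= ?mulr1n ?mulr0n ?mulr0 ?mulr1 ?subr0 ?addr0 ?add0r ?sub0r.
- by rewrite -e2 !ord3E eqxx /= mulr0n mulr1n addr0 Ea.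
- by rewrite -e2 !ord3E /= !mulr0n mulr0 addr0.
- by rewrite -e2 !ord3E /= !mulr0n mulr0 addr0.
- by rewrite -Ek mulrBr.
- by rewrite Q11 Ea.
- by rewrite Ec opprK.
- by rewrite -e2 !ord3E eqxx /= mulr0n mulr1n addr0 Eb'.
- by rewrite -e2 !ord3E /= !mulr0n mulr0 addr0.
- by rewrite -e2 !ord3E /= !mulr0n mulr0 addr0.
Qed.

Lemma tangent_TCP2_equations (x w : CM * CM) (c : R -> CM * CM) :
  is_derive (0 : R) 1 c w -> c 0 = x -> (\forall t \near (0 : R), TCP2 (c t)) ->
  [/\ cplx w.1 *m cplx x.1 + cplx x.1 *m cplx w.1 = cplx w.1, (cplx w.1)^t* = cplx w.1,
      cplx w.1 *m cplx x.2 + cplx x.1 *m cplx w.2 = cplx w.2 &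
      cplx w.2 *m cplx x.1 + cplx x.2 *m cplx w.1 = 0].
Proof.
move=> D c0 cT; have fC := findim_CM R; have fT := findim_TCP R.
have D1 := is_derive_lin fT fC (l := fst) (fun _ _ _ => erefl) D.
have D2 := is_derive_lin fT fC (l := snd) (fun _ _ _ => erefl) D.
have uniq (f g : R -> CM) df dg : (\forall t \near (0 : R), f t = g t) ->
    is_derive (0 : R) 1 f df -> is_derive (0 : R) 1 g dg -> df = dg.
  by move=> fg Df Dg; rewrite -(is_derive_val (is_derive_near fg Df)) (is_derive_val Dg).
have B := is_derive_bilinear fC fC fC (@cmul_linear_l R) (@cmul_linear_r R).
have cE t : TCP2 (c t) -> [/\ cmul (c t).1 (c t).1 = (c t).1, cadj (c t).1 = (c t).1,
    cmul (c t).1 (c t).2 = (c t).2 & cmul (c t).2 (c t).1 = 0].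
  move=> [pp ph _ pq qp]; split; rewrite /cmul /cadj ?pp ?ph ?pq ?qp ?cplxK //; exact: uncplx0.
have n1 : \forall t \near (0 : R), cmul (c t).1 (c t).1 = (c t).1 by apply: filterS cT => t /cE[].
have n2 : \forall t \near (0 : R), cadj (c t).1 = (c t).1 by apply: filterS cT => t /cE[].
have n3 : \forall t \near (0 : R), cmul (c t).1 (c t).2 = (c t).2 by apply: filterS cT => t /cE[].
have n4 : \forall t \near (0 : R), cmul (c t).2 (c t).1 = 0 by apply: filterS cT => t /cE[].
have Epp := uniq _ _ _ _ n1 (B _ _ _ _ _ _ _ D1 D1) D1.
have Eph := uniq _ _ _ _ n2 (is_derive_lin fC fC (@cadj_linear R) D1) D1.
have Epq := uniq _ _ _ _ n3 (B _ _ _ _ _ _ _ D1 D2) D2.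
have Eqp := uniq _ _ _ _ n4 (B _ _ _ _ _ _ _ D2 D1) (is_derive_cst (0 : CM) (0 : R) (1 : R)).
rewrite /= c0 in Epp Epq Eqp.
split.
- by move: (congr1 (@cplx R) Epp); rewrite cplxD !cplx_cmul.
- by move: (congr1 (@cplx R) Eph); rewrite cplx_cadj.
- by move: (congr1 (@cplx R) Epq); rewrite cplxD !cplx_cmul.
- by move: (congr1 (@cplx R) Eqp); rewrite cplxD !cplx_cmul cplx0.
Qed.

(** * Invariant connections at the representatives *)

Section Invariant.
Variable A : E0S -> E0S -> M3.
Hypothesis Aconn : principal_connection (@E0 R) (@E0_act R) A.
Hypothesis Ainv : su3_invariant A.

Lemma A_extension z : E0 z -> exists beta, local_extension (@E0 R) A z beta.
Proof. by case: Aconn => H _ _ _; exact: H. Qed.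

Lemma local_extension_at (V W : normedModType R) (S : set V) (a : V -> V -> W) z b v :
  local_extension S a z b -> S z -> tangent S z v -> a z v = b z v.
Proof. by move=> [U [_ Uz _ _ H]] Sz vT; exact: H. Qed.

Lemma local_extension_linear (V W : normedModType R) (S : set V) (a : V -> V -> W) z b :
  local_extension S a z b -> forall y, linear (b y).
Proof. by case=> U []. Qed.

Lemma A_section (x w : CM * CM) (h : M3) : tangent (@E0 R) (x, 1%:M) (w, 0) -> SO3 h ->
  A (x, h) (w, 0) = h^T *m A (x, 1%:M) (w, 0) *m h.
Proof.
move=> [c [cS c0 cv]] hS; have [_ _ _ H] := Aconn.
have := H c h cS hS; rewrite c0 cv /E0_act /= mul1mx => <-.
congr (A _ _); apply/esym/velocityE.
have D := smooth_curve_is_derive cS; rewrite cv in D.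
have fT := findim_TCP R; have fM := findim_mx R 2 2.
have D1 := is_derive_lin (findim_E0 R) fT (l := fst) (fun _ _ _ => erefl) D.
have D2 := is_derive_lin (findim_E0 R) fM (l := snd) (fun _ _ _ => erefl) D.
have lh : linear (fun m : M3 => m *m h) by move=> a y y'; rewrite mulmxDl scalemxAl.
have := is_derive_pair fT fM D1 (is_derive_lin fM fM lh D2).
by rewrite /= mul0mx.
Qed.

Lemma tangent_E0_base (z v : E0S) (h : M3) : tangent (@E0 R) z v -> SO3 h ->
  tangent (@E0 R) (z.1, h) (v.1, 0).
Proof.
move=> + hS => -[c [cS c0 cv]].
have D := smooth_curve_is_derive cS; rewrite cv in D.
have fT := findim_TCP R; have fM := findim_mx R 2 2.
have D1 := is_derive_lin (findim_E0 R) fT (l := fst) (fun _ _ _ => erefl) D.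
have [I [oI I0 Ic IS]] := cS.
exists (fun t => ((c t).1, h)); split.
- exists I; split=> // [k|t It]; last first.
    by have [] := IS t It; split.
  apply: Ck_pair => //; last exact: Ck_cst.
  by apply: (Ck_linear_comp (l := fst) oI (findim_E0 R) fT).
- by rewrite c0.
- by apply: velocityE; exact: (is_derive_pair fT fM D1 (is_derive_cst _ _ _)).
Qed.

(** A vertical vector is the velocity of the orbit z . k(t), where k(t) is z.2^T times the fibre
    part of a curve representing [v]. *)
Lemma A_fiber (z v : E0S) : tangent (@E0 R) z v -> A z (0, v.2) = z.2^T *m v.2.
Proof.
move=> [c [cS c0 cv]].
have D := smooth_curve_is_derive cS; rewrite cv in D.
have fT := findim_TCP R; have fM := findim_mx R 2 2.
have D2 := is_derive_lin (findim_E0 R) fM (l := snd) (fun _ _ _ => erefl) D.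
have [I [oI I0 Ic IS]] := cS; have [zT zS] := IS 0 I0; rewrite c0 in zT zS.
have lh : linear (fun m : M3 => z.2^T *m m) by move=> a y y'; rewrite mulmxDr scalemxAr.
pose k t := z.2^T *m (c t).2.
have Dk : is_derive (0 : R) 1 k (z.2^T *m v.2) := is_derive_lin fM fM lh D2.
have kS : smooth_curve (@SO3 R) k.
  exists I; split=> // [n|t It].
    apply: (Ck_linear_comp (l := fun m : M3 => z.2^T *m m) oI fM fM lh).
    by apply: (Ck_linear_comp (l := snd) oI (findim_E0 R) fM).
  have [_ [h1 h2]] := IS t It; have [z1 z2] := zS; split.
    by rewrite /k trmx_mul trmxK mulmxA -[_ *m z.2 *m _]mulmxA (SO3_tr zS) mulmx1.
  by rewrite /k det_mulmx det_tr z2 h2 mulr1.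
have k0 : k 0 = 1%:M by rewrite /k c0; case: zS.
have [_ _ H _] := Aconn.
have := H z k (conj zT zS) kS k0; rewrite (velocityE Dk) => <-.
congr (A _ _); apply/esym/velocityE.
have lh' : linear (fun m : M3 => z.2 *m m) by move=> a y y'; rewrite mulmxDr scalemxAr.
have := is_derive_pair fT fM (is_derive_cst z.1 (0 : R) 1) (is_derive_lin fM fM lh' Dk).
by rewrite /= mulmxA (SO3_tr zS) mul1mx.
Qed.

(** A connection form is linear only through a local extension, which speaks of tangent vectors;
    hence both summands must first be shown to be tangent. *)
Lemma A_split (z v : E0S) : tangent (@E0 R) z v ->
  A z v = z.2^T *m A (z.1, 1%:M) (v.1, 0) *m z.2 + z.2^T *m v.2.
Proof.
move=> vT.
have [c [[I [oI I0 Ic IS]] c0 cv]] := vT; have zE := IS 0 I0; rewrite c0 in zE.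
have [zT zS] := zE.
have v1T := tangent_E0_base vT zS; rewrite -surjective_pairing in v1T.
have v1T' := tangent_E0_base vT SO3_1.
have [b bE] := A_extension zE.
have v2T : tangent (@E0 R) z (0, v.2).
  have D := smooth_curve_is_derive (ex_intro _ I (And4 oI I0 Ic IS)); rewrite cv in D.
  have fT := findim_TCP R; have fM := findim_mx R 2 2.
  have D2 := is_derive_lin (findim_E0 R) fM (l := snd) (fun _ _ _ => erefl) D.
  exists (fun t => (z.1, (c t).2)); split.
  - exists I; split=> // [k|t It]; last by split=> //=; have [] := IS t It.
    apply: Ck_pair => //; first exact: Ck_cst.
    by apply: (Ck_linear_comp (l := snd) oI (findim_E0 R) fM).
  - by rewrite c0; case: (z).
  - by apply: velocityE; exact: (is_derive_pair fT fM (is_derive_cst _ _ _) D2).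
have E : v = (v.1, 0) + (0, v.2).
  by case: (v) => a b'; rewrite {1}/GRing.add /= /add_pair /= addr0 add0r.
rewrite -(A_section v1T' zS) -surjective_pairing -(A_fiber vT).
rewrite (local_extension_at bE zE v1T) (local_extension_at bE zE v2T).
by rewrite -(linear_add _ _ (local_extension_linear bE z)) -E; exact: local_extension_at bE zE vT.
Qed.

(* The value at [Z] of the connection form along the orbit through [xs s]. *)
Definition alpha (s : R) (Z : C3) : M3 := A (xs s, 1%:M) (ad Z (xs s), 0).

Lemma alpha_extension s b : s != 0 -> local_extension (@E0 R) A (xs s, 1%:M) b ->
  forall (X : C3) (h : CM), rotgen X -> SU3 h ->
  alpha s ((cplx h)^t* *m X *m cplx h) =
  b (xs s, 1%:M) (ad ((cplx h)^t* *m X *m cplx h) (xs s), 0).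
Proof.
move=> s0 bE X h rX hS; apply: (local_extension_at bE).
  by split=> /=; [exact: TCP2_star_xs|exact: SO3_1].
by apply: tangent_ad => //; exact: SO3_1.
Qed.

Lemma conj1 (X : C3) : (cplx (uncplx 1%:M : CM))^t* *m X *m cplx (uncplx 1%:M : CM) = X.
Proof. by rewrite uncplxK trC_1 mul1mx mulmx1. Qed.

(** Invariance moves the base point back to [xs s], equivariance moves the fibre point back to 1. *)
Lemma A_orbit s (k : M3) (g h : CM) (X : C3) : s != 0 -> SO3 k -> SU3 g -> SU3 h -> rotgen X ->
  A (su3_act g (xs s), k) (su3_act g (ad ((cplx h)^t* *m X *m cplx h) (xs s)), 0) =
  k^T *m alpha s ((cplx h)^t* *m X *m cplx h) *m k.
Proof.
move=> s0 kS gS hS rX.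
rewrite -(A_section (tangent_ad s0 SO3_1 rX hS) kS).
have zE : E0 (xs s, k) by split=> //=; exact: TCP2_star_xs.
exact: (Ainv gS zE (tangent_ad s0 kS rX hS)).
Qed.

Section TwoRotations.
Variables (s : R) (k : M3) (X Y : C3).
Hypotheses (s0 : s != 0) (kS : SO3 k) (rX : rotgen X) (rY : rotgen Y).

(** A surface with velocities [X] and [Y] at the origin on which A is explicit everywhere: on the
    second velocity it is constant, on the first it depends on the second parameter alone. *)
Definition orbit2 (p : R * R) : E0S :=
  (su3_act (cmul (rotation X p.1) (rotation Y p.2)) (xs s), k).

Lemma Ck_orbit2 n : Ck n setT orbit2.
Proof.
apply: Ck_pair; [exact: openT|exact: findim_TCP|exact: findim_mx| |exact: Ck_cst].
apply: Ck_su3_act; [exact: openT| |exact: Ck_cst].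
have fRR := findim_prod (findim_R R) (findim_R R).
apply: Ck_cmul; [exact: openT| |].
  apply: (@Ck_comp _ _ R _ n setT setT (rotation X) fst) => //; try exact: openT.
  - exact: findim_R.
  - exact: findim_CM.
  - by apply: Ck_rotation; exact: openT.
  - by apply: Ck_linear => //; [exact: openT|exact: findim_R].
apply: (@Ck_comp _ _ R _ n setT setT (rotation Y) snd) => //; try exact: openT.
- exact: findim_R.
- exact: findim_CM.
- by apply: Ck_rotation; exact: openT.
- by apply: Ck_linear => //; [exact: openT|exact: findim_R].
Qed.

Lemma E0_orbit2 p : E0 (orbit2 p).
Proof.
split=> //=; apply: TCP2_star_su3_act; last exact: TCP2_star_xs.
by apply: SU3_cmul; exact: SU3_rotation.
Qed.

Lemma derive_orbit2_l p : 'D_(1, 0) orbit2 p =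
  (su3_act (cmul (rotation X p.1) (rotation Y p.2))
    (ad ((cplx (rotation Y p.2))^t* *m X *m cplx (rotation Y p.2)) (xs s)), 0).
Proof.
have hS := SU3_rotation p.2 rY.
have fC := findim_CM R.
have fRR := findim_prod (findim_R R) (findim_R R).
have D1 : is_derive p (1, 0) (fun p : R * R => cmul (rotation X p.1) (rotation Y p.2))
  (uncplx (cplx (cmul (rotation X p.1) (rotation Y p.2)) *m
    ((cplx (rotation Y p.2))^t* *m X *m cplx (rotation Y p.2)))).
  have d1 := is_derive_lin fRR (findim_R R) (l := fst) (fun _ _ _ => erefl) (is_derive_id p (1, 0)).
  have d2 := is_derive_lin fRR (findim_R R) (l := snd) (fun _ _ _ => erefl) (is_derive_id p (1, 0)).
  have e1 := is_derive_comp1 d1 (is_derive_rotation p.1 rX).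
  have e2 := is_derive_comp1 d2 (is_derive_rotation p.2 rY).
  have := is_derive_bilinear fC fC fC (@cmul_linear_l R) (@cmul_linear_r R) e1 e2.
  rewrite /= scale1r scale0r (linear_zero (cmul_linear_r _)) addr0.
  move=> D; apply: (is_derive_eq D); move: (rotation X p.1) (rotation Y p.2) hS => g h.
  move=> [/unitarymxP hu _]; rewrite /cmul !uncplxK; apply: (congr1 (@uncplx R)).
  by rewrite !mulmxA -[in RHS](mulmxA _ (cplx h) ((cplx h)^t*)) hu mulmx1.
have := is_derive_pair (findim_TCP R) (findim_mx R 2 2)
  (is_derive_su3_act (skew_conj _ (rotgen_skew rX)) D1 (is_derive_cst (xs s) p (1, 0)))
  (is_derive_cst k p (1, 0)).
by move=> /is_derive_val; rewrite addr0.
Qed.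

Lemma derive_orbit2_r p : 'D_(0, 1) orbit2 p =
  (su3_act (cmul (rotation X p.1) (rotation Y p.2)) (ad Y (xs s)), 0).
Proof.
have fC := findim_CM R.
have fRR := findim_prod (findim_R R) (findim_R R).
have D1 : is_derive p (0, 1) (fun p : R * R => cmul (rotation X p.1) (rotation Y p.2))
  (uncplx (cplx (cmul (rotation X p.1) (rotation Y p.2)) *m Y)).
  have d1 := is_derive_lin fRR (findim_R R) (l := fst) (fun _ _ _ => erefl) (is_derive_id p (0, 1)).
  have d2 := is_derive_lin fRR (findim_R R) (l := snd) (fun _ _ _ => erefl) (is_derive_id p (0, 1)).
  have e1 := is_derive_comp1 d1 (is_derive_rotation p.1 rX).
  have e2 := is_derive_comp1 d2 (is_derive_rotation p.2 rY).
  have := is_derive_bilinear fC fC fC (@cmul_linear_l R) (@cmul_linear_r R) e1 e2.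
  rewrite /= scale1r scale0r (linear_zero (cmul_linear_l _)) add0r.
  move=> D; apply: (is_derive_eq D); move: (rotation X p.1) (rotation Y p.2) => g h.
  by rewrite /cmul !uncplxK mulmxA.
have := is_derive_pair (findim_TCP R) (findim_mx R 2 2)
  (is_derive_su3_act (rotgen_skew rY) D1 (is_derive_cst (xs s) p (0, 1)))
  (is_derive_cst k p (0, 1)).
by move=> /is_derive_val; rewrite addr0.
Qed.

Lemma A_orbit2_l p : A (orbit2 p) ('D_(1, 0) orbit2 p) =
  k^T *m alpha s ((cplx (rotation Y p.2))^t* *m X *m cplx (rotation Y p.2)) *m k.
Proof.
rewrite derive_orbit2_l; apply: A_orbit => //; last exact: SU3_rotation.
by apply: SU3_cmul; exact: SU3_rotation.
Qed.

Lemma A_orbit2_r p : A (orbit2 p) ('D_(0, 1) orbit2 p) = k^T *m alpha s Y *m k.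
Proof.
rewrite derive_orbit2_r -[Y in ad Y]conj1 -[Y in alpha s Y]conj1; apply: A_orbit => //.
  by apply: SU3_cmul; exact: SU3_rotation.
exact: SU3_1.
Qed.

(** Conjugating [X] by the rotations of [Y] and differentiating at the identity gives [X, Y]; the
    linear extension [b] carries this over to A. *)
Lemma is_derive_A_orbit2 b : local_extension (@E0 R) A (xs s, 1%:M) b ->
  is_derive (0 : R * R) (0, 1) (fun p => A (orbit2 p) ('D_(1, 0) orbit2 p))
   (k^T *m b (xs s, 1%:M) (ad (X *m Y - Y *m X) (xs s), 0) *m k).
Proof.
move=> bE; have fC := findim_CM R; have fM := findim_mx R 2 2.
have fRR := findim_prod (findim_R R) (findim_R R).
pose l (x : CM) : M3 := k^T *m b (xs s, 1%:M) (ad (cplx x) (xs s), 0) *m k.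
have ll : linear l.
  move=> a x y; rewrite /l cplxD cplxZ ad_linear_l.
  rewrite (_ : (a *: ad (cplx x) (xs s) + ad (cplx y) (xs s), 0) =
     a *: (ad (cplx x) (xs s), 0) + (ad (cplx y) (xs s), 0) :> E0S); last first.
    by congr (_, _); rewrite /= scaler0 addr0.
  by rewrite (local_extension_linear bE) mulmxDr mulmxDl -scalemxAr -scalemxAl.
have E p : A (orbit2 p) ('D_(1, 0) orbit2 p) =
   l (cmul (cmul (cadj (rotation Y p.2)) (uncplx X)) (rotation Y p.2)).
  rewrite A_orbit2_l (alpha_extension s0 bE rX (SU3_rotation p.2 rY)) /l.
  by move: (rotation Y p.2) => r; rewrite !cplx_cmul cplx_cadj uncplxK.
have d2 := is_derive_lin fRR (findim_R R) (l := snd) (fun _ _ _ => erefl) (is_derive_id (0 : R * R) (0, 1)).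
have e2 := is_derive_comp1 d2 (is_derive_rotation 0 rY).
have e1 := is_derive_lin fC fC (@cadj_linear R) e2.
have e3 := is_derive_lin fC fC (cmul_linear_l (uncplx X)) e1.
have e4 := is_derive_bilinear fC fC fC (@cmul_linear_l R) (@cmul_linear_r R) e3 e2.
have := is_derive_lin fC fM ll e4.
rewrite (_ : _ \o _ = (fun p => A (orbit2 p) ('D_(1, 0) orbit2 p))); last by apply/funext.
move=> D; apply: (is_derive_eq D); rewrite /= !scale1r rotation0.
rewrite (_ : _ + _ = uncplx (X *m Y - Y *m X)) ?/l ?uncplxK //.
rewrite /cmul /cadj !uncplxK -uncplxD; apply: (congr1 (@uncplx R)).
by rewrite trC_1 !mul1mx !mulmx1 (rotgen_skew rY) mulNmx addrC.
Qed.

End TwoRotations.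

(* The (X, Y)-component of d A at [xs s], for generators X and Y. *)
Lemma ext_deriv_orbit s X Y b : s != 0 -> rotgen X -> rotgen Y ->
  local_extension (@E0 R) A (xs s, 1%:M) b ->
  'D_(ad X (xs s), 0) (b^~ (ad Y (xs s), 0)) (xs s, 1%:M) -
  'D_(ad Y (xs s), 0) (b^~ (ad X (xs s), 0)) (xs s, 1%:M) =
  - b (xs s, 1%:M) (ad (X *m Y - Y *m X) (xs s), 0).
Proof.
move=> s0 rX rY bE; have [U [oU Uz bC bl bA]] := bE.
pose G := orbit2 s 1%:M X Y.
have G0 : G 0 = (xs s, 1%:M).
  rewrite /G /orbit2 /= !rotation0 /cmul uncplxK mul1mx su3_act1 //.
have GX : 'D_(1, 0) G 0 = (ad X (xs s), 0).
  rewrite /G derive_orbit2_l // !rotation0 conj1 /cmul uncplxK mul1mx su3_act1 //.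
have GY : 'D_(0, 1) G 0 = (ad Y (xs s), 0).
  rewrite /G derive_orbit2_r // !rotation0 /cmul uncplxK mul1mx su3_act1 //.
have GE p : E0 (G p) by apply: E0_orbit2 => //; exact: SO3_1.
have fRR := findim_prod (findim_R R) (findim_R R).
have GT p v : tangent (@E0 R) (G p) ('D_v G p).
  exact: (@tangent_line _ _ setT _ G p v fRR (findim_E0 R) openT (Ck_orbit2 s 1%:M X Y) (fun p _ => GE p) I).
have UG0 : U (G 0) by rewrite G0.
have nU : \forall p \near (0 : R * R), U (G p).
  have Gc := Ck_continuous (Ck_orbit2 s 1%:M X Y 0) (I : setT (0 : R * R)).
  exact: Gc (open_nbhs_nbhs (conj oU UG0)).
have E1 : 'D_(1, 0) (fun y => b (G y) ('D_(0, 1) G y)) 0 = 0.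
  transitivity ('D_(1, 0) (fun _ : R * R => alpha s Y) 0); last exact: derive_cst.
  apply: near_eq_derive; near=> p; have Up : U (G p) by near: p.
  rewrite -(bA _ _ (GE p) Up (GT p _)) (A_orbit2_r s0 SO3_1 rX rY p).
  by rewrite trmx1 mul1mx mulmx1.
have E2 : 'D_(0, 1) (fun y => b (G y) ('D_(1, 0) G y)) 0 =
    b (xs s, 1%:M) (ad (X *m Y - Y *m X) (xs s), 0).
  have := is_derive_val (is_derive_A_orbit2 s0 SO3_1 rX rY bE).
  rewrite trmx1 mul1mx mulmx1 => <-.
  apply: near_eq_derive; near=> p; have Up : U (G p) by near: p.
  by rewrite -(bA _ _ (GE p) Up (GT p _)).
rewrite -[RHS]sub0r.
exact: (pullback_ext_deriv openT oU (findim_E0 R) (findim_mx R 2 2)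
  (Ck_orbit2 s 1%:M X Y 2) I Uz (fun w => bC w 1%N) (fun y _ => bl y) G0 GX GY E1 E2).
Unshelve. all: by end_near. Qed.

(** [tangent] is defined by curves, so multiples come from the reparametrisation of t to a t. *)
Lemma tangent_scale (V : normedModType R) (S : set V) x v (a : R) : findim V ->
  tangent S x v -> tangent S x (a *: v).
Proof.
move=> fV [c [[I [oI I0 Ic IS]] c0 cv]].
have oI' : open [set t : R | I (a * t)].
  by have := open_line (y := 0) (v := a) oI; congr open; apply/funext => t; rewrite /= addr0 [t *: a]mulrC.
exists (fun t => c (a * t)); split.
- exists [set t : R | I (a * t)]; split=> //; rewrite /= ?mulr0 //; last by move=> t /IS.
  move=> n; apply: (@Ck_comp _ R R _ n _ I c (fun t : R => a * t)) => //; first exact: findim_R.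
  by apply: Ck_mulr => //; [exact: Ck_cst|exact: Ck_id].
- by rewrite mulr0.
- apply: velocityE; rewrite -cv.
  have D := smooth_curve_is_derive (ex_intro _ I (And4 oI I0 Ic IS)).
  have := is_derive_scale_dir a D => /is_derive_line0.
  rewrite (_ : (fun t : R => c (t *: (a *: 1) + 0)) = fun t => c (a * t)) //.
  by apply/funext => t; rewrite addr0 [a *: 1]mulr1 [t *: a]mulrC.
Qed.

Lemma calabi_radius (s : R) : 0 < s ->
  exists r : R, [/\ 1 < r, r ^+ 4 = s ^+ 2 + 1 & Num.sqrt (r ^+ 4 - 1) = s].
Proof.
move=> s0; have s1 : 0 <= s ^+ 2 + 1 by rewrite addr_ge0 // sqr_ge0.
have E : Num.sqrt (Num.sqrt (s ^+ 2 + 1)) ^+ 4 = s ^+ 2 + 1.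
  by rewrite (exprM _ 2 2) !sqr_sqrtr // sqrtr_ge0.
exists (Num.sqrt (Num.sqrt (s ^+ 2 + 1))); rewrite E; split=> //.
  by rewrite -(@ltr_pXn2r _ 4) ?nnegrE ?sqrtr_ge0 // E expr1n ltrDr exprn_gt0.
by rewrite addrK sqrtr_sqr gtr0_norm.
Qed.

(** The radial coefficient comes from the derivative 2 r^3 / sqrt (r^4 - 1) of the covector norm
    with respect to r. *)
Lemma is_derive_calabi (y : R * CM) (rho : R) (Z : C3) : Z^t* = - Z -> 1 < y.1 ->
  is_derive y (rho, uncplx (cplx y.2 *m Z)) (@calabi_map R)
   (su3_act y.2 (ad Z (xs (Num.sqrt (y.1 ^+ 4 - 1))) +
     (0, (2 * y.1 ^+ 3 * rho / Num.sqrt (y.1 ^+ 4 - 1)) *: uncplx (delta_mx 1 0)))).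
Proof.
move=> ZS y1; have fC := findim_CM R.
have fRC := findim_prod (findim_R R) fC.
set v := (rho, uncplx (cplx y.2 *m Z)) : R * CM.
have d1 := is_derive_lin fRC (findim_R R) (l := fst) (fun _ _ _ => erefl) (is_derive_id y v).
have d2 := is_derive_lin fRC fC (l := snd) (fun _ _ _ => erefl) (is_derive_id y v).
have r4 : 0 < y.1 ^+ 4 - 1 by rewrite subr_gt0 exprn_egt1.
have s0 : Num.sqrt (y.1 ^+ 4 - 1) != 0 by rewrite gt_eqF // sqrtr_gt0.
have d3 : is_derive y.1 1 (fun r : R => r ^+ 4 - 1) (4 * y.1 ^+ 3).
  have := is_deriveB (is_deriveX 4 (is_derive_id y.1 (1 : R))) (is_derive_cst (1 : R) y.1 1).
  by rewrite subr0 [_ *: 1]mulr1.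
have d4 : is_derive y.1 1 (fun r : R => Num.sqrt (r ^+ 4 - 1))
    (2 * y.1 ^+ 3 / Num.sqrt (y.1 ^+ 4 - 1)).
  have := is_derive1_comp (g := fun r : R => r ^+ 4 - 1) (is_derive1_sqrt r4) d3.
  move=> D; apply: (is_derive_eq D).
  by move: (Num.sqrt _) s0 (y.1 ^+ 3) => q q0 u; field.
have := is_derive_su3_act ZS d2 (is_derive_xs (is_derive_comp1 d1 d4)).
rewrite (_ : (fun y0 => _) = @calabi_map R); last first.
  by apply/funext => y'; rewrite calabi_mapE.
rewrite [_ *: (_ / _)]mulrA [v.1 * _]mulrC.
exact.
Qed.

Hypothesis Atemp : temporal_gauge A.

(** The gauge condition concerns d/dr, which at [xs s] is the nonzero multiple 2 r^3 / s of the
    radial vector. *)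
Lemma A_radial s (k : M3) : 0 < s -> SO3 k ->
  A (xs s, k) ((0, uncplx (delta_mx 1 0)), 0) = 0.
Proof.
move=> s0 kS; have [r [r1 r4 rs]] := calabi_radius s0.
have yC : cone (r, uncplx 1%:M : CM) by split=> //; exact: SU3_1.
have := Atemp yC kS; rewrite calabi_mapE /= rs su3_act1.
have Z0 : (0 : C3)^t* = - 0 by rewrite oppr0 trmx0 map_mx0.
have := is_derive_calabi (y := (r, uncplx 1%:M)) 1 Z0 r1.
rewrite mulmx0 uncplx0 /= rs => /is_derive_val ->.
rewrite su3_act1 /ad /ad1 /comm !mul0mx !mulmx0 subrr uncplx0 mulr1.
set a := 2 * r ^+ 3 / s => H.
have a0 : a != 0 by rewrite gt_eqF // divr_gt0 // mulr_gt0 // exprn_gt0 // (lt_trans ltr01).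
have zE : E0 (xs s, k) by split=> //=; exact/TCP2_star_xs/lt0r_neq0.
have [b bE] := A_extension zE.
have E : (0 + (0, a *: uncplx (delta_mx 1 0)), 0) = a *: ((0, uncplx (delta_mx 1 0)), 0) :> E0S.
  by rewrite add0r; congr (_, _, _); rewrite /= ?scaler0.
have T := tangent_radial s0 kS.
have aT := tangent_scale a (findim_E0 R) T.
move: H; rewrite [X in A _ X]E (local_extension_at bE zE aT).
rewrite (linear_scale _ _ (local_extension_linear bE _)) => /eqP.
rewrite scaler_eq0 (negPf a0) /= => /eqP H.
by rewrite (local_extension_at bE zE T).
Qed.

(** The right-hand side is d A on the radial vector and the generator. Pulled back to the surface of
    rotations and radii, its second term differentiates A on radial vectors along an orbit, which is
    zero by the temporal gauge and invariance. *)
Lemma is_derive_alpha s X b : 0 < s -> rotgen X ->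
  local_extension (@E0 R) A (xs s, 1%:M) b ->
  is_derive s 1 (fun t => alpha t X)
  ('D_((0, uncplx (delta_mx 1 0)), 0) (b^~ (ad X (xs s), 0)) (xs s, 1%:M) -
   'D_(ad X (xs s), 0) (b^~ ((0, uncplx (delta_mx 1 0)), 0)) (xs s, 1%:M)).
Proof.
move=> s0 rX bE; have [U [oU Uz bC bl bA]] := bE.
pose O := [set p : R * R | 0 < s + p.1].
pose G (p : R * R) : E0S := (su3_act (rotation X p.2) (xs (s + p.1)), 1%:M).
have fC := findim_CM R.
have fRR := findim_prod (findim_R R) (findim_R R).
have oO : open O.
  apply: (@open_gt0 _ (fun p : R * R => s + p.1)) => p.
  by apply: cvgD; [exact: cvg_cst|exact: cvg_fst].
have GC n : Ck n O G.
  apply: Ck_pair; [by []|exact: findim_TCP|exact: findim_mx| |exact: Ck_cst].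
  apply: Ck_su3_act => //.
    apply: (@Ck_comp _ _ R _ n O setT (rotation X) snd) => //; try exact: openT.
    - exact: findim_R.
    - by apply: Ck_rotation; exact: openT.
    - by apply: Ck_linear => //; exact: findim_R.
  apply: Ck_xs => //; apply: Ck_addr => //; first exact: Ck_cst.
  by apply: Ck_linear => //; exact: findim_R.
have GE p : O p -> E0 (G p).
  move=> Op; split; rewrite /=; last exact: SO3_1.
  by apply: TCP2_star_su3_act; [exact: SU3_rotation|exact/TCP2_star_xs/lt0r_neq0].
have GT p v : O p -> tangent (@E0 R) (G p) ('D_v G p).
  by move=> Op; apply: (@tangent_line _ _ O _ G p v fRR (findim_E0 R)).
have D1 p v : is_derive p v (fun p : R * R => rotation X p.2)
    (v.2 *: uncplx (cplx (rotation X p.2) *m X)).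
  have d2 := is_derive_lin fRR (findim_R R) (l := snd) (fun _ _ _ => erefl) (is_derive_id p v).
  exact: is_derive_comp1 d2 (is_derive_rotation p.2 rX).
have D2 p v : is_derive p v (fun p : R * R => xs (s + p.1)) (0, v.1 *: uncplx (delta_mx 1 0)).
  have d1 := is_derive_lin fRR (findim_R R) (l := fst) (fun _ _ _ => erefl) (is_derive_id p v).
  have := is_deriveD (is_derive_cst s p v) d1; rewrite add0r => d.
  exact: (is_derive_xs d).
have GX p : 'D_(0, 1) G p = (su3_act (rotation X p.2) (ad X (xs (s + p.1))), 0).
  have e1 := D1 p (0, 1); rewrite scale1r in e1.
  have := is_derive_pair (findim_TCP R) (findim_mx R 2 2)
    (is_derive_su3_act (rotgen_skew rX) e1 (D2 p (0, 1))) (is_derive_cst 1%:M p (0, 1)).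
  by move=> /is_derive_val; rewrite /= scale0r addr0.
have Gr p : 'D_(1, 0) G p = (su3_act (rotation X p.2) (0, uncplx (delta_mx 1 0)), 0).
  have e1 := D1 p (1, 0); rewrite scale0r in e1.
  have Z0 : (0 : C3)^t* = - 0 by rewrite oppr0 trmx0 map_mx0.
  rewrite (_ : 0 = uncplx (cplx (rotation X p.2) *m 0)) in e1; last by rewrite mulmx0 uncplx0.
  have := is_derive_pair (findim_TCP R) (findim_mx R 2 2)
    (is_derive_su3_act Z0 e1 (D2 p (1, 0))) (is_derive_cst 1%:M p (1, 0)).
  move=> /is_derive_val; rewrite /= scale1r /ad /ad1 /comm !mul0mx !mulmx0 subrr uncplx0.
  by rewrite add0r.
have G0 : G 0 = (xs s, 1%:M) by rewrite /G /= rotation0 su3_act1 addr0.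
have GX0 : 'D_(0, 1) G 0 = (ad X (xs s), 0) by rewrite GX rotation0 su3_act1 addr0.
have Gr0 : 'D_(1, 0) G 0 = ((0, uncplx (delta_mx 1 0)), 0) by rewrite Gr rotation0 su3_act1.
have O0 : O 0 by rewrite /O /= addr0.
have UG0 : U (G 0) by rewrite G0.
have nUO : \forall p \near (0 : R * R), U (G p) /\ O p.
  near=> p; split; near: p; last exact: open_nbhs_nbhs.
  have Gc := Ck_continuous (GC 0%N) O0; exact: Gc (open_nbhs_nbhs (conj oU UG0)).
have [DX _] := is_derive_form ((1, 0) : (R * R)%type) ((0, 1) : (R * R)%type) oO oU
  (findim_E0 R) (findim_mx R 2 2) (GC 2%N) O0 UG0 (fun w => bC w 1%N) (fun y _ => bl y).
have E2 : 'D_(0, 1) (fun y => b (G y) ('D_(1, 0) G y)) 0 = 0.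
  transitivity ('D_(0, 1) (fun _ : R * R => 0 : M3) 0); last exact: derive_cst.
  apply: near_eq_derive; near=> p; have [Up Op] : U (G p) /\ O p by near: p.
  rewrite -(bA _ _ (GE p Op) Up (GT p _ Op)) Gr.
  have SX := SU3_rotation p.2 rX.
  have T := tangent_radial Op SO3_1.
  have zE : E0 (xs (s + p.1), 1%:M) by split=> //=; [exact/TCP2_star_xs/lt0r_neq0|exact: SO3_1].
  by rewrite [LHS](Ainv SX zE T); exact: A_radial Op SO3_1.
rewrite (pullback_ext_deriv oO oU (findim_E0 R) (findim_mx R 2 2) (GC 2%N) O0 Uz
  (fun w => bC w 1%N) (fun y _ => bl y) G0 Gr0 GX0 erefl E2) subr0.
have {}DX : is_derive (0 : R * R) (1, 0) (fun p => alpha (s + p.1) X)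
   ('D_(1, 0) (fun y => b (G y) ('D_(0, 1) G y)) 0).
  apply: (is_derive_near (f := fun y => b (G y) ('D_(0, 1) G y))); last by split.
  near=> p; have [Up Op] : U (G p) /\ O p by near: p.
  rewrite -(bA _ _ (GE p Op) Up (GT p _ Op)) GX.
  have := A_orbit (lt0r_neq0 Op) SO3_1 (SU3_rotation p.2 rX) (SU3_1 R) rX.
  by rewrite conj1 trmx1 mul1mx mulmx1.
have := DX => /is_derive_line0.
rewrite (_ : (fun t : R => alpha (s + (t *: (1, 0) + 0).1) X) = fun t => alpha (s + t) X); last first.
  by apply/funext => t; rewrite /= addr0 [t *: 1]mulr1.
move=> D; have := (is_derive_translate (fun t => alpha t X) s 0 1 _).2 D.
by rewrite addr0.
Unshelve. all: by end_near. Qed.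

(** The matrix generates K_0, the stabiliser of [xs s]. *)
Lemma ad_Z s : ad (Ci R *: (delta_mx 0 0 + delta_mx 1 1 - delta_mx 2 2 - delta_mx 2 2)) (xs s) = 0.
Proof.
have E m : comm (Ci R *: (delta_mx 0 0 + delta_mx 1 1 - delta_mx 2 2 - delta_mx 2 2)) (delta_mx 1 m) =
   Ci R *: (delta_mx 1 m - (delta_mx 1 m *m (delta_mx 0 0 + delta_mx 1 1 - delta_mx 2 2 - delta_mx 2 2))).
  rewrite /comm -scalemxAl -scalemxAr -scalerBr; congr (_ *: (_ - _)).
  by rewrite !(mulmxDl, mulNmx) !mul_delta_mx_cond !ord3E eqxx !mulr0n mulr1n oppr0 !addr0 add0r.
rewrite /ad /ad1 /xs cplxZ !uncplxK.
have -> (a : R[i]) (m : C3) Z : comm Z (a *: m) = a *: comm Z m.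
  by rewrite /comm -scalemxAl -scalemxAr -scalerBr.
rewrite !E !(mulmxDr, mulmxN) !mul_delta_mx_cond !ord3E !eqxx !mulr0n !mulr1n !oppr0 !addr0 !add0r.
by rewrite !subrr !scaler0 uncplx0.
Qed.

Lemma su3_act_ad (g : CM) Z x : SU3 g ->
  su3_act g (ad Z x) = ad (cplx g *m Z *m (cplx g)^t*) (su3_act g x).
Proof.
move=> gS; have gV := SU3_inv gS.
have E (y : CM) : conj_by g (cplx (ad1 Z y)) =
    ad1 (cplx g *m Z *m (cplx g)^t*) (conj_by g (cplx y)).
  rewrite /ad1 /conj_by !uncplxK /comm; apply: (congr1 (@uncplx R)).
  rewrite mulmxBr mulmxBl !mulmxA; congr (_ - _).
    by rewrite -[in RHS](mulmxA _ ((cplx g)^t*) (cplx g)) gV mulmx1.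
  by rewrite -[in RHS](mulmxA _ ((cplx g)^t*) (cplx g)) gV mulmx1.
exact: (f_equal2 pair (E x.1) (E x.2)).
Qed.

(* The element of K_0 with angle pi, acting by -1 on the sigma and mu directions. *)
Definition k0 : C3 := delta_mx 2 2 - delta_mx 0 0 - delta_mx 1 1.

Lemma trC_k0 : k0^t* = k0.
Proof. by rewrite /k0 !trC_D !trC_N !trC_delta. Qed.

Lemma SU3_k0 : SU3 (uncplx k0).
Proof.
split; rewrite uncplxK; last exact: det_k0.
by apply/unitarymxP; rewrite trC_k0; exact: sqr_k0.
Qed.

Lemma su3_act_k0 s : su3_act (uncplx k0) (xs s) = xs s.
Proof.
have E (m : C3) : k0 *m m *m k0 = m -> conj_by (uncplx k0) m = uncplx m.
  by move=> H; rewrite /conj_by uncplxK trC_k0 H.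
have [K11 K10] := k0_fixed (R[i]).
have := linear_scale s (uncplx (delta_mx 1 0)) (conj_by_linear (uncplx k0)).
by rewrite /su3_act /xs /= => ->; rewrite !uncplxK !E.
Qed.

(** [k0] fixes [xs s] and sends X to - X, so invariance gives alpha s X = - alpha s X. *)
Lemma alpha_vanish s X : s != 0 -> rotgen X -> k0 *m X *m k0 = - X -> alpha s X = 0.
Proof.
move=> s0 rX kX.
have zE : E0 (xs s, 1%:M) by split=> /=; [exact: TCP2_star_xs|exact: SO3_1].
have T := tangent_ad s0 SO3_1 rX (SU3_1 R); rewrite conj1 in T.
have [b bE] := A_extension zE.
have := Ainv SU3_k0 zE T; rewrite /= su3_act_ad ?su3_act_k0; last exact: SU3_k0.
rewrite uncplxK trC_k0 kX.
have aN : ad (- X) (xs s) = - ad X (xs s).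
  have -> : - X = (-1)%:C *: X by rewrite -[in LHS](scale1r X) -scaleNr; congr (_ *: _); apply/eqP; rewrite eq_complex /= oppr0 !eqxx.
  by rewrite adZ scaleN1r.
have TN := tangent_scale (-1) (findim_E0 R) T.
have EN : (- ad X (xs s), 0) = -1 *: (ad X (xs s), 0) :> E0S by rewrite scaleN1r; congr (_, _); rewrite /= oppr0.
rewrite aN EN (local_extension_at bE zE TN) (linear_scale _ _ (local_extension_linear bE _)).
rewrite -(local_extension_at bE zE T) scaleN1r => /eqP; rewrite -[A _ _]/(alpha s X).
rewrite eq_sym -subr_eq0 opprK -mulr2n -scaler_nat scaler_eq0 pnatr_eq0 /= => /eqP.
exact.
Qed.

(** The same choice as inside [ext_deriv], so that the exterior derivative of A at [xs s] unfolds to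
    derivatives of [b0 s]. *)
Definition b0 s := xget A [set b | local_extension (@E0 R) A (xs s, 1%:M) b].

Lemma b0P s : s != 0 -> local_extension (@E0 R) A (xs s, 1%:M) (b0 s).
Proof.
move=> s0; have zE : E0 (xs s, 1%:M) by split=> /=; [exact: TCP2_star_xs|exact: SO3_1].
by have [b bE] := A_extension zE; exact: (xgetPex A (ex_intro _ b bE)).
Qed.

(** [alpha] is linear only as far as tangency has been proved. Its version for the extension is
    real-linear in every matrix, in particular on brackets, and agrees with [alpha] on
    generators. *)
Definition alphaL s Z := b0 s (xs s, 1%:M) (ad Z (xs s), 0).

Lemma alphaL_linear s (a : R) Z Z' : s != 0 -> alphaL s (a%:C *: Z + Z') = a *: alphaL s Z + alphaL s Z'.
Proof.
move=> s0; rewrite /alphaL ad_linear_l.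
rewrite (_ : (a *: ad Z (xs s) + ad Z' (xs s), 0) =
     a *: (ad Z (xs s), 0) + (ad Z' (xs s), 0) :> E0S); last first.
  by congr (_, _); rewrite /= scaler0 addr0.
by rewrite (local_extension_linear (b0P s0)).
Qed.

Lemma realC1 : (1 : R)%:C = 1 :> R[i]. Proof. by []. Qed.

Lemma alphaLD s Z Z' : s != 0 -> alphaL s (Z + Z') = alphaL s Z + alphaL s Z'.
Proof. by move=> s0; have := alphaL_linear 1 Z Z' s0; rewrite realC1 !scale1r. Qed.

Lemma alphaLN s Z : s != 0 -> alphaL s (- Z) = - alphaL s Z.
Proof.
move=> s0; have E : alphaL s 0 = 0.
  by apply: (addrI (alphaL s 0)); rewrite -alphaLD // !addr0.
by apply: (addrI (alphaL s Z)); rewrite -alphaLD // !subrr.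
Qed.

Lemma alphaLE s X : s != 0 -> rotgen X -> alphaL s X = alpha s X.
Proof.
move=> s0 rX; have := alpha_extension s0 (b0P s0) rX (SU3_1 R).
by rewrite conj1.
Qed.

Lemma alphaL_Z s : s != 0 ->
  alphaL s (Ci R *: (delta_mx 0 0 + delta_mx 1 1 - delta_mx 2 2 - delta_mx 2 2)) = 0.
Proof.
move=> s0; rewrite /alphaL ad_Z.
exact: (linear_zero (local_extension_linear (b0P s0) _)).
Qed.

(** * Curvature in the frame dual to the coframe *)

Section Frame.
Variables (s r : R).
Hypotheses (s0 : 0 < s) (r1 : 1 < r) (r4 : r ^+ 4 = s ^+ 2 + 1) (rs : Num.sqrt (r ^+ 4 - 1) = s).

Let y : R * CM := (r, uncplx 1%:M).

(** The trivial factor is kept so that the vector matches [is_derive_calabi] at the identity. *)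
Definition fv (rho : R) (Z : C3) : R * CM := (rho, uncplx (cplx (uncplx 1%:M : CM) *m Z)).

Lemma calabi_y : calabi_map y = xs s.
Proof. by rewrite calabi_mapE /= rs su3_act1. Qed.

Lemma derive_calabi_fv rho Z : Z^t* = - Z ->
  'D_(fv rho Z) (@calabi_map R) y = ad Z (xs s) + (0, (2 * r ^+ 3 * rho / s) *: uncplx (delta_mx 1 0)).
Proof.
by move=> ZS; have := is_derive_val (is_derive_calabi (y := y) rho ZS r1); rewrite su3_act1 /= rs.
Qed.

Lemma tangent_cone_rot l X : rotgen X -> tangent (@cone R) y (fv 0 (l%:C *: X)).
Proof.
move=> rX; exists (fun t => (r, rotation X (l * t))); split.
- exists setT; split=> //; first exact: openT; last first.
    by move=> t _; split=> //=; exact: SU3_rotation.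
  move=> n; apply: Ck_pair; [exact: openT|exact: findim_R|exact: findim_CM|exact: Ck_cst|].
  apply: (@Ck_comp _ R R _ n setT setT (rotation X) (fun t => l * t)) => //; try exact: openT.
  + exact: findim_R.
  + exact: findim_CM.
  + by apply: Ck_rotation; exact: openT.
  + by apply: Ck_mulr; [exact: openT|exact: Ck_cst|exact: Ck_id].
- by rewrite mulr0 rotation0.
- apply: velocityE.
  have dl : is_derive (0 : R) 1 (fun t : R => l * t) l.
    have := is_derive_lin (findim_R R) (findim_R R) (l := fun t : R => l * t) _ (is_derive_id (0 : R) 1).
    by rewrite mulr1; apply => a u v; rewrite mulrDr; congr (_ + _); rewrite [in LHS]/GRing.scale /= mulrCA.
  have dr : is_derive (l * 0) 1 (rotation X) (uncplx X).
    by have := is_derive_rotation 0 rX; rewrite mulr0 rotation0 uncplxK mul1mx.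
  have := is_derive_pair (findim_R R) (findim_CM R) (is_derive_cst r (0 : R) 1) (is_derive_comp1 dl dr).
  by rewrite /fv uncplxK mul1mx uncplxZ.
Qed.

Lemma tangent_cone_radial rho : tangent (@cone R) y (fv rho 0).
Proof.
have oO : open [set t : R | 0 < r - 1 + t * rho].
  apply: (@open_gt0 _ (fun t : R => r - 1 + t * rho)) => t.
  by apply: cvgD; [exact: cvg_cst|apply: cvgM; [exact: cvg_id|exact: cvg_cst]].
exists (fun t => (t *: rho + r, uncplx 1%:M)); split.
- exists [set t : R | 0 < r - 1 + t * rho]; split=> //.
  + by rewrite /= mul0r addr0 subr_gt0.
  + move=> n; apply: Ck_pair => //; [exact: findim_R|exact: findim_CM| |exact: Ck_cst].
    by apply: Ck_line => //; exact: findim_R.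
  + move=> t /= H; split=> /=; last exact: SU3_1.
    by move: H; rewrite addrAC subr_gt0 addrC.
- by rewrite scale0r add0r.
- apply: velocityE; rewrite /fv mulmx0 uncplx0.
  have d : is_derive (0 : R) 1 (fun t : R => t *: rho + r) rho.
    have := is_deriveD (is_derive_scalel rho (is_derive_id (0 : R) 1)) (is_derive_cst r (0 : R) 1).
    by rewrite addr0 scale1r.
  exact: (is_derive_pair (findim_R R) (findim_CM R) d (is_derive_cst _ (0 : R) 1)).
Qed.

Lemma coframe_fv (i : 'I_8) rho Z : coframe i y (fv rho Z) =
  [:: r ^+ 2 / s * rho;
      Num.sqrt ((r ^+ 2 - 1) / 2) * complex.Re (Z 0 2); Num.sqrt ((r ^+ 2 - 1) / 2) * complex.Im (Z 0 2);
      Num.sqrt ((r ^+ 2 + 1) / 2) * complex.Re (Z 1 2); Num.sqrt ((r ^+ 2 + 1) / 2) * complex.Im (Z 1 2);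
      r * complex.Re (Z 0 1); r * complex.Im (Z 0 1);
      r^-1 * s * ((complex.Im (Z 0 0) - complex.Im (Z 1 1)) / 2)]`_i.
Proof.
have E : maurer_cartan y (fv rho Z) = Z.
  by rewrite /maurer_cartan /= !uncplxK trC_1 !mul1mx.
have E0' : Num.sqrt (r ^+ 4 / (r ^+ 4 - 1)) = r ^+ 2 / s.
  have r0 : 0 <= r by rewrite ltW // (lt_trans ltr01).
  have q0 : 0 <= r ^+ 4 - 1 by rewrite r4 addrK sqr_ge0.
  rewrite sqrtrM ?exprn_ge0 // sqrtrV // rs; congr (_ / _).
  by rewrite (exprM r 2 2) sqrtr_sqr ger0_norm // exprn_ge0.
by rewrite /coframe E /= rs E0'.
Qed.

Lemma ext_deriv_scale (z e f : E0S) (b : E0S -> E0S -> M3) (U : set E0S) l l' : open U -> U z ->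
  (forall v, Cinfty U (b^~ v)) -> (forall y, linear (b y)) ->
  'D_(l *: e) (b^~ (l' *: f)) z - 'D_(l' *: f) (b^~ (l *: e)) z =
  (l * l') *: ('D_e (b^~ f) z - 'D_f (b^~ e) z).
Proof.
move=> oU Uz bC bl.
have E (p q : R) (v w : E0S) : 'D_(p *: v) (b^~ (q *: w)) z = (p * q) *: 'D_v (b^~ w) z.
  rewrite (_ : b^~ (q *: w) = q \*: b^~ w); last first.
    by apply/funext => u; exact: (linear_scale q w (bl u)).
  have D := is_derive_scale_dir p (is_deriveZ q (Ck_is_derive v (bC w 1%N) Uz)).
  by rewrite (is_derive_val D) scalerA.
by rewrite !E scalerBr; congr (_ - _ *: _); rewrite mulrC.
Qed.

(** d A contributes minus the value on the bracket, and the quadratic term of the curvature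
    contributes the commutator of the values. *)
Lemma pulled_rot l l' X Y : rotgen X -> rotgen Y ->
  pulled_curvature A y (fv 0 (l%:C *: X)) (fv 0 (l'%:C *: Y)) =
  (l * l') *: (- alphaL s (X *m Y - Y *m X) + (alpha s X *m alpha s Y - alpha s Y *m alpha s X)).
Proof.
move=> rX rY; have sn0 := lt0r_neq0 s0.
have skew (a : R) Z : rotgen Z -> (a%:C *: Z)^t* = - (a%:C *: Z).
  by move=> rZ; rewrite trC_Z (rotgen_skew rZ) scalerN.
have E a Z : rotgen Z -> ('D_(fv 0 (a%:C *: Z)) (@calabi_map R) y, 0 : M3) = a *: (ad Z (xs s), 0) :> E0S.
  move=> rZ; rewrite derive_calabi_fv; last exact: skew.
  by rewrite mulr0 mul0r scale0r addr0 adZ; congr (_, _); rewrite /= scaler0.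
transitivity (curvature (@E0 R) A (xs s, 1%:M) (l *: (ad X (xs s), 0)) (l' *: (ad Y (xs s), 0))).
  by rewrite -(E l _ rX) -(E l' _ rY) -calabi_y.
rewrite /curvature.
have zE : E0 (xs s, 1%:M) by split=> /=; [exact: TCP2_star_xs|exact: SO3_1].
have T a Z (rZ : rotgen Z) : A (xs s, 1%:M) (a *: (ad Z (xs s), 0)) = a *: alpha s Z.
  have tZ := tangent_ad sn0 SO3_1 rZ (SU3_1 R); rewrite conj1 in tZ.
  rewrite (local_extension_at (b0P sn0) zE (tangent_scale a (findim_E0 R) tZ)).
  rewrite (linear_scale _ _ (local_extension_linear (b0P sn0) _)).
  by rewrite -[b0 s _ _]/(alphaL s Z) alphaLE.
rewrite (T l X rX) (T l' Y rY) scalerDr; congr (_ + _); last first.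
  by rewrite -!(scalemxAl, scalemxAr) !scalerA [l' * l]mulrC -scalerBr.
rewrite /ext_deriv -/(b0 s).
have [U [oU Uz bC bl _]] := b0P sn0.
rewrite (ext_deriv_scale _ _ _ _ oU Uz bC bl).
by rewrite (ext_deriv_orbit sn0 rX rY (b0P sn0)).
Qed.

(** The quadratic term vanishes because A is zero on the radial vector; the s-derivative remains. *)
Lemma pulled_radial rho l X : rotgen X ->
  pulled_curvature A y (fv rho 0) (fv 0 (l%:C *: X)) =
  (2 * r ^+ 3 * rho / s * l) *: 'D_1 (fun t => alpha t X) s.
Proof.
move=> rX; have sn0 := lt0r_neq0 s0.
have Z0 : (0 : C3)^t* = - 0 by rewrite oppr0 trmx0 map_mx0.
have E : ('D_(fv 0 (l%:C *: X)) (@calabi_map R) y, 0 : M3) = l *: (ad X (xs s), 0) :> E0S.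
  rewrite derive_calabi_fv; last by rewrite trC_Z (rotgen_skew rX) scalerN.
  by rewrite mulr0 mul0r scale0r addr0 adZ; congr (_, _); rewrite /= scaler0.
have E' : ('D_(fv rho 0) (@calabi_map R) y, 0 : M3) =
    (2 * r ^+ 3 * rho / s) *: ((0, uncplx (delta_mx 1 0)), 0) :> E0S.
  rewrite derive_calabi_fv //.
  rewrite /ad /ad1 /comm !mul0mx !mulmx0 subrr uncplx0 add0r.
  by congr ((_, _), _); rewrite /= scaler0.
transitivity (curvature (@E0 R) A (xs s, 1%:M) ((2 * r ^+ 3 * rho / s) *: ((0, uncplx (delta_mx 1 0)), 0))
    (l *: (ad X (xs s), 0))).
  by rewrite -E -E' -calabi_y.
rewrite /curvature.
have zE : E0 (xs s, 1%:M) by split=> /=; [exact: TCP2_star_xs|exact: SO3_1].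
have -> : A (xs s, 1%:M) ((2 * r ^+ 3 * rho / s) *: ((0, uncplx (delta_mx 1 0)), 0)) = 0.
  have tZ := tangent_radial s0 SO3_1.
  rewrite (local_extension_at (b0P sn0) zE (tangent_scale _ (findim_E0 R) tZ)).
  rewrite (linear_scale _ _ (local_extension_linear (b0P sn0) _)).
  by rewrite -(local_extension_at (b0P sn0) zE tZ) (A_radial s0 SO3_1) scaler0.
rewrite mul0mx mulmx0 subr0 addr0 /ext_deriv -/(b0 s).
have [U [oU Uz bC bl _]] := b0P sn0.
rewrite (ext_deriv_scale _ _ _ _ oU Uz bC bl).
by rewrite (is_derive_val (is_derive_alpha s0 rX (b0P sn0))).
Qed.

Lemma pair_entry (F : comNzRingType) (u w : F) (i j p q : 'I_3) :
  (u *: delta_mx i j + w *: delta_mx j i : 'M[F]_3) p q =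
  (if (p == i) && (q == j) then u else 0) + (if (p == j) && (q == i) then w else 0).
Proof. by rewrite !mxE; do 2!case: (_ && _); rewrite ?mulr1 ?mulr0. Qed.

Lemma diag_entry (F : comNzRingType) (u : F) (p q : 'I_3) :
  (u *: (delta_mx 0 0 - delta_mx 1 1) : 'M[F]_3) p q =
  (if (p == 0) && (q == 0) then u else 0) - (if (p == 1) && (q == 1) then u else 0).
Proof. by rewrite !mxE mulrBr; do 2!case: (_ && _); rewrite ?mulr1 ?mulr0. Qed.

(** The values of sigma_1, sigma_2, mu_1, mu_2, nu_1, nu_2 and kappa, in the order of the coframe;
    [gens] is dual to them. *)
Definition coords (Z : C3) : seq R :=
  [:: complex.Re (Z 0 2); complex.Im (Z 0 2); complex.Re (Z 1 2); complex.Im (Z 1 2);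
      complex.Re (Z 0 1); complex.Im (Z 0 1); (complex.Im (Z 0 0) - complex.Im (Z 1 1)) / 2].

Definition gens : seq C3 := [:: gR R 0 2; gI R 0 2; gR R 1 2; gI R 1 2; gR R 0 1; gI R 0 1; gK R].

Lemma coords_gens (k : 'I_7) : coords (nth 0 gens k) = [seq (j == k :> nat)%:R | j <- iota 0 7].
Proof.
have h2 : (1 + 1) / 2 = 1 :> R by rewrite divff // pnatr_eq0.
have E1 : coords (gR R 0 2) = [:: 1; 0; 0; 0; 0; 0; 0].
  by rewrite /coords /gR !pair_entry !ord3E ?eqxx /= ?(oppr0, addr0, add0r, mul0r).
have E2 : coords (gI R 0 2) = [:: 0; 1; 0; 0; 0; 0; 0].
  by rewrite /coords /gI !pair_entry !ord3E ?eqxx /= ?(oppr0, addr0, add0r, mul0r).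
have E3 : coords (gR R 1 2) = [:: 0; 0; 1; 0; 0; 0; 0].
  by rewrite /coords /gR !pair_entry !ord3E ?eqxx /= ?(oppr0, addr0, add0r, mul0r).
have E4 : coords (gI R 1 2) = [:: 0; 0; 0; 1; 0; 0; 0].
  by rewrite /coords /gI !pair_entry !ord3E ?eqxx /= ?(oppr0, addr0, add0r, mul0r).
have E5 : coords (gR R 0 1) = [:: 0; 0; 0; 0; 1; 0; 0].
  by rewrite /coords /gR !pair_entry !ord3E ?eqxx /= ?(oppr0, addr0, add0r, mul0r).
have E6 : coords (gI R 0 1) = [:: 0; 0; 0; 0; 0; 1; 0].
  by rewrite /coords /gI !pair_entry !ord3E ?eqxx /= ?(oppr0, addr0, add0r, mul0r).
have E7 : coords (gK R) = [:: 0; 0; 0; 0; 0; 0; 1].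
  by rewrite /coords /gK !diag_entry !ord3E ?eqxx /= ?(oppr0, addr0, add0r, opprK) ?h2.
by case: k => [[|[|[|[|[|[|[|//]]]]]]] ?];
  [exact: E1|exact: E2|exact: E3|exact: E4|exact: E5|exact: E6|exact: E7].
Qed.

Lemma coords_scale (l : R) Z : coords (l%:C *: Z) = [seq l * x | x <- coords Z].
Proof.
have ReE (z : R[i]) : complex.Re (l%:C * z) = l * complex.Re z by case: z => u w; rewrite /= mul0r subr0.
have ImE (z : R[i]) : complex.Im (l%:C * z) = l * complex.Im z by case: z => u w; rewrite /= mul0r addr0.
by rewrite /coords /= !mxE !ReE !ImE -mulrBr mulrA.
Qed.

Local Notation la := (Num.sqrt ((r ^+ 2 - 1) / 2)).
Local Notation lb := (Num.sqrt ((r ^+ 2 + 1) / 2)).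

(** The coefficients a, a, b, b, c, c, f of the coframe, in terms of r and s. *)
Definition lens : seq R := [:: la; la; lb; lb; r; r; r^-1 * s].

Lemma r_gt0 : 0 < r. Proof. exact: lt_trans ltr01 r1. Qed.

Lemma sqr_la : la ^+ 2 = (r ^+ 2 - 1) / 2.
Proof. by rewrite sqr_sqrtr // divr_ge0 // subr_ge0 expr_ge1 // ltW // r_gt0. Qed.

Lemma sqr_lb : lb ^+ 2 = (r ^+ 2 + 1) / 2.
Proof. by rewrite sqr_sqrtr // divr_ge0 // addr_ge0 // sqr_ge0. Qed.

Lemma la_gt0 : 0 < la.
Proof. by rewrite sqrtr_gt0 divr_gt0 // subr_gt0 expr_gt1 // ltW // r_gt0. Qed.

Lemma lb_gt0 : 0 < lb.
Proof. by rewrite sqrtr_gt0 divr_gt0 // ltr_pwDr // sqr_ge0. Qed.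

(** a^2 b^2 = (r^4 - 1) / 4 and r^4 - 1 = s^2. *)
Lemma la_lb : la * lb = s / 2.
Proof.
apply: (@pexpIrn _ 2) => //; rewrite ?nnegrE.
- by rewrite mulr_ge0 // ltW // ?la_gt0 ?lb_gt0.
- by rewrite divr_ge0 // ltW.
rewrite !exprMn sqr_la sqr_lb.
have -> : s ^+ 2 = r ^+ 4 - 1 by rewrite r4 addrK.
by field.
Qed.

Lemma lens_neq0 (k : 'I_7) : lens`_k != 0.
Proof.
have H : all (fun l => l != 0) lens.
  by rewrite /= !gt_eqF ?la_gt0 ?lb_gt0 ?r_gt0 // mulr_gt0 // invr_gt0 r_gt0.
by apply: (allP H); rewrite mem_nth.
Qed.

(** The radial factor inverts e^0 = dt = (r^2 / s) dr, the others invert the coefficients of the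
    coframe. *)
Definition frame (k : nat) : R * CM :=
  if k is k'.+1 then fv 0 ((lens`_k')^-1%:C *: nth 0 gens k') else fv (s / r ^+ 2) 0.

Lemma coframe_frame (i k : 'I_8) : coframe i y (frame k) = (i == k)%:R.
Proof.
have cE rho Z : coframe i y (fv rho Z) =
    nth 0 (r ^+ 2 / s * rho :: [seq x.1 * x.2 | x <- zip lens (coords Z)]) i.
  by rewrite coframe_fv /= !mulrA.
have r0 : r != 0 by rewrite gt_eqF // r_gt0.
case: k => [[|k] kp].
  rewrite /frame /= cE.
  have c0 : coords 0 = nseq 7 0 by rewrite /coords !mxE /= subrr mul0r.
  rewrite c0 /= !mulr0.
  case: i {cE} => [[|i] ip] /=; last by do 7!(case: i ip => [//|i ip]).
  by field; rewrite r0 gt_eqF.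
have k7 : (k < 7)%N by [].
rewrite /frame cE coords_scale (coords_gens (Ordinal k7)).
case: i {cE} => [[|i] ip]; first by rewrite /= mulr0.
have i7 : (i < 7)%N by [].
have H : nth 0 [seq x.1 * x.2 | x <- zip lens [seq (lens`_k)^-1 * x | x <- [seq (j == k)%:R | j <- iota 0 7]]] i
   = lens`_i * ((lens`_k)^-1 * (i == k)%:R).
  by do 7!(case: i ip i7 => [//|i ip i7]).
rewrite -[LHS]/(nth 0 _ i) H -[(Ordinal ip == _)]/(i == k); case: eqP => [->|_]; last by rewrite !mulr0.
by rewrite mulr1 mulfV // (lens_neq0 (Ordinal k7)).
Qed.

Lemma rotgen_gens (k : 'I_7) : rotgen (nth 0 gens k).
Proof.
by case: k => [[|[|[|[|[|[|[|//]]]]]]] ?] /=;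
  [exact: rotgen_gR|exact: rotgen_gI|exact: rotgen_gR|exact: rotgen_gI|exact: rotgen_gR
  |exact: rotgen_gI|exact: rotgen_gK].
Qed.

Lemma tangent_frame (k : 'I_8) : tangent (@cone R) y (frame k).
Proof.
case: k => [[|k] kp]; first exact: tangent_cone_radial.
exact: (tangent_cone_rot _ (rotgen_gens (Ordinal (kp : (k < 7)%N)))).
Qed.

(** Evaluation on the dual frame singles out one coefficient, so the form F in [SU4_instanton] is
    forced for indices k < l. *)
Lemma frame_component (F : 'I_8 -> 'I_8 -> M3) (k l : 'I_8) : (k < l)%N ->
  (forall u v, tangent (@cone R) y u -> tangent (@cone R) y v ->
       pulled_curvature A y u v =
       \sum_(i < 8) \sum_(j < 8 | (i < j)%N)
         (coframe i y u * coframe j y v - coframe i y v * coframe j y u) *: F i j) ->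
  F k l = pulled_curvature A y (frame k) (frame l).
Proof.
move=> kl H; rewrite (H _ _ (tangent_frame k) (tangent_frame l)).
have lk : (l == k) = false by rewrite -val_eqE gtn_eqF.
have kl' : (k == l) = false by rewrite eq_sym.
rewrite (bigD1 k) //= (bigD1 l) //= !coframe_frame !eqxx lk kl'.
rewrite mulr1 mulr0 subr0 scale1r big1 ?big1 ?addr0 //.
  move=> i ik; rewrite big1 // => j ij; rewrite !coframe_frame (negPf ik) mul0r sub0r.
  case: (i =P l) => [il|_]; last by rewrite mul0r oppr0 scale0r.
  case: (j =P k) => [jk|_]; last by rewrite mulr0 oppr0 scale0r.
  by move: ij; rewrite il jk ltnNge ltnW.
move=> j /andP[kj jl]; rewrite !coframe_frame (negPf jl) mulr0 sub0r.
by rewrite mul0r oppr0 scale0r.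
Qed.

Lemma alpha_R2 (i : 'I_3) : i != 2 -> alpha s (gR R i 2) = 0.
Proof.
move=> i2; apply: alpha_vanish; [exact: lt0r_neq0|exact: rotgen_gR|exact: k0_anti].
Qed.

Lemma alpha_I2 (i : 'I_3) : i != 2 -> alpha s (gI R i 2) = 0.
Proof.
move=> i2; apply: alpha_vanish; [exact: lt0r_neq0|exact: rotgen_gI|exact: k0_anti].
Qed.

Local Notation aK := (alpha s (gK R)).
Local Notation aN1 := (alpha s (gR R 0 1)).
Local Notation aN2 := (alpha s (gI R 0 1)).
Local Notation P k l := (pulled_curvature A y (frame k) (frame l)).

Lemma pulled_frame (k l : 'I_7) : P k.+1 l.+1 = ((lens`_k)^-1 * (lens`_l)^-1) *:
  (- alphaL s (nth 0 gens k *m nth 0 gens l - nth 0 gens l *m nth 0 gens k)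
   + (alpha s (nth 0 gens k) *m alpha s (nth 0 gens l) - alpha s (nth 0 gens l) *m alpha s (nth 0 gens k))).
Proof. exact: pulled_rot (rotgen_gens k) (rotgen_gens l). Qed.

Lemma pulled_frame0 (l : 'I_7) : P 0%N l.+1 = (2 * r / lens`_l) *: 'D_1 (fun t => alpha t (nth 0 gens l)) s.
Proof.
rewrite -[LHS]/(pulled_curvature A y (fv (s / r ^+ 2) 0) (fv 0 ((lens`_l)^-1%:C *: nth 0 gens l))).
rewrite (pulled_radial _ _ (rotgen_gens l)); congr (_ *: _).
have rn0 : r != 0 by rewrite gt_eqF // r_gt0.
have sn0 := lt0r_neq0 s0; have ln0 := lens_neq0 l; move: (lens`_l) ln0 => x xn0.
by field; rewrite rn0 sn0 xn0.
Qed.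

(** [brackets] without the K_0 component, on which [alphaL] vanishes. *)
Lemma alphaL_brackets :
  [/\ alphaL s (gR R 0 2 *m gI R 0 2 - gI R 0 2 *m gR R 0 2) = aK,
      alphaL s (gR R 1 2 *m gI R 1 2 - gI R 1 2 *m gR R 1 2) = - aK &
      alphaL s (gR R 0 1 *m gI R 0 1 - gI R 0 1 *m gR R 0 1) = aK + aK] /\
  [/\ alphaL s (gR R 0 2 *m gR R 1 2 - gR R 1 2 *m gR R 0 2) = - aN1,
      alphaL s (gI R 0 2 *m gI R 1 2 - gI R 1 2 *m gI R 0 2) = - aN1,
      alphaL s (gI R 0 2 *m gR R 1 2 - gR R 1 2 *m gI R 0 2) = - aN2 &
      alphaL s (gR R 0 2 *m gI R 1 2 - gI R 1 2 *m gR R 0 2) = aN2] /\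
  alphaL s (gR R 0 1 *m gK R - gK R *m gR R 0 1) = - (aN2 + aN2) /\
  alphaL s (gI R 0 1 *m gK R - gK R *m gI R 0 1) = aN1 + aN1.
Proof.
have sn0 := lt0r_neq0 s0.
rewrite -(alphaLE sn0 (rotgen_gK R)).
rewrite -(alphaLE sn0 (@rotgen_gR R 0 1 isT)) -(alphaLE sn0 (@rotgen_gI R 0 1 isT)).
have Z0 := alphaL_Z sn0; have D := fun u v => alphaLD u v sn0; have N := fun u => alphaLN u sn0.
have [[B12 B34 B56] [[B13 B24 B23 B14] [B57 B67]]] := brackets (mulC_i R).
split; first split.
- by rewrite [X in alphaL s X]B12 D Z0 addr0.
- by rewrite [X in alphaL s X]B34 D Z0 addr0 N.
- by rewrite [X in alphaL s X]B56 D.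
split; first split.
- by rewrite [X in alphaL s X]B13 N.
- by rewrite [X in alphaL s X]B24 N.
- by rewrite [X in alphaL s X]B23 N.
- by rewrite [X in alphaL s X]B14.
split.
- by rewrite [X in alphaL s X]B57 D !N opprD.
- by rewrite [X in alphaL s X]B67 D.
Qed.

Lemma bracket0 (c d : R) (x z l v : M3) : x = 0 -> z = 0 -> l = v -> c = d ->
  c *: (- l + (x *m z - z *m x)) = d *: (- v).
Proof. by move=> -> -> -> ->; rewrite mul0mx subr0 addr0. Qed.

Lemma bracket1 (c d : R) (x z l v : M3) : l = v -> c = d ->
  c *: (- l + (x *m z - z *m x)) = d *: (- v + (x *m z - z *m x)).
Proof. by move=> -> ->. Qed.

(** Values keep the raw form of [bracket0] and [bracket1], where the sign of d A precedes the sign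
    of the bracket; this explains the double negations. *)
Lemma curvature_components :
  [/\ [/\ P 1 2 = la ^- 2 *: - aK, P 3 4 = lb ^- 2 *: - - aK & P 5 6 = r ^- 2 *: (- (aK + aK) + (aN1 *m aN2 - aN2 *m aN1))],
      [/\ P 1 3 = (2 / s) *: - - aN1, P 2 4 = (2 / s) *: - - aN1, P 1 4 = (2 / s) *: - aN2 & P 2 3 = (2 / s) *: - - aN2],
      P 5 7 = s^-1 *: (- - (aN2 + aN2) + (aN1 *m aK - aK *m aN1)),
      P 6 7 = s^-1 *: (- (aN1 + aN1) + (aN2 *m aK - aK *m aN2)) &
     [/\ P 0 5 = 2 *: 'D_1 (fun t => alpha t (gR R 0 1)) s,
         P 0 6 = 2 *: 'D_1 (fun t => alpha t (gI R 0 1)) s &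
         P 0 7 = (2 * r ^+ 2 / s) *: 'D_1 (fun t => alpha t (gK R)) s]].
Proof.
have sn0 := lt0r_neq0 s0.
have rn0 : r != 0 by rewrite gt_eqF // r_gt0.
have iab : la^-1 * lb^-1 = 2 / s by rewrite -invfM la_lb invf_div.
have irf : r^-1 * (r^-1 * s)^-1 = s^-1 by field; rewrite rn0 sn0.
have irr : 2 * r / r = 2 by field.
have irf0 : 2 * r / (r^-1 * s) = 2 * r ^+ 2 / s by field; rewrite rn0 sn0.
have iexp (x : R) : x^-1 * x^-1 = x ^- 2 by rewrite expr2 invfM.
have S1 := alpha_R2 (isT : (0 : 'I_3) != 2); have S2 := alpha_I2 (isT : (0 : 'I_3) != 2).
have M1 := alpha_R2 (isT : (1 : 'I_3) != 2); have M2 := alpha_I2 (isT : (1 : 'I_3) != 2).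
have [[B12 B34 B56] [[B13 B24 B23 B14] [B57 B67]]] := alphaL_brackets.
have c k l (kp : (k < 7)%N) (lp : (l < 7)%N) := pulled_frame (Ordinal kp) (Ordinal lp).
have c0 l (lp : (l < 7)%N) := pulled_frame0 (Ordinal lp).
split.
- split.
  + exact: (etrans (c 0%N 1%N isT isT) (bracket0 S1 S2 B12 (iexp la))).
  + exact: (etrans (c 2%N 3%N isT isT) (bracket0 M1 M2 B34 (iexp lb))).
  + exact: (etrans (c 4%N 5%N isT isT) (bracket1 _ _ B56 (iexp r))).
- split.
  + exact: (etrans (c 0%N 2%N isT isT) (bracket0 S1 M1 B13 iab)).
  + exact: (etrans (c 1%N 3%N isT isT) (bracket0 S2 M2 B24 iab)).
  + exact: (etrans (c 0%N 3%N isT isT) (bracket0 S1 M2 B14 iab)).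
  + exact: (etrans (c 1%N 2%N isT isT) (bracket0 S2 M1 B23 iab)).
- exact: (etrans (c 4%N 6%N isT isT) (bracket1 _ _ B57 irf)).
- exact: (etrans (c 5%N 6%N isT isT) (bracket1 _ _ B67 irf)).
- split.
  + exact: (etrans (c0 4%N isT) (congr1 (fun c => c *: 'D_1 (fun t => alpha t (gR R 0 1)) s) irr)).
  + exact: (etrans (c0 5%N isT) (congr1 (fun c => c *: 'D_1 (fun t => alpha t (gI R 0 1)) s) irr)).
  + exact: (etrans (c0 6%N isT) (congr1 (fun c => c *: 'D_1 (fun t => alpha t (gK R)) s) irf0)).
Qed.

Lemma eq_opp0 (x : M3) : x = - x -> x = 0.
Proof.
move=> /eqP; rewrite eq_sym -subr_eq0 -opprD oppr_eq0 -mulr2n -scaler_nat scaler_eq0 pnatr_eq0 /=.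
by move=> /eqP.
Qed.

(** With q = r^2, k' is - s / (2 q) times (a^-2 + b^-2 + 2 / q) k. Since s^2 = q^2 - 1, the first
    two terms add up to 4 q / s^2, and q^2 = s^2 + 1 rewrites the last. *)
Lemma ode_coefficient (k k' : R) :
  la ^- 2 * - k = lb ^- 2 * - - k - r ^- 2 * - (k + k) + 2 * r ^+ 2 / s * k' ->
  k' = - (2 / s + s / (s ^+ 2 + 1)) * k.
Proof.
rewrite sqr_la sqr_lb -r4 (exprM r 2 2).
have : s ^+ 2 = (r ^+ 2 - 1) * (r ^+ 2 + 1).
  by rewrite -[LHS](addrK 1) -r4 (exprM r 2 2); ring.
have : r ^+ 2 - 1 != 0 by rewrite subr_eq0 gt_eqF // expr_gt1 // ltW // r_gt0.
have : r ^+ 2 + 1 != 0 by rewrite gt_eqF // ltr_pwDr // sqr_ge0.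
have : r ^+ 2 != 0 by rewrite expf_neq0 // gt_eqF // r_gt0.
move: (r ^+ 2) (lt0r_neq0 s0) => q sn0 qn0 q1 q2 sq E.
have {}E : k' = s / (2 * q) * (- k / ((q - 1) / 2) - k / ((q + 1) / 2) - 2 * k / q).
  have -> : k' = s / (2 * q) * (2 * q / s * k') by field; rewrite qn0 sn0.
  congr (_ * _); rewrite -[LHS](addKr (((q + 1) / 2)^-1 * - - k - q^-1 * - (k + k))) -E.
  by field; rewrite qn0 q1 q2.
have H : (q - 1)^-1 + (q + 1)^-1 = 2 * q / s ^+ 2 by rewrite sq; field; rewrite q1 q2.
rewrite E; transitivity (- (s / (2 * q)) * 2 * ((q - 1)^-1 + (q + 1)^-1 + q^-1) * k).
  by field; rewrite qn0 q1 q2.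
by rewrite H; field; rewrite sn0 qn0.
Qed.

Lemma lens_sum_neq0 : la ^- 2 + lb ^- 2 != 0.
Proof. by rewrite gt_eqF // addr_gt0 // invr_gt0 exprn_gt0 ?la_gt0 ?lb_gt0. Qed.

Lemma two_div_neq0 : 2 / s != 0.
Proof. by rewrite mulf_neq0 ?invr_eq0 ?pnatr_eq0 // lt0r_neq0. Qed.

Lemma scale_eq_opp (c : R) (x : M3) : c != 0 -> c *: x = c *: - x -> x = 0.
Proof. by move=> cn0 /(scalerI cn0)/eq_opp0. Qed.

(** The first two relations kill N1 and N2, hence also the commutator, and the third becomes a
    linear equation for each entry. *)
Lemma algebra_I (K N1 N2 K' : M3) :
  (2 / s) *: - - N1 = - ((2 / s) *: - - N1) -> (2 / s) *: - N2 = (2 / s) *: - - N2 ->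
  la ^- 2 *: - K = lb ^- 2 *: - - K - r ^- 2 *: (- (K + K) + (N1 *m N2 - N2 *m N1))
    + (2 * r ^+ 2 / s) *: K' ->
  [/\ N1 = 0, N2 = 0 & K' = - (2 / s + s / (s ^+ 2 + 1)) *: K].
Proof.
rewrite (opprK N1) (opprK N2) -scalerN => /(scale_eq_opp two_div_neq0) -> /esym/(scale_eq_opp two_div_neq0) ->.
rewrite !mul0mx ?mulmx0 subr0 addr0 => E; split=> //.
by apply/matrixP => p q; have := congr1 (fun m : M3 => m p q) E; rewrite !mxE => /ode_coefficient.
Qed.

Lemma lens_vanish (K : M3) : la ^- 2 *: - K = lb ^- 2 *: - - K -> K = 0.
Proof.
move=> /eqP; rewrite -subr_eq0 !scalerN opprK -opprD oppr_eq0 -scalerDl.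
by rewrite scaler_eq0 (negPf lens_sum_neq0) => /eqP.
Qed.

(** Once N1 and K vanish, the third relation reads - (2/s) N2 = (2/s) N2 + (2/s) N2 + 2 N', which is
    the origin of the factor 3. *)
Lemma algebra_J (K N1 N2 N' : M3) :
  (2 / s) *: - - N1 = - ((2 / s) *: - - N1) -> la ^- 2 *: - K = lb ^- 2 *: - - K ->
  (2 / s) *: - N2 = (2 / s) *: - - N2 + s^-1 *: (- - (N2 + N2) + (N1 *m K - K *m N1)) + 2 *: N' ->
  [/\ N1 = 0, K = 0 & N' = - (3 / s) *: N2].
Proof.
rewrite [- - N1]opprK -scalerN => /(scale_eq_opp two_div_neq0) -> /lens_vanish ->.
rewrite !mul0mx ?mulmx0 subr0 addr0 => E; split=> //.
apply/matrixP => p q; have := congr1 (fun m : M3 => m p q) E; rewrite !mxE.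
move: (N2 p q) (N' p q) (lt0r_neq0 s0) => k k' sn0 e.
have -> : k' = 2^-1 * (2 / s * - k - (2 / s * - - k + s^-1 * - - (k + k)) : R).
  by rewrite e [X in 2^-1 * X]addrAC subrr add0r mulKf ?pnatr_eq0.
by field.
Qed.

Lemma algebra_K (K N1 N2 N' : M3) :
  (2 / s) *: - N2 = (2 / s) *: - - N2 -> la ^- 2 *: - K = lb ^- 2 *: - - K ->
  (2 / s) *: - - N1 = - ((2 / s) *: - - N1) + s^-1 *: (- (N1 + N1) + (N2 *m K - K *m N2)) - 2 *: N' ->
  [/\ N2 = 0, K = 0 & N' = - (3 / s) *: N1].
Proof.
rewrite [- - N2]opprK => /esym/(scale_eq_opp two_div_neq0) -> /lens_vanish ->.
rewrite !mul0mx ?mulmx0 subr0 addr0 => E; split=> //.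
apply/matrixP => p q; have := congr1 (fun m : M3 => m p q) E; rewrite !mxE.
move: (N1 p q) (N' p q) (lt0r_neq0 s0) => k k' sn0 e.
have -> : k' = 2^-1 * (- (2 / s * - - k) + s^-1 * - (k + k) - 2 / s * - - k).
  have solve (u w z : R) : u = - u + w - z -> - u + w - u = z by move=> {}e; rewrite {2}e subKr.
  by rewrite (solve _ _ _ e) mulKf ?pnatr_eq0.
by field.
Qed.

(** [two_form] reads only coefficients with increasing indices, and these are the frame components
    of the curvature. *)
Lemma instanton_hodge L : SU4_instanton L A -> hodge_equation (fun k l : 'I_8 => P k l) L.
Proof.
move=> /(_ y); case; first by split=> //=; exact: SU3_1.
move=> F [HF hF]; rewrite /hodge_equation.
have <- : two_form F = two_form (fun k l : 'I_8 => P k l); last exact: hF.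
apply/ffunP => S; rewrite !ffunE; apply: eq_bigr => k _; apply: eq_bigr => l kl.
by rewrite (frame_component kl HF).
Qed.

Lemma ode_I : SU4_instanton cI A -> [/\ aN1 = 0, aN2 = 0 &
  'D_1 (fun t => alpha t (gK R)) s = - (2 / s + s / (s ^+ 2 + 1)) *: aK].
Proof.
move=> /instanton_hodge H.
have [H1 H2 H3] : [/\ P 1 3 = - P 2 4, P 1 4 = P 2 3 & P 1 2 = P 3 4 - P 5 6 + P 0 7] := hodge_I H.
have [[P12 P34 P56] [P13 P24 P14 P23] _ _ [_ _ P07]] := curvature_components.
exact: (algebra_I (etrans (esym P13) (etrans H1 (congr1 -%R P24))) (etrans (esym P14) (etrans H2 P23))
  (etrans (esym P12) (etrans H3 (f_equal2 +%R (f_equal2 (fun a b => a - b) P34 P56) P07)))).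
Qed.

Lemma ode_J : SU4_instanton cJ A -> [/\ aN1 = 0, aK = 0 &
  'D_1 (fun t => alpha t (gI R 0 1)) s = - (3 / s) *: aN2].
Proof.
move=> /instanton_hodge H.
have [H1 H2 H3] : [/\ P 1 3 = - P 2 4, P 1 2 = P 3 4 & P 1 4 = P 2 3 + P 5 7 + P 0 6] := hodge_J H.
have [[P12 P34 _] [P13 P24 P14 P23] P57 _ [_ P06 _]] := curvature_components.
exact: (algebra_J (etrans (esym P13) (etrans H1 (congr1 -%R P24))) (etrans (esym P12) (etrans H2 P34))
  (etrans (esym P14) (etrans H3 (f_equal2 +%R (f_equal2 +%R P23 P57) P06)))).
Qed.

Lemma ode_K : SU4_instanton cK A -> [/\ aN2 = 0, aK = 0 &
  'D_1 (fun t => alpha t (gR R 0 1)) s = - (3 / s) *: aN1].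
Proof.
move=> /instanton_hodge H.
have [H1 H2 H3] : [/\ P 1 4 = P 2 3, P 1 2 = P 3 4 & P 1 3 = - P 2 4 + P 6 7 - P 0 5] := hodge_K H.
have [[P12 P34 _] [P13 P24 P14 P23] _ P67 [P05 _ _]] := curvature_components.
exact: (algebra_K (etrans (esym P14) (etrans H1 P23)) (etrans (esym P12) (etrans H2 P34))
  (etrans (esym P13) (etrans H3 (f_equal2 (fun a b => a - b) (f_equal2 +%R (congr1 -%R P24) P67) P05)))).
Qed.

End Frame.

(** * Curvature of an extension near the zero section *)

Section Extension.
Variables (W : normedModType R) (P : set W) (p : W -> CM * CM) (act : W -> M3 -> W) (theta : W -> W -> M3).
Hypotheses (fW : findim W) (Pb : principal_bundle (@TCP2 R) P p act) (Pc : principal_connection P act theta)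
  (Piso : bundle_connection_iso (@E0 R) (@E0_proj R) (@E0_act R) A
          (P `&` p @^-1` (@TCP2_star R)) p act theta).

Lemma xs_cvg : xs s @[s --> (0 : R)] --> xs 0.
Proof. exact: (Ck_continuous (Ck_xs openT (Ck_id 0 setT)) (I : setT (0 : R))). Qed.

Lemma ad_xs_cvg X : ad X (xs s) @[s --> (0 : R)] --> ad X (xs 0).
Proof.
have fT := findim_TCP R.
apply: (cvg_comp _ _ xs_cvg); exact: (linear_continuous_findim fT fT (@ad_linear_r R X)).
Qed.

Section Lift.
Variables (Phi : E0S -> W).
Hypotheses (PhiS : smooth_on (@E0 R) Phi) (PhiP : forall z, E0 z -> P (Phi z) /\ p (Phi z) = z.1)
  (PhiA : forall c : R -> E0S, smooth_curve (@E0 R) c ->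
     theta (Phi (c 0)) (velocity (Phi \o c)) = A (c 0) (velocity c)).

(** [Phi] is smooth only in the sense of [smooth_on]. Composing the orbit surface with a local
    smooth representative of [Phi] yields a smooth map G into P to which [pullback_ext_deriv]
    applies and along which theta is A. *)
Lemma orbit_lift (s : R) (k : M3) X Y : s != 0 -> SO3 k -> rotgen X -> rotgen Y ->
  exists (O : set (R * R)) (G : R * R -> W),
  [/\ open O, O 0, (forall n, Ck n O G),
     (forall y, O y -> P (G y) /\ p (G y) = (orbit2 s k X Y y).1) &
     G 0 = Phi (xs s, k)] /\
  forall y v, O y -> tangent P (G y) ('D_v G y) /\
     theta (G y) ('D_v G y) = A (orbit2 s k X Y y) ('D_v (orbit2 s k X Y) y).
Proof.
move=> s0 kS rX rY; set orb := orbit2 s k X Y.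
have orb0 : orb 0 = (xs s, k).
  by rewrite /orb /orbit2 /= !rotation0 /cmul uncplxK mul1mx su3_act1.
have orbE y : E0 (orb y) by exact: E0_orbit2.
have fRR := findim_prod (findim_R R) (findim_R R).
have fE := findim_E0 R.
have [Om [Ph [oO' O'e PhC PhE]]] := PhiS (orbE 0).
have oO := open_preimage openT (Ck_orbit2 s k X Y 0) oO'.
set O := setT `&` _ in oO.
have GE y : O y -> Ph (orb y) = Phi (orb y) by move=> [_ Oy]; rewrite PhE.
have GC n : Ck n O (Ph \o orb).
  apply: (Ck_comp oO oO' fE fW _ (PhC n)); first by move=> y [].
  by apply: Ck_subset (Ck_orbit2 s k X Y n).
have GP y : O y -> P ((Ph \o orb) y) by move=> Oy; rewrite /= GE //; have [] := PhiP (orbE y).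
exists O, (Ph \o orb); split; first split=> //.
- by move=> y Oy; split; [exact: GP|rewrite /= GE //; have [] := PhiP (orbE y)].
- by rewrite /= GE // orb0.
move=> y v Oy; split; first exact: (tangent_line v fRR fW oO GC GP Oy).
have cS : smooth_curve (@E0 R) (fun t : R => orb (t *: v + y)).
  exact: (@smooth_curve_line _ _ setT _ orb y v fRR fE openT (Ck_orbit2 s k X Y) (fun y _ => orbE y) I).
have := PhiA cS; rewrite scale0r add0r velocity_line /= GE // => <-; congr (theta _ _).
transitivity (velocity (fun t : R => (Ph \o orb) (t *: v + y))); first exact/esym/velocity_line.
have oL := open_line (y := y) (v := v) oO.
have L0 : [set t : R | O (t *: v + y)] 0 by rewrite /= scale0r add0r.
by apply: velocity_near; apply: (filterS _ (open_nbhs_nbhs (conj oL L0))) => t /GE.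
Qed.

End Lift.

(** As [alpha] vanishes on X and Y, the velocities of the image of the orbit surface at the origin
    are the horizontal lifts of [ad X (xs s)] and [ad Y (xs s)]. The value of [hcurv] on them is
    continuous in s up to s = 0. *)
Lemma extension_curvature X Y : rotgen X -> rotgen Y ->
  exists (N : R -> M3) (N0 : M3), N s @[s --> (0 : R)] --> N0 /\
  \forall s \near (0 : R), 0 < s -> alpha s X = 0 -> alpha s Y = 0 ->
    exists2 k : M3, SO3 k & k^T *m alphaL s (X *m Y - Y *m X) *m k = N s.
Proof.
move=> rX rY; have fT := findim_TCP R; have fM := findim_mx R 2 2.
have fE := findim_E0 R; have fRR := findim_prod (findim_R R) (findim_R R).
have [U [Om [N [T [beta [[[oU U0] [oO O0] [oN N0]] TC [bC bl] bE liftE]]]]]] :=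
  bundle_gauge fT fW Pb Pc (TCP2_xs 0).
exists (fun s => - hcurv T beta (xs s) (ad X (xs s)) (ad Y (xs s))).
exists (- hcurv T beta (xs 0) (ad X (xs 0)) (ad Y (xs 0))); split.
  by apply: cvgN; apply: (cvg_hcurv fT fW oO TC bl oN bC _ O0 N0 xs_cvg); exact: ad_xs_cvg.
have nU : \forall s \near (0 : R), U (xs s) by apply: xs_cvg; exact: open_nbhs_nbhs.
have cO : (xs s, 1%:M : M3) @[s --> (0 : R)] --> (xs 0, 1%:M : M3).
  by apply: cvg_pair_cst; exact: xs_cvg.
have cN : T (xs s, 1%:M) @[s --> (0 : R)] --> T (xs 0, 1%:M).
  exact: (cvg_comp _ _ cO (Ck_continuous (TC 0%N) O0)).
have nO : \forall s \near (0 : R), Om (xs s, 1%:M) by apply: cO; exact: open_nbhs_nbhs.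
have nN : \forall s \near (0 : R), N (T (xs s, 1%:M)) by apply: cN; exact: open_nbhs_nbhs.
near=> s => s0 aX aY; have sn0 := lt0r_neq0 s0.
have [Phi [Psi [[PhiS _] PhiP PsiP _ PhiA]]] := Piso.
have Us : U (xs s) by near: s.
have Os : Om (xs s, 1%:M) by near: s.
have Ns : N (T (xs s, 1%:M)) by near: s.
have [Pz pz lift] := liftE _ (TCP2_xs s) Us Os Ns.
have PhiP' z : E0 z -> P (Phi z) /\ p (Phi z) = z.1 by move=> /PhiP[[]].
(* The isomorphism is onto over the complement of the zero section, so the reference point T(xs s,
   1) has a preimage; [k] is its fibre coordinate. *)
have [[x k] Ez eE] : exists2 e : E0S, E0 e & Phi e = T (xs s, 1%:M).
  have [] := PsiP (T (xs s, 1%:M)); last by exists (Psi (T (xs s, 1%:M))).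
  by split=> //=; rewrite pz; exact: TCP2_star_xs.
have xE : x = xs s by have [_ H] := PhiP' _ Ez; rewrite -[LHS]H eE.
rewrite xE in Ez eE; have kS : SO3 k by case: Ez.
exists k => //.
have [W0 [G [[oW W00 GC GP G0] GA]]] := orbit_lift PhiS PhiP' PhiA sn0 kS rX rY.
rewrite eE in G0.
have A1 : A (orbit2 s k X Y 0) ('D_(1, 0) (orbit2 s k X Y) 0) = 0.
  by rewrite A_orbit2_l // rotation0 conj1 aX mulmx0 mul0mx.
have A2 y : A (orbit2 s k X Y y) ('D_(0, 1) (orbit2 s k X Y) y) = 0.
  by rewrite A_orbit2_r // aY mulmx0 mul0mx.
have D1 : 'D_(1, 0) (orbit2 s k X Y) 0 = (ad X (xs s), 0).
  by rewrite derive_orbit2_l // !rotation0 conj1 /cmul uncplxK mul1mx su3_act1.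
have D2 : 'D_(0, 1) (orbit2 s k X Y) 0 = (ad Y (xs s), 0).
  by rewrite derive_orbit2_r // !rotation0 /cmul uncplxK mul1mx su3_act1.
(* A horizontal velocity over xi has to be the horizontal lift of xi. *)
have GL v xi : 'D_v (orbit2 s k X Y) 0 = (xi, 0) -> A (orbit2 s k X Y 0) ('D_v (orbit2 s k X Y) 0) = 0 ->
    'D_v G 0 = hlift T beta (xs s) xi.
  move=> Dv Av.
  have GPW y : W0 y -> P (G y) by move=> /GP[].
  have cS := smooth_curve_line v fRR fW oW GC GPW W00.
  have cE : velocity (fun t : R => G (t *: v + 0)) = 'D_v G 0 := velocity_line G 0 v.
  rewrite -cE; apply: lift => //.
  - by rewrite scale0r add0r.
  - by rewrite cE scale0r add0r (GA _ v W00).2.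
  have oL := open_line (y := 0) (v := v) oW.
  have L0 : [set t : R | W0 (t *: v + 0)] 0 by rewrite /= scale0r add0r.
  have oc : is_derive (0 : R) 1 (fun t : R => orbit2 s k X Y (t *: v + 0)) (xi, 0).
    rewrite -Dv; apply/(is_derive_line0 (orbit2 s k X Y) 0 v).
    exact: (Ck_is_derive v (Ck_orbit2 s k X Y 1) I).
  apply: (is_derive_near _ (is_derive_lin fE fT (l := fst) (fun _ _ _ => erefl) oc)).
  by apply: (filterS _ (open_nbhs_nbhs (conj oL L0))) => t /GP[_ /= ->].
have G1 := GL _ _ D1 A1.
have G2 := GL _ _ D2 (A2 0).
have WN : nbhs (0 : R * R) (W0 `&` G @^-1` N).
  apply: filterI; first exact: open_nbhs_nbhs.
  have NG0 : N (G 0) by rewrite G0.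
  exact: (Ck_continuous (GC 0%N) W00) (open_nbhs_nbhs (conj oN NG0)).
(* A vanishes on the second velocity near the origin too, so its derivative along the first is
   zero. *)
have E1 : 'D_(1, 0) (fun y => beta (G y) ('D_(0, 1) G y)) 0 = 0.
  transitivity ('D_(1, 0) (fun _ : R * R => 0 : M3) (0 : R * R)); last exact: derive_cst.
  apply: near_eq_derive; apply: filterS WN => y [Wy Ny].
  have [GT GE] := GA y (0, 1) Wy.
  exact: (etrans (esym (bE _ _ (GP y Wy).1 Ny GT)) (etrans GE (A2 y))).
have E2 : 'D_(0, 1) (fun y => beta (G y) ('D_(1, 0) G y)) 0 =
    k^T *m alphaL s (X *m Y - Y *m X) *m k.
  rewrite -[RHS](is_derive_val (is_derive_A_orbit2 sn0 kS rX rY (b0P sn0))).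
  apply: near_eq_derive; apply: filterS WN => y [Wy Ny].
  have [GT GE] := GA y (1, 0) Wy.
  exact: (etrans (esym (bE _ _ (GP y Wy).1 Ny GT)) GE).
have := pullback_ext_deriv oW oN fW fM (GC 2%N) W00 Ns (fun w => bC w 1%N) (fun y _ => bl y)
  G0 G1 G2 E1 E2.
by rewrite /hcurv => ->; rewrite sub0r opprK.
Unshelve. all: by end_near. Qed.

Lemma is_derive_alpha_entry (s c : R) X (p' q' : 'I_3) : 0 < s -> rotgen X ->
  'D_1 (fun t => alpha t X) s = c *: alpha s X ->
  is_derive s 1 (fun t => alpha t X p' q') (c * alpha s X p' q').
Proof.
move=> s0 rX E; have fM := findim_mx R 2 2.
have D := is_derive_alpha s0 rX (b0P (lt0r_neq0 s0)).
have l : linear (fun m : M3 => m p' q' : R) by move=> a u v; rewrite !mxE.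
have := is_derive_lin fM (findim_R R) l D.
by rewrite -(is_derive_val D) E mxE.
Qed.

(* As alpha(s, X) = alpha(s, Y) = 0, the (X, Y)-component of the curvature is - e alpha(s, Z); it stays
   bounded as s -> 0 because A extends, so the constant phi |alpha(., Z)|^2 is zero. *)
Lemma extension_vanish (phi q : R -> R) (e : R) X Y Z : e != 0 -> rotgen X -> rotgen Y -> rotgen Z ->
  (forall s : R, 0 < s -> [/\ alpha s X = 0, alpha s Y = 0, alphaL s (X *m Y - Y *m X) = e *: alpha s Z &
     'D_1 (fun t => alpha t Z) s = - q s *: alpha s Z]) ->
  (forall s : R, 0 < s -> is_derive s 1 phi (2 * q s * phi s)) ->
  (forall s : R, 0 < s -> 0 < phi s) -> (forall s : R, 0 < s -> s <= 1 -> phi s <= 2 * s) ->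
  forall s : R, 0 < s -> alpha s Z = 0.
Proof.
move=> e0 rX rY rZ H phid phi0 phi2 s s0; apply/matrixP => i j; rewrite mxE.
have [N [N0 [NN near_N]]] := extension_curvature rX rY.
have nF : \forall s \near (0 : R), frob (N s) < frob N0 + 1.
  have F0 : frob (N s) @[s --> (0 : R)] --> frob N0 by apply: (cvg_comp _ _ NN); exact: frob_continuous.
  have nbhsF : nbhs (frob N0) [set t : R | t < frob N0 + 1].
    by apply: open_nbhs_nbhs; split; [exact: open_lt|rewrite /= ltrDl].
  exact: (F0 _ nbhsF).
(* frob N0 + 1 bounds the curvature near s = 0; division by e^2 turns this into a bound on the
   squared entry of [alpha]. *)
apply: (@decay (fun s => alpha s Z i j) phi q (e ^- 2 * (frob N0 + 1))) => //.
  by move=> t t0; have [_ _ _ E] := H t t0; exact: is_derive_alpha_entry.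
near=> t => t0; have [aX aY aZ _] := H t t0.
have [k kS kE] : exists2 k : M3, SO3 k & k^T *m alphaL t (X *m Y - Y *m X) *m k = N t.
  by move: t0 aX aY; near: t.
have Nt : frob (N t) < frob N0 + 1 by near: t.
rewrite mulrC ler_pdivlMr ?exprn_even_gt0 // -exprMn mulrC.
apply: le_trans (ltW Nt); rewrite -kE frob_conj // aZ.
by have := entry_le_frob (e *: alpha t Z) i j; rewrite mxE.
Unshelve. all: by end_near. Qed.
End Extension.

Lemma is_derive_monomial (n : nat) (s : R) :
  is_derive s 1 (fun t : R => t ^+ n) (n%:R * s ^+ n.-1).
Proof.
have := is_deriveX n (is_derive_id s (1 : R)).
by rewrite exprfctE => D; apply: (is_derive_eq D); rewrite [LHS]mulr1.
Qed.

(** The integrating factor for the square of a solution of the equation in [ode_I]. *)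
Lemma is_derive_phi_I (s : R) : 0 < s ->
  is_derive s 1 (fun t : R => t ^+ 4 * (t ^+ 2 + 1))
   (2 * (2 / s + s / (s ^+ 2 + 1)) * (s ^+ 4 * (s ^+ 2 + 1))).
Proof.
move=> s0; have sn0 := lt0r_neq0 s0.
have q0 : s ^+ 2 + 1 != 0 by rewrite gt_eqF // ltr_wpDl // sqr_ge0.
have D := is_deriveM (is_derive_monomial 4 s)
  (is_deriveD (is_derive_monomial 2 s) (is_derive_cst (1 : R) s (1 : R))).
apply: (is_derive_eq D).
transitivity (s ^+ 4 * (2 * s ^+ 1 + 0) + (s ^+ 2 + 1) * (4 * s ^+ 3)) => //.
by field; rewrite sn0 q0.
Qed.

Lemma is_derive_phi_JK (s : R) : 0 < s ->
  is_derive s 1 (fun t : R => t ^+ 6) (2 * (3 / s) * s ^+ 6).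
Proof.
move=> s0; have sn0 := lt0r_neq0 s0.
by apply: (is_derive_eq (is_derive_monomial 6 s)); field.
Qed.

(** X and Y are taken among the directions killed by the stabiliser argument, with bracket equal, up
    to sign and modulo K_0, to the surviving generator: sigma_1 and sigma_2 for I, sigma_2 and mu_1
    for J, sigma_1 and mu_1 for K. *)
Lemma extension_alpha L : SU4_instanton L A -> extends_across_zero_section A ->
  forall s : R, 0 < s ->
  [/\ alpha s (gK R) = 0, alpha s (gR R 0 1) = 0 & alpha s (gI R 0 1) = 0].
Proof.
move=> Ainst [n [P [p [act [theta [Pb Pc Piso]]]]]] s s0.
have fW := findim_mx R 0 n.
have r02 := @rotgen_gR R 0 2 isT; have i02 := @rotgen_gI R 0 2 isT.
have r12 := @rotgen_gR R 1 2 isT; have r01 := @rotgen_gR R 0 1 isT.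
have i01 := @rotgen_gI R 0 1 isT.
have phi6 (t : R) : 0 < t -> 0 < t ^+ 6 by move=> t0; rewrite exprn_gt0.
have phi6' (t : R) : 0 < t -> t <= 1 -> t ^+ 6 <= 2 * t.
  move=> t0 t1; have t0' := ltW t0; apply: (@le_trans _ _ t); last by rewrite ler_peMl // ler1n.
  by rewrite exprS ler_piMr // exprn_ile1.
have m1 : -1 != 0 :> R by rewrite oppr_eq0 oner_eq0.
case: L Ainst => Ainst.
- have H (t : R) : 0 < t -> [/\ alpha t (gR R 0 1) = 0, alpha t (gI R 0 1) = 0 &
    'D_1 (fun t => alpha t (gK R)) t = - (2 / t + t / (t ^+ 2 + 1)) *: alpha t (gK R)].
    by move=> t0; have [r [r1 r4 rs]] := calabi_radius t0; exact: (ode_I t0 r1 r4 rs Ainst).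
  have [N1 N2 _] := H s s0; split; [|exact: N1|exact: N2].
  apply: (extension_vanish fW Pb Pc Piso (oner_neq0 R) r02 i02 (rotgen_gK R) _ is_derive_phi_I _ _ s0).
  + move=> t t0; have [_ _ E] := H t t0.
    have [[E' _ _] _] := alphaL_brackets t0; rewrite scale1r.
    exact: And4 (alpha_R2 t0 (isT : (0 : 'I_3) != 2)) (alpha_I2 t0 (isT : (0 : 'I_3) != 2)) E' E.
  + by move=> t t0; rewrite mulr_gt0 ?exprn_gt0 // ltr_wpDl // sqr_ge0.
  + move=> t t0 t1; have t0' := ltW t0; rewrite mulrC ler_pM ?exprn_ge0 //.
    * by rewrite addr_ge0 // sqr_ge0.
    * by rewrite -[2]/(1 + 1) lerD // exprn_ile1.
    * by rewrite exprS ler_piMr // exprn_ile1.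
- have H (t : R) : 0 < t -> [/\ alpha t (gR R 0 1) = 0, alpha t (gK R) = 0 &
    'D_1 (fun t => alpha t (gI R 0 1)) t = - (3 / t) *: alpha t (gI R 0 1)].
    by move=> t0; have [r [r1 r4 rs]] := calabi_radius t0; exact: (ode_J t0 r1 r4 rs Ainst).
  have [N1 K0 _] := H s s0; split; [exact: K0|exact: N1|].
  apply: (extension_vanish fW Pb Pc Piso m1 i02 r12 i01 _ is_derive_phi_JK phi6 phi6' s0).
  move=> t t0; have [_ _ E] := H t t0.
  have [_ [[_ _ E' _] _]] := alphaL_brackets t0; rewrite scaleN1r.
  exact: And4 (alpha_I2 t0 (isT : (0 : 'I_3) != 2)) (alpha_R2 t0 (isT : (1 : 'I_3) != 2)) E' E.
- have H (t : R) : 0 < t -> [/\ alpha t (gI R 0 1) = 0, alpha t (gK R) = 0 &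
    'D_1 (fun t => alpha t (gR R 0 1)) t = - (3 / t) *: alpha t (gR R 0 1)].
    by move=> t0; have [r [r1 r4 rs]] := calabi_radius t0; exact: (ode_K t0 r1 r4 rs Ainst).
  have [N2 K0 _] := H s s0; split; [exact: K0| |exact: N2].
  apply: (extension_vanish fW Pb Pc Piso m1 r02 r12 r01 _ is_derive_phi_JK phi6 phi6' s0).
  move=> t t0; have [_ _ E] := H t t0.
  have [_ [[E' _ _ _] _]] := alphaL_brackets t0; rewrite scaleN1r.
  exact: And4 (alpha_R2 t0 (isT : (0 : 'I_3) != 2)) (alpha_R2 t0 (isT : (1 : 'I_3) != 2)) E' E.
Qed.

Lemma tangent_E0_su3_act (g : CM) (z v : E0S) : SU3 g -> tangent (@E0 R) z v ->
  tangent (@E0 R) (su3_act g z.1, z.2) (su3_act g v.1, v.2).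
Proof.
move=> gS [c [cS c0 cv]]; have fE := findim_E0 R.
have l : linear (fun z : E0S => (su3_act g z.1, z.2) : E0S).
  by move=> a x y; rewrite /= su3_act_linear.
have D := smooth_curve_is_derive cS; rewrite cv in D.
have [I [oI I0 Ic IE]] := cS.
exists (fun t => (su3_act g (c t).1, (c t).2)); split.
- exists I; split=> //; last by move=> t /IE; exact: E0_su3_act.
  by move=> k; apply: (Ck_linear_comp oI fE fE l (Ic k)).
- by rewrite c0.
- exact: velocityE (is_derive_lin fE fE l D).
Qed.

(** * A connection vanishing on all generators is canonical *)

Section ZeroGenerators.
Hypothesis alpha0 : forall s : R, 0 < s ->
  [/\ alpha s (gK R) = 0, alpha s (gR R 0 1) = 0 & alpha s (gI R 0 1) = 0].

(** Rewrites a skew-Hermitian pair with real coefficients, the scalars over which [alphaL] is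
    linear. *)
Lemma pair_gens (a : R[i]) (i j : 'I_3) :
  a *: delta_mx i j + (- Num.conj a) *: delta_mx j i =
  (complex.Re a)%:C *: gR R i j + (complex.Im a)%:C *: gI R i j.
Proof.
rewrite /gR /gI !scalerDr !scalerA addrACA -!scalerDl.
congr (_ *: _ + _ *: _); case: a => x y; apply/eqP; rewrite eq_complex /=;
  apply/andP; split; apply/eqP; ring.
Qed.

Lemma alphaLZ s (a : R) Z : s != 0 -> alphaL s (a%:C *: Z) = a *: alphaL s Z.
Proof.
move=> sn0; apply: (addIr (alphaL s 0)); rewrite -alphaL_linear // -alphaLD //.
Qed.

Lemma alphaL_pair s (a : R[i]) (i j : 'I_3) : 0 < s -> i != j ->
  alpha s (gR R i j) = 0 -> alpha s (gI R i j) = 0 ->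
  alphaL s (a *: delta_mx i j + (- Num.conj a) *: delta_mx j i) = 0.
Proof.
move=> s0 ij aR aI; have sn0 := lt0r_neq0 s0.
have lZ (x : R) Z : alphaL s Z = 0 -> alphaL s (x%:C *: Z) = 0.
  by move=> Z0; rewrite (alphaLZ _ _ sn0) Z0 scaler0.
rewrite pair_gens alphaLD // (lZ _ _ (etrans (alphaLE sn0 (@rotgen_gR R i j ij)) aR)).
by rewrite (lZ _ _ (etrans (alphaLE sn0 (@rotgen_gI R i j ij)) aI)) addr0.
Qed.

(** A tangent vector at [xs s] is the velocity of some Z in su(3) plus a radial vector, and A
    vanishes on both. *)
Lemma A_xs_zero s (w : CM * CM) : 0 < s -> tangent (@E0 R) (xs s, 1%:M) (w, 0) ->
  A (xs s, 1%:M) (w, 0) = 0.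
Proof.
move=> s0 wT; have sn0 := lt0r_neq0 s0.
have [c [cS c0 cv]] := wT.
have D := smooth_curve_is_derive cS; rewrite cv in D.
have fT := findim_TCP R.
have D1 := is_derive_lin (findim_E0 R) fT (l := fst) (fun _ _ _ => erefl) D.
have cT : \forall t \near (0 : R), TCP2 ((fst \o c) t).
  have [I [oI I0 _ IE]] := cS.
  by apply: (filterS _ (open_nbhs_nbhs (conj oI I0))) => t /IE[[]].
have c01 : (fst \o c) 0 = xs s by rewrite /= c0.
have X1 : cplx (xs s).1 = delta_mx 1 1 by exact: uncplxK.
have X2 : cplx (xs s).2 = s%:C *: delta_mx 1 0 by rewrite /xs /= cplxZ uncplxK.
have := tangent_TCP2_equations D1 c01 cT; rewrite X1 X2 -/(w.1) -/(w.2).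
set P := cplx w.1; set Q := cplx w.2 => -[E1 EP E2 E3].
have sC : s%:C != 0 :> R[i] by rewrite eq_complex /= eqxx andbT.
(* The real part of the covector entry is radial; its imaginary part comes from kappa, which changes
   that entry at rate - 2 s i. *)
pose kap : R := - complex.Im (Q 1 0) / (2 * s).
have Pc i j : P j i = Num.conj (P i j).
  by have := congr1 (fun m : C3 => m j i) EP; rewrite trC_entries => ->.
have Ek : s%:C * (- (kap%:C * Ci R) - kap%:C * Ci R) + (complex.Re (Q 1 0))%:C = Q 1 0.
  rewrite /kap /Ci; case: (Q 1 0) => x y; apply/eqP; rewrite eq_complex /=.
  by apply/andP; split; apply/eqP; field.
have cc : Num.conj (- P 1 2) = - P 2 1 by rewrite rmorphN (Pc 1 2).
have c' : s%:C * (- Q 1 2 / s%:C) = - Q 1 2 by rewrite mulrC divfK.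
pose Z : C3 := P 0 1 *: delta_mx 0 1 + (- Num.conj (P 0 1)) *: delta_mx 1 0
  + (- P 1 2 *: delta_mx 1 2 + (- Num.conj (- P 1 2)) *: delta_mx 2 1)
  + ((- Q 1 2 / s%:C) *: delta_mx 0 2 + (- Num.conj (- Q 1 2 / s%:C)) *: delta_mx 2 0)
  + (kap%:C * Ci R) *: (delta_mx 0 0 - delta_mx 1 1).
pose rho := complex.Re (Q 1 0).
have [EP' EQ'] : P = comm Z (delta_mx 1 1) /\ Q = comm Z (s%:C *: delta_mx 1 0) + rho%:C *: delta_mx 1 0.
  exact: (@tangent_equations _ P Q s%:C rho%:C (P 0 1) (- Num.conj (P 0 1)) (- P 1 2) (- Num.conj (- P 1 2))
    (- Q 1 2 / s%:C) (- Num.conj (- Q 1 2 / s%:C)) (kap%:C * Ci R)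
    E1 E2 E3 erefl (congr1 -%R (esym (Pc 0 1))) erefl (etrans (congr1 -%R cc) (opprK _)) c' Ek).
have w1 : w.1 = ad1 Z (xs s).1 + rho *: 0 by rewrite scaler0 addr0 /ad1 X1 -EP' cplxK.
have w2 : w.2 = ad1 Z (xs s).2 + rho *: uncplx (delta_mx 1 0).
  by rewrite /ad1 X2 -uncplxZ -uncplxD -EQ' cplxK.
have w3 : w = ad Z (xs s) + rho *: (0, uncplx (delta_mx 1 0)).
  by rewrite [LHS]surjective_pairing; exact: (f_equal2 pair w1 w2).
have w4 : (0 : M3) = 0 + rho *: 0 by rewrite scaler0 addr0.
have wE : (w, 0) = (ad Z (xs s), 0) + rho *: ((0, uncplx (delta_mx 1 0)), 0) :> E0S.
  exact: (f_equal2 pair w3 w4).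
have Z0 : alphaL s Z = 0.
  have [aK aN1 aN2] := alpha0 s0.
  have add0 u v : alphaL s u = 0 -> alphaL s v = 0 -> alphaL s (u + v) = 0.
    by move=> u0 v0; rewrite (alphaLD _ _ sn0) u0 v0 addr0.
  have zN a := alphaL_pair a s0 (isT : (0 : 'I_3) != 1) aN1 aN2.
  have zS a := alphaL_pair a s0 (isT : (0 : 'I_3) != 2)
    (alpha_R2 s0 (isT : (0 : 'I_3) != 2)) (alpha_I2 s0 (isT : (0 : 'I_3) != 2)).
  have zM a := alphaL_pair a s0 (isT : (1 : 'I_3) != 2)
    (alpha_R2 s0 (isT : (1 : 'I_3) != 2)) (alpha_I2 s0 (isT : (1 : 'I_3) != 2)).
  have zK : alphaL s ((kap%:C * Ci R) *: (delta_mx 0 0 - delta_mx 1 1)) = 0.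
    rewrite -scalerA -[RHS](scaler0 _ kap) -aK -(alphaLE sn0 (rotgen_gK R)).
    exact: (alphaLZ kap (gK R) sn0).
  exact: (add0 _ _ (add0 _ _ (add0 _ _ (zN _) (zM _)) (zS _)) zK).
have zE : E0 (xs s, 1%:M) by split=> /=; [exact: TCP2_star_xs|exact: SO3_1].
have tZ := tangent_radial s0 SO3_1.
have bl := local_extension_linear (b0P sn0) (xs s, 1%:M).
rewrite (local_extension_at (b0P sn0) zE wT) wE (linear_add _ _ bl) (linear_scale _ _ bl).
rewrite -(local_extension_at (b0P sn0) zE tZ) (A_radial s0 SO3_1) scaler0 addr0.
exact: Z0.
Qed.

(** After [A_split] only the value on base vectors at fibre point 1 remains, and invariance moves it
    to a representative. *)
Lemma zero_generators_canonical : is_canonical A.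
Proof.
move=> z v Ez vT; rewrite (A_split vT).
have [zT _] := Ez; have [s [g [s0 gS zE]]] := TCP2_star_orbit zT.
have T1 := tangent_E0_base vT SO3_1.
have E1 : E0 (z.1, 1%:M) by split=> //=; exact: SO3_1.
have gS' := SU3_cadj gS.
have T2 := tangent_E0_su3_act gS' T1.
rewrite -(Ainv gS' E1 T1) /=.
have gz : su3_act (cadj g) z.1 = xs s by rewrite zE -su3_act_cmul cadj_cmul // su3_act1.
rewrite /= gz in T2 *; rewrite (A_xs_zero s0 T2).
by rewrite mulmx0 mul0mx add0r.
Qed.
End ZeroGenerators.

End Invariant.
End InvariantConnections.

Theorem theorem6p9 (R : realType) (L : complex_structure)
    (A : E0_space R -> E0_space R -> 'M[R]_3) :
  principal_connection (@E0 R) (@E0_act R) A ->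
  su3_invariant A ->
  SU4_instanton L A ->
  temporal_gauge A ->
  (extends_across_zero_section A <-> is_canonical A).
Proof.
move=> Aconn Ainv Ainst Atemp; split=> [Aext|]; last exact: canonical_extends.
exact: zero_generators_canonical (extension_alpha Aconn Ainv Atemp Ainst Aext).
Qed.
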